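(* Let $(E,d)$ be a Polish space, $x_0\in E$, let $(X_i)_{1\le i\le n}$ be i.i.d. $E$-valued random variables with common law $\mu$, $X$ a random variable with law $\mu$, and $L_n=\frac1n\sum_{i=1}^n\delta_{X_i}$. Let $S\subset E$ with $\mu(S)=1$. Let $p\ge1$ and assume there exist $\alpha<2p$ (with $\alpha>0$) and $\beta>0$ such that for every $r>0$ and every $\delta\in(0,2r]$, $N(S\cap B(x_0,r),\delta)\le\beta(2r/\delta)^\alpha$. Then, with positive constants $C_{\cdot}$ depending only on the indicated parameters: (1) If $\|X\|_{rp,w}<\infty$ for some $r>2$, then for any $q>r$ and any $x>0$, $$\mathbb P(W_p^p(L_n,\mu)>x)\le e^2\exp\left(-nC_{p,\alpha,\beta}\left[\frac{x}{I_{2p,p}}\right]^2\right)\mathbf 1_{x\le C_p\|d(x_0,X)\|_p^p}+C_{p,q,r}\left\{\frac{I_{2p,p}^q}{x^qn^{q/2}}+\frac{\|X\|_{rp,w}^{rp}}{x^rn^{r-1}}\right\}.$$ (2) If $I_{2p,p}<\infty$, then for any $x>0$, $\mathbb P(W_p^p(\mu,L_n)>x)\le C_{p,\alpha,\beta}\frac{I_{2p,p}^2}{x^2n}$. (3) If $\|X\|_{rp,w}<\infty$ for some $r\in(1,2)$, then for any $x>0$, $\mathbb P(W_p^p(\mu,L_n)>x)\le C_{p,\alpha,\beta,r}\frac{\|X\|_{rp,w}^{rp}}{x^rn^{r-1}}$.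
   Context: For $p\ge1$ and probability measures $\mu,\nu$ on $E$ with finite $p$-th moments, $W_p^p(\mu,\nu)=\inf_{\pi}\int d^p(x,y)\,\pi(dx,dy)$ over couplings $\pi$ of $\mu$ and $\nu$. For a bounded set $Y\subset E$ and $\delta>0$, $N(Y,\delta)$ is the minimal $m\in\mathbb N$ such that there exist $y_1,\dots,y_m\in Y$ with $Y\subset\bigcup_{j}B(y_j,\delta)$, $B(y,\rho)$ being the closed ball. The tail function is $H(t)=\mu(B(x_0,t)^c)$, the weak moment of order $s\ge1$ is defined by $\|X\|_{s,w}^s=\sup_{t\ge0}t^sH(t)$, and $I_{2p,p}=\int_0^\infty\sqrt{H(t)}\,t^{p-1}dt$. Also $\|d(x_0,X)\|_p^p=\mathbb E[d(x_0,X)^p]$. *)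

(* Defs.v *)
From HB Require Import structures.
From mathcomp Require Import all_boot all_order all_algebra.
From mathcomp Require Import all_classical all_reals all_analysis.
Set Implicit Arguments. Unset Strict Implicit. Unset Printing Implicit Defensive.
Import Order.TTheory GRing.Theory Num.Theory.
Import numFieldNormedType.Exports.
Local Open Scope classical_set_scope.
Local Open Scope ring_scope.

Section Defs.
Variable R : realType.

Section Metric.
Context {E : Type} (d : E -> E -> R).

Definition is_metric : Prop :=
  (forall x y, 0 <= d x y) /\ (forall x y, d x y = 0 <-> x = y) /\
  (forall x y, d x y = d y x) /\ (forall x y z, d x z <= d x y + d y z).

Definition cball (x : E) (r : R) : set E := [set y | d x y <= r].
Definition oball (x : E) (r : R) : set E := [set y | d x y < r].

Definition d_open (A : set E) : Prop :=
  forall x, A x -> exists2 e : R, 0 < e & oball x e `<=` A.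

Definition d_complete : Prop :=
  forall u : nat -> E,
    (forall e : R, 0 < e -> exists N, forall m k, (N <= m)%N -> (N <= k)%N -> d (u m) (u k) < e) ->
    exists l, forall e : R, 0 < e -> exists N, forall m, (N <= m)%N -> d (u m) l < e.

Definition d_separable : Prop :=
  exists D : nat -> E, forall x (e : R), 0 < e -> exists k, d x (D k) < e.

(** N(Y, delta): minimal number of closed delta-balls centred in Y covering Y
    (+oo if there is no finite such cover) *)
Definition covering_number (Y : set E) (delta : R) : \bar R :=
  ereal_inf [set ((m%:R : R)%:E) | m in
    [set m : nat | exists y : 'I_m -> E,
        (forall j, Y (y j)) /\ Y `<=` [set z | exists j, cball (y j) delta z]]].
End Metric.

Definition polish {dE : measure_display} (E : measurableType dE) (d : E -> E -> R) : Prop :=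
  [/\ is_metric d, d_complete d, d_separable d &
      (@measurable _ E) = <<s [set A | d_open d A] >>].

Section Probabilistic.
Context {dE : measure_display} {E : measurableType dE} (d : E -> E -> R).

Definition tailH (x0 : E) (mu : probability E R) (t : R) : R :=
  fine (mu (~` cball d x0 t)).

Definition weak_moment (x0 : E) (mu : probability E R) (s : R) : \bar R :=
  ereal_sup [set ((t `^ s) * tailH x0 mu t)%:E | t in [set t : R | 0 <= t]].

Definition I2pp (x0 : E) (mu : probability E R) (p : R) : \bar R :=
  (\int[@lebesgue_measure R]_(t in `[0%R, +oo[%classic)
      ((Num.sqrt (tailH x0 mu t)) * t `^ (p - 1))%:E)%E.

Definition pmoment (x0 : E) (mu : probability E R) (p : R) : \bar R :=
  (\int[mu]_y ((d x0 y) `^ p)%:E)%E.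

Definition coupling (m1 m2 : set E -> \bar R) (pi : probability (E * E)%type R) : Prop :=
  (forall A, measurable A -> pi (A `*` setT) = m1 A) /\
  (forall B, measurable B -> pi (setT `*` B) = m2 B).

Definition Wpp (p : R) (m1 m2 : set E -> \bar R) : \bar R :=
  ereal_inf [set (\int[pi]_z ((d z.1 z.2) `^ p)%:E)%E
            | pi in [set pi : probability (E * E)%type R | coupling m1 m2 pi]].

Definition empirical (n : nat) (xs : 'I_n -> E) : set E -> \bar R :=
  fun A => (((n%:R : R)^-1)%:E * (\sum_(i < n) \d_(xs i) A))%E.
End Probabilistic.

Definition iid {dO : measure_display} {O : measurableType dO} (P : probability O R)
  {dE : measure_display} {E : measurableType dE} (mu : probability E R)
  (n : nat) (X : 'I_n -> O -> E) : Prop :=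
  [/\ (forall i, measurable_fun setT (X i)),
      (forall i B, measurable B -> P (X i @^-1` B) = mu B) &
      (forall B : 'I_n -> set E, (forall i, measurable (B i)) ->
         P (\bigcap_(i in [set: 'I_n]) (X i @^-1` B i)) =
         (\prod_(i < n) P (X i @^-1` B i))%E)].

End Defs.
Arguments empirical {R dE E n}.

(* Main.v *)
(* Restrict to a large ball [B(x0, rho)], cut it into dyadic shells around [x0] and
   refine each shell by nested partitions obtained from the covering numbers.
   Transporting mass level by level bounds [W_p^p (L_n, mu)] by a deterministic remainder
   plus [n^-1] times the l^1 norm of a centred random walk whose coordinates are the
   weighted fluctuations of the cell counts, so only finitely many labels are involved.
   Writing [spread] for the sum over the coordinates of the standard deviation of a step,
   the second moment of this norm is at most [n spread ^ 2], and [alpha < 2 p] makes the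
   sum over the levels geometric, which leaves [spread <= C I_{2p,p}].  Chebyshev's
   inequality gives (2), and also (3) once the radius is chosen with [rho ^ p = n x].
   For (1), iterating the Hoffmann-Jorgensen inequality raises the quadratic tail to any
   power, at the price of the probability of one large jump, which the weak moment
   controls; when [x] is of the order of [I_{2p,p} / sqrt n] the exponential term exceeds
   [1], and when [x] exceeds a multiple of the p-th moment the shells alone suffice, so
   that the constants no longer involve the covering numbers. *)
Require Import Defs.
From HB Require Import structures.
From mathcomp Require Import all_boot all_order all_algebra.
From mathcomp Require Import all_classical all_reals all_analysis measurable_realfun.
From mathcomp Require Import ring lra.
Set Implicit Arguments. Unset Strict Implicit. Unset Printing Implicit Defensive.
Import Order.TTheory GRing.Theory Num.Theory.
Import numFieldNormedType.Exports.
Local Open Scope classical_set_scope.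
Local Open Scope ring_scope.

(** * Real powers, finite sums and one-sided limits *)

Section PowR.
Context {R : realType}.
Implicit Types a b c p r s : R.

Lemma ler_powRl r a b : 0 <= r -> 0 <= a -> a <= b -> a `^ r <= b `^ r.
Proof. by move=> r0 a0 ab; rewrite ge0_ler_powR ?nnegrE // (le_trans a0). Qed.

Lemma powR_le1 r a : 0 <= r -> 0 <= a -> a <= 1 -> a `^ r <= 1.
Proof. by move=> r0 a0 /(ler_powRl r0 a0); rewrite powR1. Qed.

Lemma powR_ge1 r a : 0 <= r -> 1 <= a -> 1 <= a `^ r.
Proof. by move=> r0 /(ler_powRl r0 ler01); rewrite powR1. Qed.

Lemma powR_lt1 r a : 1 < a -> r < 0 -> a `^ r < 1.
Proof.
move=> a1 r0; have a0 : 0 < a by rewrite (lt_trans ltr01).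
rewrite -[r]opprK powRN invf_lt1 ?powR_gt0 // -[ltLHS](powRr0 a).
by rewrite /powR gt_eqF // mul0r ltr_expR mulr_gt0 ?oppr_gt0 ?ln_gt0.
Qed.

Lemma powRV a r : 0 <= a -> a^-1 `^ r = (a `^ r)^-1.
Proof. by move=> a0; rewrite -powR_inv1 // -powRrM mulN1r powRN. Qed.

Lemma powRK a r : r != 0 -> 0 <= a -> (a `^ r^-1) `^ r = a.
Proof. by move=> r0 a0; rewrite -powRrM mulVf // powRr1. Qed.

Lemma gt0_powRD a r s : 0 < a -> a `^ (r + s) = a `^ r * a `^ s.
Proof. by move=> a0; rewrite powRD // (gt_eqF a0) implybT. Qed.

Lemma powR_exprn a r n : 0 <= a -> (a ^+ n) `^ r = (a `^ r) ^+ n.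
Proof.
by move=> a0; rewrite -powR_mulrn // -powRrM mulrC powRrM powR_mulrn ?powR_ge0.
Qed.

Lemma sqrt_powR a r : Num.sqrt (a `^ r) = a `^ (r / 2).
Proof. by rewrite -powR12_sqrt ?powR_ge0 // -powRrM. Qed.

(* Split according to whether the second summand is at most [c] times the first. *)
Lemma powR_add_le p a b c : 0 <= p -> 0 <= a -> 0 <= b -> 0 < c ->
  (a + b) `^ p <= (1 + c) `^ p * a `^ p + (1 + c^-1) `^ p * b `^ p.
Proof.
move=> p0 a0 b0 c0; have ci0 : 0 < c^-1 by rewrite invr_gt0.
rewrite -!powRM ?addr_ge0 ?(ltW c0) ?(ltW ci0) //.
have [bca|/ltW cab] := lerP b (c * a).
  rewrite ler_wpDr ?powR_ge0 // ler_powRl ?addr_ge0 //.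
  by rewrite mulrDl mul1r lerD2l.
rewrite ler_wpDl ?powR_ge0 // ler_powRl ?addr_ge0 //.
by rewrite mulrDl mul1r addrC lerD2l ler_pdivlMl.
Qed.

Lemma dyadic_above a : 1 < a -> exists2 j : nat, 2 ^+ j < a & a <= 2 ^+ j.+1.
Proof.
move=> a1; have ex : exists m : nat, a <= 2 ^+ m.
  by exists (Num.bound a); apply/ltW/upper_nthrootP.
case: (ex_minnP ex) => -[|m] am min_m; first by rewrite expr0 leNgt a1 in am.
exists m => //; rewrite ltNge; apply/negP => /min_m.
by rewrite ltnn.
Qed.

Lemma exists_invn_lt (e : R) : 0 < e -> exists k : nat, k.+1%:R^-1 < e.
Proof.
move=> e0; have [k _ /(_ k (leqnn k))] := near_infty_natSinv_lt (PosNum e0).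
by exists k.
Qed.

Lemma exists_dyadic_powR_le c e p : 0 <= c -> 0 < e -> 0 < p ->
  exists K : nat, (c / 2 ^+ K) `^ p <= e.
Proof.
move=> c0 e0 p0; have r0 : 0 < e `^ p^-1 by rewrite powR_gt0.
exists (Num.bound (c / e `^ p^-1)).
rewrite -[leRHS](@powRK e p) ?gt_eqF ?(ltW e0) //.
rewrite ler_powRl ?divr_ge0 ?exprn_ge0 ?(ltW p0) //.
rewrite ler_pdivrMr ?exprn_gt0 // mulrC -ler_pdivrMr //.
exact/ltW/upper_nthrootP.
Qed.

Lemma exists_powRN_le c e p : 0 <= c -> 0 < e -> 0 < p ->
  exists2 x, 1 <= x & c * x `^ (- p) <= e.
Proof.
move=> c0 e0 p0; have ce0 : 0 <= c / e by rewrite divr_ge0 // ltW.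
pose x := Num.max 1 ((c / e) `^ p^-1).
have x1 : 1 <= x by rewrite le_max lexx.
exists x => //; rewrite powRN ler_pdivrMr ?powR_gt0 ?(lt_le_trans ltr01) //.
rewrite mulrC -ler_pdivrMr // -[leLHS](@powRK _ p) ?gt_eqF //.
by rewrite ler_powRl ?powR_ge0 ?(ltW p0) // le_max lexx orbT.
Qed.

Lemma exists_powR_between a b e p : 0 <= a -> a < b -> 0 < e -> 0 < p ->
  exists u, [/\ a < u, u <= b & u `^ p <= a `^ p + e].
Proof.
move=> a0 ab e0 p0; pose u := Num.min b ((a `^ p + e) `^ p^-1).
have ape0 : 0 <= a `^ p + e by rewrite addr_ge0 ?powR_ge0 // ltW.
have powu : ((a `^ p + e) `^ p^-1) `^ p = a `^ p + e by rewrite powRK ?gt_eqF.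
have au : a < u.
  rewrite lt_min ab ltNge; apply/negP => /(ler_powRl (ltW p0) (powR_ge0 _ _)).
  by rewrite powu leNgt ltrDl e0.
exists u; split => //; first by rewrite ge_min lexx.
by rewrite -powu ler_powRl ?(ltW p0) ?(le_trans a0 (ltW au)) // ge_min lexx orbT.
Qed.

End PowR.

Section FiniteSums.
Context {R : realType}.

Lemma ler_sum_geometric (f : nat -> R) (c z : R) n : 0 <= c -> 0 < z -> z < 1 ->
  (forall k, f k <= c * z ^+ k) -> \sum_(k < n) f k <= c / (1 - z).
Proof.
move=> c0 z0 z1 fcz; have zn1 : `|z| < 1 by rewrite gtr0_norm.
apply: le_trans (geometric_le_lim n c0 z0 zn1).
by rewrite /series /= big_mkord; apply: ler_sum.
Qed.

(* Sedrakyan's (or Titu's) form of the Cauchy-Schwarz inequality. *)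
Lemma sqr_sum_le (I : finType) (P : pred I) (u c : I -> R) : (forall i, 0 < c i) ->
  (\sum_(i | P i) u i) ^+ 2 <=
  (\sum_(i | P i) c i) * \sum_(i | P i) (u i ^+ 2 / c i).
Proof.
move=> c0; set U := \sum_(i | P i) u i; set C := \sum_(i | P i) c i.
set Q := \sum_(i | P i) _.
have C0 : 0 <= C by apply: sumr_ge0 => i _; exact: ltW.
have CQU : 0 <= C * (C * Q - U ^+ 2).
  have -> : C * (C * Q - U ^+ 2) = \sum_(i | P i) (C * u i - U * c i) ^+ 2 / c i.
    rewrite (eq_bigr (fun i => C ^+ 2 * (u i ^+ 2 / c i) - 2 * C * U * u i + U ^+ 2 * c i)).
      by rewrite big_split sumrB /= -!mulr_sumr -/U -/C -/Q; ring.
    by move=> i _; field; rewrite gt_eqF.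
  by apply: sumr_ge0 => i _; rewrite divr_ge0 ?sqr_ge0 // ltW.
have [Cp|] := ltP 0 C; first by rewrite -subr_ge0 -(pmulr_rge0 _ Cp).
rewrite le_eqVlt ltNge C0 orbF psumr_eq0 => [/allP P0|i _]; last exact: ltW.
rewrite /U big1 ?expr0n ?mulr_ge0 //; last first.
  by move=> i Pi; have := P0 i (mem_index_enum i); rewrite Pi gt_eqF.
by apply: sumr_ge0 => i _; rewrite divr_ge0 ?sqr_ge0 // ltW.
Qed.

Lemma sum_sqrt_le (I : finType) (A : {pred I}) (f : I -> R) : (forall i, 0 <= f i) ->
  \sum_(i in A) Num.sqrt (f i) <= Num.sqrt #|A|%:R * Num.sqrt (\sum_(i in A) f i).
Proof.
move=> f0; have := @sqr_sum_le I (mem A) (fun i => Num.sqrt (f i)) (fun=> 1) (fun=> ltr01).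
rewrite sumr_const; under [X in _ <= _ * X]eq_bigr do rewrite divr1 sqr_sqrtr //.
move=> /ler_wsqrtr; rewrite sqrtr_sqr ger0_norm ?sqrtrM //.
by apply: sumr_ge0 => i _; exact: sqrtr_ge0.
Qed.

End FiniteSums.

Section RightLimits.
Context {R : realType}.
Implicit Types a b c k d : R.

Lemma lee_sqr_affine (y : \bar R) a b c k d : 0 < d ->
  (forall e, 0 < e -> e < d -> (y <= (a + b * e + c * (k + e) ^+ 2)%:E)%E) ->
  (y <= (a + c * k ^+ 2)%:E)%E.
Proof.
move=> d0 y_le; pose f (e : R) := a + b * e + c * (k + e) ^+ 2.
have -> : a + c * k ^+ 2 = f 0 by rewrite /f mulr0 !addr0.
have f_lim : f e @[e --> 0^'+] --> f 0.
  have k_lim : k + e @[e --> 0] --> k + 0 by apply: cvgD; [exact: cvg_cst|exact: cvg_id].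
  apply: cvg_at_right_filter; apply: cvgD.
    by apply: cvgD; [exact: cvg_cst|apply: cvgM; [exact: cvg_cst|exact: cvg_id]].
  by apply: cvgM; [exact: cvg_cst|exact: (cvgM k_lim k_lim)].
have lim : (f e)%:E @[e --> 0^'+] --> (f 0)%:E by apply: cvg_EFin => //; exact: nearW.
apply: (cvge_to_ge lim).
near=> e; apply: y_le; near: e; [exact: nbhs_right_gt|exact: nbhs_right_lt].
Unshelve. all: by end_near. Qed.

Lemma ler_sqr_addgt0 (x c k : R) : (forall e, 0 < e -> x <= c * (k + e) ^+ 2) ->
  x <= c * k ^+ 2.
Proof.
move=> x_le; rewrite -lee_fin -[c * _]add0r; apply: (lee_sqr_affine (b := 0) ltr01) => e e0 _.
by rewrite mul0r !add0r lee_fin x_le.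
Qed.

End RightLimits.

(** * Random walks with finitely many steps *)

Section RandomWalk.
Context {R : realFieldType} {V : normedZmodType R} {T : finType}.
Variables (law : T -> R) (step : T -> V).
Hypothesis law_ge0 : forall t, 0 <= law t.
Hypothesis law_sum1 : \sum_t law t = 1.
Implicit Types (v w : V) (f g : V -> R) (h s : R).

Fixpoint walk_mean (n : nat) (f : V -> R) (v : V) : R :=
  if n is m.+1 then \sum_t law t * walk_mean m f (v + step t) else f v.

Definition end_prob (n : nat) (h : R) : V -> R := walk_mean n (fun v => (h < `|v|)%R%:R).

Fixpoint max_prob (n : nat) (h : R) (v : V) : R :=
  if h < `|v| then 1 else
  if n is m.+1 then \sum_t law t * max_prob m h (v + step t) else 0.

Definition jump_prob (s : R) : R := \sum_(t | s < `|step t|) law t.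

Lemma ler_mean (f g : T -> R) : (forall t, f t <= g t) ->
  \sum_t law t * f t <= \sum_t law t * g t.
Proof. by move=> fg; apply: ler_sum => t _; rewrite ler_wpM2l. Qed.

Lemma mean_cst (c : R) : \sum_t law t * c = c.
Proof. by rewrite -mulr_suml law_sum1 mul1r. Qed.

Lemma walk_mean_le n f g v : (forall w, f w <= g w) -> walk_mean n f v <= walk_mean n g v.
Proof. by move=> fg; elim: n v => [|n IH] v //=; apply: ler_mean. Qed.

Lemma walk_meanZ n c f v : walk_mean n (fun w => c * f w) v = c * walk_mean n f v.
Proof.
elim: n v => [|n IH] v //=; rewrite mulr_sumr; apply: eq_bigr => t _.
by rewrite IH mulrCA.
Qed.

Lemma walk_mean_sum n (I : finType) (f : I -> V -> R) v :
  walk_mean n (fun w => \sum_i f i w) v = \sum_i walk_mean n (f i) v.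
Proof.
elim: n v => [|n IH] v //=; rewrite exchange_big /=; apply: eq_bigr => t _.
by rewrite IH mulr_sumr.
Qed.

Lemma end_prob_ge0 n h v : 0 <= end_prob n h v.
Proof.
rewrite /end_prob; elim: n v => [|n IH] v /=; first exact: ler0n.
by apply: sumr_ge0 => t _; rewrite mulr_ge0.
Qed.

Lemma max_prob_ge0 n h v : 0 <= max_prob n h v.
Proof.
elim: n v => [|n IH] v /=; case: ifP => // _.
by apply: sumr_ge0 => t _; rewrite mulr_ge0.
Qed.

Lemma max_prob_le1 n h v : max_prob n h v <= 1.
Proof.
elim: n v => [|n IH] v /=; case: ifP => // _.
by rewrite -[leRHS]mean_cst; apply: ler_mean.
Qed.

Lemma jump_prob_ge0 s : 0 <= jump_prob s.
Proof. exact: sumr_ge0. Qed.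

Lemma jump_probE s : jump_prob s = \sum_t law t * (s < `|step t|)%R%:R.
Proof. by rewrite /jump_prob big_mkcond; apply: eq_bigr => t _; rewrite mulr_natr mulrb. Qed.

Lemma jump_prob_anti s s' : s <= s' -> jump_prob s' <= jump_prob s.
Proof.
move=> ss'; rewrite !jump_probE; apply: ler_mean => t.
by case: (ltP s' _) => [/(le_lt_trans ss') ->|_] //; rewrite ler_nat.
Qed.

Lemma end_prob_le_max n h v : end_prob n h v <= max_prob n h v.
Proof.
rewrite /end_prob; elim: n v => [|n IH] v /=; case: ifP => // _; last exact: ler_mean.
rewrite -[leRHS]mean_cst; apply: ler_mean => t.
exact: le_trans (IH _) (max_prob_le1 _ _ _).
Qed.

Lemma max_prob_eq1 n h v : h < `|v| -> max_prob n h v = 1.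
Proof. by case: n => [|n] /= ->. Qed.

Lemma max_probS n h v : `|v| <= h ->
  max_prob n.+1 h v = \sum_t law t * max_prob n h (v + step t).
Proof. by move=> vh /=; rewrite ltNge vh. Qed.

Lemma max_prob_leS n h v : max_prob n h v <= max_prob n.+1 h v.
Proof.
elim: n v => [|n IH] v; rewrite [leLHS]/= [leRHS]/=; case: ifP => // _.
  by apply: sumr_ge0 => t _; rewrite mulr_ge0 //; case: ifP.
exact: ler_mean.
Qed.

Lemma max_prob_shift n h h' v w : `|v - w| <= h - h' -> max_prob n h v <= max_prob n h' w.
Proof.
elim: n v w => [|n IH] v w vw.
all: have hw : h < `|v| -> h' < `|w| by have := ler_distD w v 0; rewrite !subr0; lra.
  by rewrite /=; case: ifP => [/hw ->|_] //; case: ifP.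
have [/hw/max_prob_eq1 ->|vh] := ltP h `|v|; first exact: max_prob_le1.
rewrite max_probS //; have [/max_prob_eq1 ->|wh] := ltP h' `|w|.
  by rewrite -(max_probS _ vh) max_prob_le1.
rewrite max_probS //; apply: ler_mean => t; apply: IH.
by rewrite opprD addrACA subrr addr0.
Qed.

Lemma max_prob_anti n h h' v : h <= h' -> max_prob n h' v <= max_prob n h v.
Proof. by move=> hh'; apply: max_prob_shift; rewrite subrr normr0 subr_ge0. Qed.

(* Conditionally on the first passage above [h], the walk starts afresh from a
   point of norm at most [h + s] unless a jump larger than [s] occurred. *)
Lemma hoffmann_jorgensen n h s v : 0 <= s -> `|v| <= h ->
  max_prob n (3 * h + s) v <=
  max_prob n h v * max_prob n (2 * h) 0 + n%:R * jump_prob s.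
Proof.
move=> s0; elim: n v => [|n IH] v vh; have h0 : 0 <= h := le_trans (normr_ge0 v) vh.
  by rewrite /= !ltNge vh /= !mul0r addr0 ifF // leNgt; apply/negbTE; rewrite -leNgt; lra.
set M := max_prob n.+1 (2 * h) 0.
have M0 : 0 <= M by exact: max_prob_ge0.
have J0 := jump_prob_ge0 s.
rewrite (max_probS _ vh) max_probS; last by lra.
have -> : n.+1%:R * jump_prob s =
    \sum_t (law t * (n%:R * jump_prob s) + law t * (s < `|step t|)%R%:R).
  by rewrite big_split /= mean_cst -jump_probE -[n.+1%:R]natr1 mulrDl mul1r.
rewrite mulr_suml -big_split /=.
apply: ler_sum => t _; rewrite -mulrA -!mulrDr ler_wpM2l //.
have [big_jump|small_jump] := ltP s `|step t|.
  apply: le_trans (max_prob_le1 _ _ _) _.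
  by rewrite addrA ler_wpDl // addr_ge0 // mulr_ge0 // max_prob_ge0.
rewrite addr0; have [vt|vt] := leP `|v + step t| h.
  apply: le_trans (IH _ vt) _; rewrite lerD2r ler_wpM2l ?max_prob_ge0 //.
  exact: max_prob_leS.
rewrite (max_prob_eq1 _ vt) mul1r -[leLHS]addr0 lerD ?mulr_ge0 //.
apply: le_trans (max_prob_leS _ _ _); apply: max_prob_shift.
by rewrite subr0; have := ler_normD v (step t); lra.
Qed.

(* Two walks driven by the same steps stay at constant distance, so one of them
   ends at norm at least half that distance. *)
Lemma end_prob_dist n h v w : 2 * h < `|v - w| -> 1 <= end_prob n h v + end_prob n h w.
Proof.
rewrite /end_prob; elim: n v w => [|n IH] v w vw /=.
  have := ler_normB v w.
  case: (ltP h `|v|) => hv; first by rewrite lerDl ler0n.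
  by case: (ltP h `|w|) => hw; rewrite ?lerDr ?ler0n //; lra.
rewrite -big_split /= -[leLHS]mean_cst; apply: ler_sum => t _.
by rewrite -mulrDr ler_wpM2l // IH // opprD addrACA subrr addr0.
Qed.

Lemma ottaviani n h v : (forall k, (k <= n)%N -> end_prob k h 0 <= 2^-1) ->
  max_prob n (2 * h) v <= 2 * end_prob n h v.
Proof.
move=> half; have far k w : (k <= n)%N -> 2 * h < `|w| -> 1 <= 2 * end_prob k h w.
  by move=> /half; have := @end_prob_dist k h w 0; rewrite subr0 => + + hw => /(_ hw); lra.
have : (n <= n)%N by []; move: {1 3 4}n => k; elim: k v => [|k IH] v kn.
  rewrite [leLHS]/=; case: ifPn => [|_]; first exact: far.
  by rewrite mulr_ge0 ?end_prob_ge0.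
rewrite [leLHS]/=; case: ifPn => [|_]; first exact: far.
rewrite /end_prob /= mulr_sumr; apply: ler_sum => t _.
by rewrite mulrCA ler_wpM2l // IH // ltnW.
Qed.

Fixpoint hj_cst (j : nat) : R := if j is i.+1 then 2 * hj_cst i ^+ 2 + 1 else 1.

Lemma hj_cst_ge1 j : 1 <= hj_cst j.
Proof. by case: j => //= j; rewrite lerDr mulr_ge0 ?sqr_ge0. Qed.

Lemma max_prob_iter n j h : 0 <= h ->
  max_prob n (4 ^+ j * h) 0 <=
  hj_cst j * (max_prob n h 0 ^+ (2 ^ j) + n%:R * jump_prob h).
Proof.
move=> h0; set J := n%:R * jump_prob h; set q := max_prob n h 0.
have J0 : 0 <= J by rewrite mulr_ge0 // jump_prob_ge0.
elim: j => [|j IH]; first by rewrite expr0 !mul1r expr1 lerDl.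
have C1 := hj_cst_ge1 j.
set t := 4 ^+ j * h in IH; have t0 : 0 <= t by rewrite mulr_ge0 // exprn_ge0.
set M := max_prob n t 0 in IH; have M0 : 0 <= M by exact: max_prob_ge0.
have once : max_prob n (4 ^+ j.+1 * h) 0 <= M ^+ 2 + J.
  have -> : 4 ^+ j.+1 * h = 3 * t + t by rewrite exprS /t; ring.
  apply: le_trans (hoffmann_jorgensen n t0 _) _; first by rewrite normr0.
  apply: lerD; last first.
    by rewrite ler_wpM2l // jump_prob_anti // ler_peMl // exprn_ege1 // ler1n.
  by rewrite expr2 ler_wpM2l // max_prob_anti //; lra.
rewrite [hj_cst j.+1]/= expnS mulnC exprM; set Q := q ^+ (2 ^ j) in IH *.
have Q0 : 0 <= Q by rewrite exprn_ge0 // max_prob_ge0.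
have [J1|J1] := lerP 1 J.
  by apply: le_trans (max_prob_le1 _ _ _) _; nra.
apply: le_trans once _.
have M2 : M ^+ 2 <= (hj_cst j * (Q + J)) ^+ 2.
  by rewrite lerXn2r ?nnegrE // mulr_ge0 ?addr_ge0 // (le_trans ler01).
have QJ2 : (Q + J) ^+ 2 <= 2 * (Q ^+ 2 + J).
  have := sqr_ge0 (Q - J); have : J ^+ 2 <= J by rewrite expr2 ler_piMl // ltW.
  by rewrite sqrrB sqrrD; lra.
have C2 : hj_cst j ^+ 2 * (Q + J) ^+ 2 <= hj_cst j ^+ 2 * (2 * (Q ^+ 2 + J)).
  by rewrite ler_wpM2l ?sqr_ge0.
have := sqr_ge0 Q; rewrite exprMn in M2; lra.
Qed.

End RandomWalk.

Arguments hj_cst {R} j.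

Definition l1 (R : Type) (J : finType) : Type := {ffun J -> R}.

Section L1.
Context {R : numDomainType} {J : finType}.

HB.instance Definition _ := GRing.Zmodule.on (l1 R J).

Implicit Types v w : l1 R J.

Definition l1_norm v : R := \sum_F `|v F|.

Let l1_normD v w : l1_norm (v + w) <= l1_norm v + l1_norm w.
Proof. by rewrite -big_split; apply: ler_sum => F _; rewrite ffunE ler_normD. Qed.

Let l1_norm_eq0 v : l1_norm v = 0 -> v = 0.
Proof.
move=> /eqP; rewrite psumr_eq0 // => /allP v0; apply/ffunP => F; rewrite ffunE.
by apply/eqP; rewrite -normr_eq0; exact: v0 (mem_index_enum F).
Qed.

Let l1_normMn v n : l1_norm (v *+ n) = l1_norm v *+ n.
Proof.
by rewrite -sumrMnl; apply: eq_bigr => F _; rewrite ffunMnE normrMn.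
Qed.

Let l1_normN v : l1_norm (- v) = l1_norm v.
Proof. by apply: eq_bigr => F _; rewrite ffunE normrN. Qed.

HB.instance Definition _ := Num.Zmodule_isNormed.Build R (l1 R J)
  l1_normD l1_norm_eq0 l1_normMn l1_normN.

Lemma l1_normE v : `|v| = \sum_F `|v F|.
Proof. by []. Qed.

End L1.

Section SecondMoment.
Context {R : realType} {T J : finType}.
Variables (law : T -> R) (step : T -> l1 R J).
Hypothesis law_ge0 : forall t, 0 <= law t.
Hypothesis law_sum1 : \sum_t law t = 1.
Hypothesis step_mean0 : forall F, \sum_t law t * step t F = 0.

Definition step_var (F : J) : R := \sum_t law t * step t F ^+ 2.

Definition spread : R := \sum_F Num.sqrt (step_var F).

Lemma step_var_ge0 F : 0 <= step_var F.
Proof. by apply: sumr_ge0 => t _; rewrite mulr_ge0 ?sqr_ge0. Qed.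

Lemma spread_ge0 : 0 <= spread.
Proof. by apply: sumr_ge0 => F _; exact: sqrtr_ge0. Qed.

Lemma walk_mean_sqr n F (v : l1 R J) :
  walk_mean law step n (fun w => w F ^+ 2) v = v F ^+ 2 + n%:R * step_var F.
Proof.
elim: n v => [|n IH] v /=; first by rewrite mul0r addr0.
under eq_bigr do rewrite IH ffunE sqrrD.
rewrite (eq_bigr (fun t => law t * (v F ^+ 2 + n%:R * step_var F) +
    2 * v F * (law t * step t F) + law t * step t F ^+ 2)); last by move=> t _; ring.
rewrite !big_split /= -mulr_sumr step_mean0 mulr0 addr0 mean_cst //.
by rewrite -addrA -natr1 mulrDl mul1r.
Qed.

Lemma walk_mean_sqr_norm n :
  walk_mean law step n (fun w => `|w| ^+ 2) 0 <= n%:R * spread ^+ 2.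
Proof.
apply: ler_sqr_addgt0 => e e0; pose c F := Num.sqrt (step_var F) + e / #|J|.+1%:R.
have c_gt F : Num.sqrt (step_var F) < c F by rewrite ltrDl divr_gt0.
have c0 F : 0 < c F := le_lt_trans (sqrtr_ge0 _) (c_gt F).
have sum_c : \sum_F c F <= spread + e.
  rewrite big_split /= lerD2l sumr_const -[_ *+ _]mulr_natr mulrAC ler_pdivrMr //.
  by rewrite ler_wpM2l ?ler_nat // ltW.
have sum_c0 : 0 <= \sum_F c F by apply: sumr_ge0 => F _; exact: ltW.
apply: (@le_trans _ _ (n%:R * (\sum_F c F) ^+ 2)); last first.
  by rewrite ler_wpM2l // lerXn2r ?nnegrE // (le_trans sum_c0).
apply: le_trans (walk_mean_le step law_ge0 n 0 (fun w =>
  sqr_sum_le xpredT (fun F => `|w F|) c0)) _.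
rewrite walk_meanZ walk_mean_sum expr2 mulrCA ler_wpM2l // mulr_sumr.
apply: ler_sum => F _.
rewrite -[X in X <= _](_ : (c F)^-1 * walk_mean law step n (fun w => w F ^+ 2) 0 = _).
  rewrite walk_mean_sqr ffunE expr0n add0r mulrCA ler_wpM2l // ler_pdivrMl //.
  rewrite -[step_var F]sqr_sqrtr ?step_var_ge0 // -expr2.
  by rewrite lerXn2r ?nnegrE ?sqrtr_ge0 // ltW.
rewrite -walk_meanZ; congr walk_mean; apply/funext => w.
by rewrite real_normK ?num_real // mulrC.
Qed.

Lemma end_prob_le_spread n h : 0 < h ->
  end_prob law step n h 0 <= n%:R * spread ^+ 2 / h ^+ 2.
Proof.
move=> h0; have h20 : 0 < h ^+ 2 by rewrite exprn_gt0.
rewrite ler_pdivlMr //; apply: le_trans (walk_mean_sqr_norm n).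
rewrite mulrC -walk_meanZ; apply: walk_mean_le => // w.
case: ltP => hw; last by rewrite mulr0 sqr_ge0.
by rewrite mulr1 lerXn2r ?nnegrE // ltW.
Qed.

Lemma max_prob_le_spread n h : 0 < h ->
  max_prob law step n h 0 <= 8 * (n%:R * spread ^+ 2 / h ^+ 2).
Proof.
move=> h0; have h20 : 0 < h / 2 by rewrite divr_gt0.
have half m : m%:R * spread ^+ 2 / (h / 2) ^+ 2 = 4 * (m%:R * spread ^+ 2 / h ^+ 2).
  by field; rewrite gt_eqF.
have [small|big] := lerP (4 * (n%:R * spread ^+ 2 / h ^+ 2)) 2^-1; last first.
  by apply: le_trans (max_prob_le1 _ law_ge0 law_sum1 _ _ _) _; lra.
apply: (@le_trans _ _ (2 * end_prob law step n (h / 2) 0)); last first.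
  by have := end_prob_le_spread n h20; rewrite half; lra.
rewrite [in leLHS](_ : h = 2 * (h / 2)); last by rewrite mulrC divfK.
apply: ottaviani => // k kn; apply: le_trans (end_prob_le_spread k h20) _.
rewrite half; apply: le_trans small.
by rewrite ler_wpM2l // ler_wpM2r ?invr_ge0 ?sqr_ge0 // ler_wpM2r ?sqr_ge0 ?ler_nat.
Qed.

End SecondMoment.

(** * Transport along nested partitions *)

Section FiberSum.
Context {R : realFieldType} {K T : finType}.
Implicit Types (f : K -> T) (a : K -> R) (F : T).

Definition fiber_sum f a F : R := \sum_(k | f k == F) a k.

Lemma fiber_sum_ge0 f a F : (forall k, 0 <= a k) -> 0 <= fiber_sum f a F.
Proof. by move=> a0; apply: sumr_ge0. Qed.

Lemma le_fiber_sum f a k : (forall k, 0 <= a k) -> a k <= fiber_sum f a (f k).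
Proof. by move=> a0; rewrite /fiber_sum (bigD1 k) //= lerDl sumr_ge0. Qed.

Lemma sum_fiber f a (w : T -> R) : \sum_k w (f k) * a k = \sum_F w F * fiber_sum f a F.
Proof.
rewrite (partition_big f predT) //=; apply: eq_bigr => F _.
by rewrite /fiber_sum mulr_sumr; apply: eq_bigr => k /eqP ->.
Qed.

Lemma fiber_sum_coarsen (T' : finType) f (g : K -> T') (h : T -> T') a (F : T') :
  (forall k, g k = h (f k)) ->
  \sum_(k | g k == F) a k = \sum_(G | h G == F) fiber_sum f a G.
Proof.
move=> gE; rewrite (partition_big f (fun G => h G == F)) /=; last by move=> k; rewrite gE.
apply: eq_bigr => G /eqP hG; apply: eq_bigl => k; rewrite gE.
by case: (f k =P G) => [->|]; rewrite ?andbF // hG eqxx.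
Qed.

End FiberSum.

Section PartialPlan.
Context {R : realFieldType} {I J : finType}.
Implicit Types (a : I -> R) (b : J -> R) (c q : I -> J -> R).

Definition row_rest a q (i : I) : R := a i - \sum_j q i j.

Definition col_rest b q (j : J) : R := b j - \sum_i q i j.

Definition plan_cost c q : R := \sum_i \sum_j q i j * c i j.

Definition partial_plan a b q : Prop :=
  [/\ forall i j, 0 <= q i j, forall i, 0 <= row_rest a q i & forall j, 0 <= col_rest b q j].

Definition plan a b q : Prop :=
  [/\ forall i j, 0 <= q i j, forall i, \sum_j q i j = a i & forall j, \sum_i q i j = b j].

Lemma row_restD a q m : row_rest a (q \+ m) =1 row_rest (row_rest a q) m.
Proof. by move=> i; rewrite /row_rest -addrA -opprD -big_split. Qed.

Lemma col_restD b q m : col_rest b (q \+ m) =1 col_rest (col_rest b q) m.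
Proof. by move=> j; rewrite /col_rest -addrA -opprD -big_split. Qed.

Lemma plan_costD c q m : plan_cost c (q \+ m) = plan_cost c q + plan_cost c m.
Proof.
rewrite -big_split; apply: eq_bigr => i _; rewrite -big_split.
by apply: eq_bigr => j _; rewrite /= mulrDl.
Qed.

Lemma partial_planD a b q m : partial_plan a b q ->
  partial_plan (row_rest a q) (col_rest b q) m -> partial_plan a b (q \+ m).
Proof.
move=> [q0 _ _] [m0 am bm]; split => [i j|i|j]; first exact: addr_ge0.
- by rewrite row_restD.
- by rewrite col_restD.
Qed.

Lemma independent_plan a b (S := \sum_i a i) : (forall i, 0 <= a i) -> (forall j, 0 <= b j) ->
  S = \sum_j b j -> plan a b (fun i j => a i * b j / S).
Proof.
move=> a0 b0 abS; have S0 : 0 <= S by exact: sumr_ge0.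
have aS i : a i <= S by rewrite /S (bigD1 i) //= lerDl sumr_ge0.
have bS j : b j <= S by rewrite abS (bigD1 j) //= lerDl sumr_ge0.
split => [i j|i|j]; first by rewrite divr_ge0 ?mulr_ge0.
- rewrite -mulr_suml -mulr_sumr -abS; have [S00|S_neq0] := eqVneq S 0; last by rewrite mulfK.
  by rewrite S00 mulr0 mul0r; apply/eqP; rewrite eq_le a0 -S00 aS.
- rewrite -mulr_suml -mulr_suml -/S; have [S00|S_neq0] := eqVneq S 0.
    by rewrite S00 !mul0r; apply/eqP; rewrite eq_le b0 -S00 bS.
  by rewrite mulrAC mulfV // mul1r.
Qed.

Section FiberMatching.
Context {T : finType}.
Implicit Types (u : I -> T) (v : J -> T).

Definition saturated u v a b q : Prop := forall F,
  fiber_sum u (row_rest a q) F = Num.max (fiber_sum u a F - fiber_sum v b F) 0 /\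
  fiber_sum v (col_rest b q) F = Num.max (fiber_sum v b F - fiber_sum u a F) 0.

Lemma mulr_div_max (x y : R) : 0 <= x -> 0 <= y -> x - x * (y / Num.max x y) = Num.max (x - y) 0.
Proof.
move=> x0 y0; have [xy|yx] := leP x y.
  have [yz|yn0] := eqVneq y 0.
    by have -> : x = 0; [lra|rewrite yz mul0r subrr maxxx].
  by rewrite divff // mulr1 subrr max_r // subr_le0.
by rewrite mulrCA divff ?mulr1 ?max_l ?subr_ge0 ?(ltW yx) // gt_eqF // (le_lt_trans y0).
Qed.

Lemma fiber_matching u v a b : (forall i, 0 <= a i) -> (forall j, 0 <= b j) ->
  exists m, [/\ partial_plan a b m, forall i j, u i != v j \/ a i * b j = 0 -> m i j = 0 &
    saturated u v a b m].
Proof.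
move=> a0 b0; pose A := fiber_sum u a; pose B := fiber_sum v b.
have A0 F : 0 <= A F by exact: fiber_sum_ge0.
have B0 F : 0 <= B F by exact: fiber_sum_ge0.
pose M F := Num.max (A F) (B F); have M0 F : 0 <= M F by rewrite le_max A0.
pose m i j := if u i == v j then a i * b j / M (u i) else 0.
have rowE i : \sum_j m i j = a i * (B (u i) / M (u i)).
  rewrite /m -big_mkcond /= mulrA /B /fiber_sum mulr_sumr mulr_suml.
  by apply: eq_bigl => j; rewrite eq_sym.
have colE j : \sum_i m i j = b j * (A (v j) / M (v j)).
  rewrite /m -big_mkcond /= mulrA /A /fiber_sum mulr_sumr mulr_suml.
  by apply: eq_bigr => i /eqP ->; rewrite [a i * _]mulrC.
have div_le1 x F : x <= M F -> x / M F <= 1.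
  move=> xM; have := M0 F; rewrite le_eqVlt => /predU1P[<-|MF]; first by rewrite invr0 mulr0.
  by rewrite ler_pdivrMr // mul1r.
exists m; split=> [|i j|F].
- split=> [i j|i|j].
  + by rewrite /m; case: ifP => // _; rewrite divr_ge0 // mulr_ge0.
  + by rewrite /row_rest rowE subr_ge0 ler_piMr // div_le1 // le_max lexx orbT.
  + by rewrite /col_rest colE subr_ge0 ler_piMr // div_le1 // le_max lexx.
- by rewrite /m => -[/negbTE ->|->] //; rewrite mul0r if_same.
- rewrite -/(A F) -/(B F) -!mulr_div_max // [Num.max (B F) _]maxC -/(M F).
  rewrite /fiber_sum !sumrB; split; congr (_ - _).
  + by rewrite {1}/A /fiber_sum mulr_suml; apply: eq_bigr => i /eqP <-; rewrite rowE.
  + by rewrite {1}/B /fiber_sum mulr_suml; apply: eq_bigr => j /eqP <-; rewrite colE.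
Qed.

Lemma saturated_eq0 u v a b q i j : partial_plan a b q -> saturated u v a b q ->
  u i = v j -> row_rest a q i * col_rest b q j = 0.
Proof.
move=> [_ a0 b0] sat uv; have := le_fiber_sum u i a0; have := le_fiber_sum v j b0.
have [rowF colF] := sat (u i); rewrite -uv rowF colF.
have := a0 i; have := b0 j; move: (fiber_sum u a _) (fiber_sum v b _) => A B.
have [AB|BA] := leP A B => bj ai.
  have -> : Num.max (A - B) 0 = 0 by rewrite max_r // subr_le0.
  by move=> _ ai0; rewrite (@le_anti _ _ (row_rest a q i) 0) ?mul0r ?ai0.
have -> : Num.max (B - A) 0 = 0 by rewrite max_r // subr_le0 ltW.
by move=> bj0 _; rewrite (@le_anti _ _ (col_rest b q j) 0) ?mulr0 ?bj0.
Qed.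

Lemma saturated_diff u v a b q F : saturated u v a b q ->
  fiber_sum u (row_rest a q) F - fiber_sum v (col_rest b q) F =
  fiber_sum u a F - fiber_sum v b F.
Proof.
move=> /(_ F)[-> ->]; move: (fiber_sum u a F) (fiber_sum v b F) => A B.
by case: (lerP (A - B) 0) => AB; case: (lerP (B - A) 0) => BA; lra.
Qed.

Lemma saturated_le u v a b q F : saturated u v a b q ->
  fiber_sum u (row_rest a q) F <= `|fiber_sum u a F - fiber_sum v b F|.
Proof. by move=> /(_ F)[-> _]; rewrite ge_max normr_ge0 ler_norm. Qed.

Lemma saturated_add u v a b q F : saturated u v a b q ->
  fiber_sum u (row_rest a q) F + fiber_sum v (col_rest b q) F =
  `|fiber_sum u a F - fiber_sum v b F|.
Proof.
move=> /(_ F)[-> ->]; move: (fiber_sum u a F) (fiber_sum v b F) => A B.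
by case: (lerP (A - B) 0) => AB; case: (lerP (B - A) 0) => BA; case: ger0P; lra.
Qed.

Lemma partial_plan_cost_le a b q c (w : I -> R) : partial_plan a b q ->
  (forall i, 0 <= w i) -> (forall i j, q i j = 0 \/ c i j <= w i) ->
  plan_cost c q <= \sum_i w i * a i.
Proof.
move=> [q0 a0 _] w0 cw; apply: ler_sum => i _.
apply: (@le_trans _ _ (\sum_j w i * q i j)).
  apply: ler_sum => j _; case: (cw i j) => [->|cwi]; first by rewrite mul0r mulr0.
  by rewrite mulrC ler_wpM2r.
by rewrite -mulr_sumr ler_wpM2l // -subr_ge0; exact: a0.
Qed.

End FiberMatching.

Section NestedCells.
Context {T : finType}.
Variables (a : I -> R) (b : J -> R) (L : nat).
Variables (phi : nat -> I -> T) (psi : nat -> J -> T) (parent : nat -> T -> T).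
Variables (c : I -> J -> R) (W : nat -> T -> R) (leaf_cost : J -> R).
Hypothesis a_ge0 : forall i, 0 <= a i.
Hypothesis b_ge0 : forall j, 0 <= b j.
Hypothesis same_mass : \sum_i a i = \sum_j b j.
Hypothesis phi_parent : forall l i, (l < L)%N -> phi l i = parent l (phi l.+1 i).
Hypothesis psi_parent : forall l j, (l < L)%N -> psi l j = parent l (psi l.+1 j).
Hypothesis W_ge0 : forall l F, 0 <= W l F.
Hypothesis leaf_cost_ge0 : forall j, 0 <= leaf_cost j.
Hypothesis cost_leaf : forall i j, phi L i = psi L j -> c i j <= leaf_cost j.
Hypothesis cost_split : forall l i j, (l < L)%N -> phi l i = psi l j ->
  phi l.+1 i != psi l.+1 j -> c i j <= W l.+1 (phi l.+1 i).
Hypothesis cost_root : forall i j, phi 0 i != psi 0 j -> c i j <= W 0 (phi 0 i) + W 0 (psi 0 j).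

Definition level_cost (l : nat) : R :=
  \sum_F W l F * `|fiber_sum (phi l) a F - fiber_sum (psi l) b F|.

Lemma saturate_leaves : exists q, [/\ partial_plan a b q,
  saturated (phi L) (psi L) a b q & plan_cost c q <= \sum_j b j * leaf_cost j].
Proof.
have [q [pq q_cell sat]] := fiber_matching (phi L) (psi L) a_ge0 b_ge0.
exists q; split => //; have [q0 _ colq] := pq.
rewrite /plan_cost exchange_big /=; apply: ler_sum => j _.
apply: (@le_trans _ _ (\sum_i q i j * leaf_cost j)).
  apply: ler_sum => i _; have [same|diff] := eqVneq (phi L i) (psi L j).
    by rewrite ler_wpM2l // cost_leaf.
  by rewrite q_cell ?mul0r //; left.
by rewrite -mulr_suml ler_wpM2r // -subr_ge0; exact: colq.
Qed.

Lemma saturate_parent l q : (l < L)%N -> partial_plan a b q ->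
  saturated (phi l.+1) (psi l.+1) a b q ->
  exists q', [/\ partial_plan a b q', saturated (phi l) (psi l) a b q' &
    plan_cost c q' <= plan_cost c q + level_cost l.+1].
Proof.
move=> lL pq sat; have [_ a0 b0] := pq.
have [m [pm m_cell sat_m]] := fiber_matching (phi l) (psi l) a0 b0.
exists (q \+ m); split; first exact: partial_planD.
  move=> F; have [rowF colF] := sat_m F.
  have restE : fiber_sum (phi l) (row_rest a q) F - fiber_sum (psi l) (col_rest b q) F =
      fiber_sum (phi l) a F - fiber_sum (psi l) b F.
    rewrite /fiber_sum !(fiber_sum_coarsen _ _ (fun i => phi_parent i lL)).
    rewrite !(fiber_sum_coarsen _ _ (fun j => psi_parent j lL)) -!sumrB.
    by apply: eq_bigr => G _; exact: saturated_diff.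
  rewrite -restE -[X in _ /\ _ = Num.max X 0]opprB -restE opprB -rowF -colF.
  by split; apply: eq_bigr => k _; rewrite ?row_restD ?col_restD.
rewrite plan_costD lerD2l.
apply: (@le_trans _ _ (\sum_i W l.+1 (phi l.+1 i) * row_rest a q i)).
  apply: partial_plan_cost_le pm _ _ => // i j.
  have [same|diff] := eqVneq (phi l i) (psi l j); last by left; apply: m_cell; left.
  have [same'|diff'] := eqVneq (phi l.+1 i) (psi l.+1 j); last by right; exact: cost_split.
  by left; apply: m_cell; right; exact: saturated_eq0 pq sat same'.
rewrite sum_fiber; apply: ler_sum => F _.
by rewrite ler_wpM2l // (saturated_le _ sat).
Qed.

Lemma saturate_level m : (m <= L)%N -> exists q, [/\ partial_plan a b q,
  saturated (phi (L - m)) (psi (L - m)) a b q &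
  plan_cost c q <= \sum_j b j * leaf_cost j + \sum_((L - m).+1 <= l < L.+1) level_cost l].
Proof.
elim: m => [_|m IH mL].
  have [q [pq sat cost]] := saturate_leaves; exists q; rewrite subn0; split => //.
  by rewrite big_geq // addr0.
have [q [pq sat cost]] := IH (ltnW mL); have lE : (L - m)%N = (L - m.+1).+1 by rewrite subnSK.
rewrite lE in sat cost.
have lL : (L - m.+1 < L)%N by rewrite -lE leq_subr.
have [q' [pq' sat' cost']] := saturate_parent lL pq sat; exists q'; split => //.
by rewrite big_ltn // addrCA [leRHS]addrC; apply: le_trans cost' _; rewrite lerD2r.
Qed.

Lemma complete_plan q : partial_plan a b q -> saturated (phi 0) (psi 0) a b q ->
  exists2 q', plan a b q' & plan_cost c q' <= plan_cost c q + level_cost 0.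
Proof.
move=> pq sat; have [q0 a0 b0] := pq.
have rests : \sum_i row_rest a q i = \sum_j col_rest b q j.
  by rewrite !sumrB same_mass [X in _ - X = _]exchange_big.
have := independent_plan a0 b0 rests.
set m := (fun i j => _) => -[m0 mrow mcol]; exists (q \+ m).
  split=> [i j|i|j]; first exact: addr_ge0.
  - by rewrite big_split /= mrow addrC subrK.
  - by rewrite big_split /= mcol addrC subrK.
rewrite plan_costD lerD2l; pose w0 := W 0 \o phi 0; pose w1 := W 0 \o psi 0.
apply: (@le_trans _ _ (\sum_i \sum_j m i j * (w0 i + w1 j))).
  apply: ler_sum => i _; apply: ler_sum => j _.
  have [same|diff] := eqVneq (phi 0 i) (psi 0 j); last by rewrite ler_wpM2l // cost_root.
  by rewrite {1 2}/m (saturated_eq0 pq sat same) !mul0r.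
under eq_bigr do under eq_bigr do rewrite mulrDr.
under eq_bigr do rewrite big_split /= -mulr_suml mrow mulrC.
rewrite big_split /= [X in _ + X]exchange_big /=.
under [X in _ + X]eq_bigr do rewrite -mulr_suml mcol mulrC.
rewrite !(sum_fiber (phi 0)) (sum_fiber (psi 0)) -big_split /=; apply: ler_sum => F _.
by rewrite -mulrDr ler_wpM2l // (saturated_add _ sat).
Qed.

(* Mass is matched inside the cells of the finest partition, then what is left
   over inside the next coarser cells, and so on; at most the discrepancy between
   the masses of a cell is left over in it. *)
Lemma nested_transport : exists2 q, plan a b q &
  plan_cost c q <= \sum_j b j * leaf_cost j + \sum_(0 <= l < L.+1) level_cost l.
Proof.
have [q [pq]] := saturate_level (leqnn L); rewrite subnn => sat cost.
have [q' pq' cost'] := complete_plan pq sat; exists q' => //.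
by rewrite big_ltn // addrCA [leRHS]addrC; apply: le_trans cost' _; rewrite lerD2r.
Qed.

End NestedCells.
End PartialPlan.

(** * Couplings on a Polish space *)

Section MeasureTools.
Local Open Scope ereal_scope.
Context {d1 d2 : measure_display} {T : measurableType d1} {T' : measurableType d2} {R : realType}.

Lemma ge0_integral_mrestr (mu : {measure set T -> \bar R}) (C : set T)
    (mC : measurable C) (f : T -> \bar R) :
  measurable_fun setT f -> (forall x, 0 <= f x) ->
  \int[mrestr mu mC]_x f x = \int[mu]_(x in C) f x.
Proof.
move=> mf f0; rewrite -(setUv C) ge0_integral_setU //=; last 3 first.
- exact: measurableC.
- by rewrite setUv.
- by rewrite disj_set2E setICr.
rewrite [X in _ + X](_ : _ = 0) ?adde0.
  by apply: eq_measure_integral => A mA AC; rewrite /= /mrestr setIidl.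
rewrite -(integral_measure_zero (~` C) f); apply: eq_measure_integral => A mA AC.
by rewrite /= /mrestr /mzero (_ : A `&` C = set0) ?measure0 // disjoints_subset.
Qed.

Lemma measure_sum_exists (J : finType) (m : J -> {measure set T -> \bar R}) :
  exists M : {measure set T -> \bar R}, (forall A, M A = \sum_j m j A) /\
    (forall f : T -> \bar R, measurable_fun setT f -> (forall x, 0 <= f x) ->
       \int[M]_x f x = \sum_j \int[m j]_x f x).
Proof.
pose m' k : {measure set T -> \bar R} :=
  if insub k is Some i then m (enum_val (i : 'I_#|J|)) else mzero.
have m'E (i : 'I_#|J|) : m' i = m (enum_val i) by rewrite /m' valK.
exists (msum m' #|J|); split => [A|f mf f0].
  rewrite /= /msum; transitivity (\sum_(i < #|J|) m (enum_val i) A).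
    by apply: eq_bigr => i _; rewrite m'E.
  by rewrite -(big_enum_val (A := J) (fun j => m j A)).
rewrite ge0_integral_measure_sum //.
transitivity (\sum_(i < #|J|) \int[m (enum_val i)]_x f x).
  by apply: eq_bigr => i _; rewrite m'E.
by rewrite -(big_enum_val (A := J) (fun j => \int[m j]_x f x)).
Qed.

Lemma image_measure_exists (m : {measure set T -> \bar R}) (f : T -> T') :
  measurable_fun setT f ->
  exists M : {measure set T' -> \bar R}, (forall A, M A = m (f @^-1` A)) /\
    (forall h : T' -> \bar R, measurable_fun setT h -> (forall y, 0 <= h y) ->
       \int[M]_y h y = \int[m]_x h (f x)).
Proof.
move=> mf; pose mixin := isMeasurableFun.Build _ _ _ _ _ mf.
pose F : {mfun T >-> T'} := HB.pack f mixin.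
exists (pushforward m F); split => [//|h mh h0].
exact: (ge0_integral_pushforward mf m measurableT mh (fun y _ => h0 y)).
Unshelve. exact: mf.
Qed.

Lemma probability_of_measure (M : {measure set T -> \bar R}) : M setT = 1 ->
  exists P : probability T R, forall A, P A = M A.
Proof.
move=> M1; exists (mnormalize M (dirac point)) => A /=.
by rewrite /mnormalize M1 onee_eq0 /= invr1 mule1.
Qed.

Lemma eq_measure_of_le (m M : {measure set T -> \bar R}) :
  (forall A, measurable A -> m A <= M A) -> m setT = M setT -> M setT \is a fin_num ->
  forall A, measurable A -> m A = M A.
Proof.
move=> mM mMT Mfin A mA; have mAC := measurableC mA; apply/eqP; rewrite eq_le mM //=.
have MCfin : M (~` A) \is a fin_num.
  rewrite ge0_fin_numE // (@le_lt_trans _ _ (M setT)) ?le_measure ?inE //.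
  by rewrite -ge0_fin_numE.
rewrite -(@leeD2rE _ (M (~` A))) //.
have -> : M A + M (~` A) = m A + m (~` A).
  by rewrite -!measureU ?setICr // setUv.
by rewrite leeD2l // mM.
Qed.

Lemma measure_fintype_partition (m : {measure set T -> \bar R}) (L : finType) (lab : T -> L)
    (B : set T) : (forall t, measurable (lab @^-1` [set t])) -> measurable B ->
  m B = \sum_t m (B `&` lab @^-1` [set t]).
Proof.
move=> mC mB; have LT : [set` enum L] = [set: L].
  by apply/seteqP; split => t //= _; rewrite mem_enum.
rewrite -big_enum fsbig_seq ?enum_uniq // LT -measure_fin_bigcup //.
- by congr (m _); apply/seteqP; split => [x Bx|x [t _ []]] //; exists (lab x).
- by rewrite -LT; exact: finite_seq.
- apply/trivIsetP => t u _ _ tu; apply/seteqP; split => // x [[_ /= xt] [_ /= xu]].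
  by move: tu; rewrite -xt xu eqxx.
- by move=> t _; exact: measurableI.
Qed.

End MeasureTools.

Lemma measurable_fun_lt d (T : measurableType d) (R : realType) (f : T -> R) :
  (forall r, measurable [set x | f x < r]) -> measurable_fun setT f.
Proof.
move=> mf; apply: (measurability _ (RGenInftyO.measurableE R)) => _ [_ [r ->] <-].
by rewrite setTI; exact: mf.
Qed.

Section PolishSpace.
Context {R : realType} {dE : measure_display} {E : measurableType dE} {d : E -> E -> R}.
Hypothesis polish_d : polish d.

Lemma polish_ge0 x y : 0 <= d x y.
Proof. by case: polish_d => -[+ _] _ _ _; exact. Qed.

Lemma polish_sym x y : d x y = d y x.
Proof. by case: polish_d => -[_ [_ [+ _]]] _ _ _; exact. Qed.

Lemma polish_triangle x y z : d x z <= d x y + d y z.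
Proof. by case: polish_d => -[_ [_ [_ +]]] _ _ _; exact. Qed.

Lemma polish_eq0 x y : d x y = 0 <-> x = y.
Proof. by case: polish_d => -[_ [+ _]] _ _ _; exact. Qed.

Lemma polish_separable : d_separable d.
Proof. by case: polish_d. Qed.

Lemma measurable_d_open A : d_open d A -> measurable A.
Proof. by case: polish_d => _ _ _ mE oA; rewrite mE; exact: sub_sigma_algebra. Qed.

Lemma measurable_oball x r : measurable (oball d x r).
Proof.
apply: measurable_d_open => y; rewrite /oball /= => xy.
exists (r - d x y); first by rewrite subr_gt0.
by move=> z /=; have := polish_triangle x y z; lra.
Qed.

Lemma measurable_dist x : measurable_fun setT (d x).
Proof. by apply: measurable_fun_lt => r; exact: measurable_oball. Qed.

Lemma setC_cball x r : ~` cball d x r = [set y | r < d x y].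
Proof. by apply/seteqP; split => y /=; rewrite /cball /= ltNge => /negP. Qed.

Lemma measurable_cballC x r : measurable (~` cball d x r).
Proof.
rewrite setC_cball (_ : [set _ | _] = d x @^-1` `]r, +oo[%classic).
  by rewrite -[X in measurable X]setTI; exact: measurable_dist.
by apply/seteqP; split => y /=; rewrite in_itv /= andbT.
Qed.

Lemma measurable_cball x r : measurable (cball d x r).
Proof. by rewrite -[cball d x r]setCK; apply: measurableC; exact: measurable_cballC. Qed.

Lemma measurable_point x : measurable [set x : E].
Proof.
rewrite (_ : [set x] = cball d x 0); first exact: measurable_cball.
apply/seteqP; split => y /=; rewrite /cball /=; first by move=> ->; rewrite (polish_eq0 x x).2.
by move=> xy; apply/esym/polish_eq0/eqP; rewrite eq_le xy polish_ge0.
Qed.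

Lemma measurable_dist2 : measurable_fun setT (fun z : E * E => d z.1 z.2).
Proof.
apply: measurable_fun_lt => r; have [D dense] := polish_separable.
rewrite (_ : [set _ | _] = \bigcup_j \bigcup_k
   (oball d (D k) j.+1%:R^-1 `*` oball d (D k) (r - j.+1%:R^-1))).
  apply: bigcupT_measurable => j; apply: bigcupT_measurable => k.
  by apply: measurableX; exact: measurable_oball.
apply/seteqP; split => [[x y] /= xy|[x y] [j _ [k _]] []]; rewrite /oball /=; last first.
  move: (j.+1%:R^-1) => e Dx Dy.
  by have := polish_triangle x (D k) y; rewrite (polish_sym x (D k)); lra.
have [j jr] : exists j : nat, j.+1%:R^-1 < (r - d x y) / 2.
  by apply: exists_invn_lt; rewrite divr_gt0 // subr_gt0.
have [|k xk] := dense x j.+1%:R^-1; first by rewrite invr_gt0.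
exists j => //; exists k => //; split; rewrite /oball /= 1?(polish_sym (D k) x) //.
move: jr xk; move: (j.+1%:R^-1) => e jr xk.
by have := polish_triangle (D k) x y; rewrite (polish_sym (D k) x); lra.
Qed.

Lemma measurable_cost2 (p : R) : measurable_fun setT (fun z : E * E => (d z.1 z.2 `^ p)%:E).
Proof.
apply/measurable_EFinP.
exact: (measurableT_comp (@measurable_powR R p) measurable_dist2).
Qed.

Lemma measurable_cost (p : R) x : measurable_fun setT (fun y => (d x y `^ p)%:E).
Proof.
apply/measurable_EFinP.
exact: (measurableT_comp (@measurable_powR R p) (measurable_dist x)).
Qed.

Lemma cost_ge0 (p : R) x y : (0 <= (d x y `^ p)%:E)%E.
Proof. by rewrite lee_fin powR_ge0. Qed.

Local Open Scope ereal_scope.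

Lemma Wpp_le_measure (p : R) (m1 m2 : set E -> \bar R) (M : {measure set (E * E) -> \bar R}) :
  M setT = 1 -> (forall A, measurable A -> M (A `*` setT) = m1 A) ->
  (forall B, measurable B -> M (setT `*` B) = m2 B) ->
  Wpp d p m1 m2 <= \int[M]_z (d z.1 z.2 `^ p)%:E.
Proof.
move=> /probability_of_measure[pi piE] M_fst M_snd.
have <- : \int[pi]_z (d z.1 z.2 `^ p)%:E = \int[M]_z (d z.1 z.2 `^ p)%:E.
  by apply: eq_measure_integral => A mA _; exact: piE.
apply: ereal_inf_lbound; exists pi => //.
by split => A mA; rewrite piE ?M_fst ?M_snd.
Qed.

Lemma Wpp_sym (p : R) (m1 m2 : set E -> \bar R) : Wpp d p m1 m2 = Wpp d p m2 m1.
Proof.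
suff le m m' : Wpp d p m m' <= Wpp d p m' m by apply/eqP; rewrite eq_le !le.
apply: le_ereal_inf_tmp => _ [pi [pi1 pi2] <-].
have [M [ME MI]] := image_measure_exists pi (@measurable_swap _ _ E E).
apply: (@le_trans _ _ (\int[M]_z (d z.1 z.2 `^ p)%:E)).
  apply: Wpp_le_measure => [|A mA|B mB]; rewrite ME.
  - exact: (probability_setT pi).
  - by rewrite -pi2 //; congr (pi _); apply/seteqP; split => -[x y] /=; tauto.
  - by rewrite -pi1 //; congr (pi _); apply/seteqP; split => -[x y] /=; tauto.
rewrite MI; [|exact: measurable_cost2|by move=> z; exact: cost_ge0].
by under eq_integral do rewrite /= polish_sym.
Qed.

End PolishSpace.

(** * Couplings with an empirical measure *)

Section Splitting.
Context {R : realType} {dE : measure_display} {E : measurableType dE} {d : E -> E -> R}.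
Hypothesis polish_d : polish d.
Variables (p : R) (mu : probability E R) (n : nat).
Hypothesis n_gt0 : (0 < n)%N.
Local Open Scope ereal_scope.

Definition splitting (nu : 'I_n -> {measure set E -> \bar R}) : Prop :=
  (forall i, nu i setT = (n%:R^-1)%:E) /\ (forall A, measurable A -> \sum_i nu i A = mu A).

Definition splitting_cost (xs : 'I_n -> E) (nu : 'I_n -> {measure set E -> \bar R}) : \bar R :=
  \sum_i \int[nu i]_y (d (xs i) y `^ p)%:E.

Lemma Wpp_le_splitting_cost xs nu : splitting nu ->
  Wpp d p (empirical xs) mu <= splitting_cost xs nu.
Proof.
move=> [nu_mass nu_sum].
have /choice[M ME] i := image_measure_exists (nu i) (pair1_measurable (xs i)).
have [S [SE SI]] := measure_sum_exists M.
have S_snd B : measurable B -> S (setT `*` B) = mu B.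
  move=> mB; rewrite SE -nu_sum //; apply: eq_bigr => i _; rewrite (ME i).1.
  by congr (nu i _); apply/seteqP; split => [y []|y].
have S_fst A : measurable A -> S (A `*` setT) = empirical xs A.
  move=> mA; rewrite SE /empirical ge0_sume_distrr //; apply: eq_bigr => i _.
  rewrite (ME i).1 diracE; case: (boolP (xs i \in A)) => [/set_mem xA|xA].
    by rewrite mule1 -(nu_mass i); congr (nu i _); apply/seteqP; split.
  rewrite mule0 -(measure0 (nu i)); congr (nu i _); apply/seteqP; split => // y [/=].
  by move: xA; rewrite notin_setE.
apply: le_trans (Wpp_le_measure p _ S_fst S_snd) _.
  by rewrite -setXTT S_snd // probability_setT.
rewrite SI; [|exact: measurable_cost2|by move=> z; exact: cost_ge0].
rewrite le_eqVlt; apply/orP; left; apply/eqP/eq_bigr => i _.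
by rewrite (ME i).2 //; [exact: measurable_cost2|move=> z; exact: cost_ge0].
Qed.

Lemma Wpp_le_cells xs (T : finType) (lab : E -> T)
    (cell_mass := fun t => fine (mu (lab @^-1` [set t]))) (q : 'I_n -> T -> R) :
  (forall t, measurable (lab @^-1` [set t])) -> plan (fun=> n%:R^-1)%R cell_mass q ->
  Wpp d p (empirical xs) mu <=
  \sum_i \sum_t (q i t / cell_mass t)%:E *
     \int[mu]_(y in lab @^-1` [set t]) (d (xs i) y `^ p)%:E.
Proof.
move=> mC [q0 qrow qcol]; set C := fun t => lab @^-1` [set t].
have massE t : mu (C t) = (cell_mass t)%:E by rewrite fineK // fin_num_measure //; exact: mC.
have mass0 t : (0 <= cell_mass t)%R by exact: fine_ge0.
have q_null i t : cell_mass t = 0%R -> q i t = 0%R.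
  by move=> t0; apply/eqP; rewrite eq_le q0 andbT -t0 -qcol (bigD1 i) //= lerDl sumr_ge0.
pose r i t : {nonneg R} := NngNum (divr_ge0 (q0 i t) (mass0 t)).
have /choice[nu nuE] i := measure_sum_exists (fun t => mscale (r i t) (mrestr mu (mC t))).
have nuA i A : nu i A = \sum_t (q i t / cell_mass t)%:E * mu (A `&` C t) by exact: (nuE i).1.
have nu_split : splitting nu.
  split=> [i|A mA].
    rewrite nuA -(qrow i) -sumEFin; apply: eq_bigr => t _; rewrite setTI massE -EFinM.
    by have [t0|t0] := eqVneq (cell_mass t) 0%R; [rewrite q_null // t0 mulr0|rewrite divfK].
  under eq_bigr do rewrite nuA.
  rewrite exchange_big (measure_fintype_partition mu mC mA); apply: eq_bigr => t _ /=.
  rewrite -ge0_sume_distrl; last by move=> i _; rewrite lee_fin divr_ge0.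
  rewrite sumEFin -mulr_suml qcol; have [t0|t0] := eqVneq (cell_mass t) 0%R.
    rewrite t0 mul0r mul0e; apply/esym/(subset_measure0 _ _ (@subIsetr _ A (C t))) => //.
    - by apply: measurableI => //; exact: mC.
    - exact: mC.
    - by have := massE t; rewrite t0.
  by rewrite divff // mul1e.
apply: le_trans (Wpp_le_splitting_cost xs nu_split) _.
rewrite le_eqVlt; apply/orP; left; apply/eqP/eq_bigr => i _.
have mc : measurable_fun setT (fun y => (d (xs i) y `^ p)%:E) by exact: measurable_cost.
rewrite (nuE i).2 => [|//|y]; last exact: cost_ge0.
apply: eq_bigr => t _; rewrite ge0_integral_mscale //=; last by move=> y _; exact: cost_ge0.
by rewrite ge0_integral_mrestr // => y; exact: cost_ge0.
Qed.

Definition multiplicity (xs : 'I_n -> E) (i : 'I_n) : nat := #|[pred j | xs j == xs i]|.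

Lemma multiplicity_gt0 xs i : (0 < multiplicity xs i)%N.
Proof. by apply/card_gt0P; exists i; rewrite inE. Qed.

Lemma empirical_set1 xs i : empirical xs [set xs i] = ((multiplicity xs i)%:R / n%:R : R)%:E.
Proof.
rewrite /empirical /multiplicity -sum1_card natr_sum big_mkcond /= [in RHS]mulrC EFinM -sumEFin.
congr (_ * _); rewrite [RHS]big_mkcond /=; apply: eq_bigr => j _.
by rewrite diracE [in RHS]inE; case: eqP => [e|ne]; [rewrite mem_set|rewrite memNset].
Qed.

Local Notation atom xs i := ([set xs i] `*` [set: E]).

Let measurable_atom (xs : 'I_n -> E) i : measurable (atom xs i).
Proof. by apply: measurableX => //; exact: (measurable_point polish_d). Qed.

Lemma sum_multiplicity_le xs (pi : {measure set (E * E) -> \bar R}) (g : E * E -> \bar R) :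
  measurable_fun setT g -> (forall z, 0 <= g z) ->
  \sum_i ((multiplicity xs i)%:R^-1)%:E * \int[pi]_(z in atom xs i) g z <=
  \int[pi]_z g z.
Proof.
move=> mg g0; have w0 i : (0 <= (multiplicity xs i)%:R^-1 :> R)%R by rewrite invr_ge0.
have ga0 i z : 0 <= (g \_ (atom xs i)) z by apply: erestrict_ge0.
have mga i : measurable_fun setT (g \_ (atom xs i)).
  by apply/(measurable_restrictT _ _).1; [exact: measurable_atom|exact: measurable_funTS].
under eq_bigr do rewrite integral_mkcond -ge0_integralZl_EFin //.
rewrite -ge0_integral_sum //; last 2 first.
- by move=> i; exact: measurable_funeM.
- by move=> i z _; rewrite mule_ge0 // lee_fin.
apply: ge0_le_integral => //.
- by move=> z _; apply: sume_ge0 => i _; rewrite mule_ge0 // lee_fin.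
- by apply: emeasurable_sum => i; exact: measurable_funeM.
move=> z _; have [[k zk]|nz] := pselect (exists i, z.1 = xs i); last first.
  rewrite big1 // => i _; rewrite patchE memNset ?mule0 //= => -[zi _].
  by apply: nz; exists i.
rewrite (eq_bigr (fun i => if xs i == xs k then ((multiplicity xs k)%:R^-1)%:E * g z else 0)).
  rewrite -big_mkcond /= -ge0_sume_distrl; last by move=> i _; rewrite lee_fin.
  rewrite sumEFin sumr_const -[(_ *+ _)%R]mulr_natl divff ?mul1e //.
  by rewrite pnatr_eq0 -lt0n multiplicity_gt0.
move=> i _; case: eqP => [ik|ik]; rewrite patchE.
  by rewrite mem_set ?/multiplicity ?ik //; split => //=; rewrite zk ik.
by rewrite memNset ?mule0 //= => -[zi _]; apply: ik; rewrite -zi.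
Qed.

Lemma coupling_splitting xs (pi : probability (E * E)%type R) :
  coupling (empirical xs) mu pi ->
  exists2 nu, splitting nu & splitting_cost xs nu <= \int[pi]_z (d z.1 z.2 `^ p)%:E.
Proof.
move=> [pi_fst pi_snd].
have w0 i : (0 <= (multiplicity xs i)%:R^-1 :> R)%R by rewrite invr_ge0.
have /choice[nu nuE] i := image_measure_exists
  (mscale (NngNum (w0 i)) (mrestr pi (measurable_atom xs i))) (@measurable_snd _ _ E E).
have mass i : nu i setT = (n%:R^-1)%:E.
  rewrite (nuE i).1 /= /mscale /= /mrestr preimage_setT setTI.
  rewrite pi_fst; last exact: (measurable_point polish_d).
  by rewrite empirical_set1 -EFinM mulKf // pnatr_eq0 -lt0n multiplicity_gt0.
have [M [ME _]] := measure_sum_exists nu.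
have M_le_mu B : measurable B -> M B <= mu B.
  move=> mB; have mTB : measurable ([set: E] `*` B) by exact: measurableX.
  pose ind (z : E * E) : \bar R := (\1_([set: E] `*` B) z)%:E.
  have m_ind : measurable_fun setT ind by apply/measurable_EFinP; exact: measurable_indic.
  have ind0 z : 0 <= ind z by rewrite lee_fin.
  have -> : mu B = \int[pi]_z ind z by rewrite integral_indic // setIT; exact/esym/pi_snd.
  apply: le_trans (sum_multiplicity_le xs pi m_ind ind0).
  rewrite le_eqVlt ME; apply/orP; left; apply/eqP/eq_bigr => i _.
  rewrite integral_indic // (nuE i).1 /= /mscale /= /mrestr; congr (_ * pi (_ `&` _)).
  by apply/seteqP; split => [z|z []].
exists nu; first split => // A mA.
  rewrite -ME; apply: eq_measure_of_le mA => //; last exact: fin_num_measure.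
  rewrite ME [RHS](probability_setT mu); under eq_bigr do rewrite mass.
  by rewrite sumEFin sumr_const card_ord -[(_ *+ _)%R]mulr_natl divff // pnatr_eq0 -lt0n.
apply: le_trans (sum_multiplicity_le xs pi (measurable_cost2 polish_d p) _); last first.
  by move=> z; exact: cost_ge0.
apply: lee_sum => i _; have mc := measurable_cost polish_d p (xs i).
rewrite (nuE i).2 => [|//|y]; last exact: cost_ge0.
have mc2 := measurableT_comp mc (@measurable_snd _ _ E E).
rewrite ge0_integral_mscale //=; last by move=> z _; exact: cost_ge0.
rewrite (ge0_integral_mrestr _ (measurable_atom xs i) mc2) => [|z]; last exact: cost_ge0.
have <- : \int[pi]_(z in atom xs i) (d (xs i) z.2 `^ p)%:E =
    \int[pi]_(z in atom xs i) (d z.1 z.2 `^ p)%:E.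
  by apply: eq_integral => -[z1 z2]; rewrite inE => -[/= -> _].
exact: lexx.
Qed.

End Splitting.

Arguments splitting_cost {R dE E} d p {n} xs nu.

(** * Measurability of the distance to the empirical measure *)

Section Semicontinuity.
Context {R : realType} {dE : measure_display} {E : measurableType dE} {d : E -> E -> R}.
Hypothesis polish_d : polish d.
Variables (p : R) (mu : probability E R) (n : nat).
Hypotheses (p_gt0 : 0 < p) (n_gt0 : (0 < n)%N).
Implicit Types xs ys : 'I_n -> E.
Local Open Scope ereal_scope.

Lemma splitting_cost_perturb xs ys (nu : 'I_n -> {measure set E -> \bar R}) (c r : R) :
  splitting mu nu -> (0 < c)%R -> (forall i, d (xs i) (ys i) <= r)%R ->
  splitting_cost d p ys nu <=
  ((1 + c) `^ p)%:E * splitting_cost d p xs nu + ((1 + c^-1) `^ p * r `^ p)%:E.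
Proof.
move=> [nu_mass _] c0 xyr; set A := ((1 + c) `^ p)%R; set B := ((1 + c^-1) `^ p * r `^ p)%R.
have A0 : (0 <= A)%R by exact: powR_ge0.
have B0 : (0 <= B)%R by rewrite mulr_ge0 ?powR_ge0.
have mc z : measurable_fun setT (fun y => (d z y `^ p)%:E) by exact: measurable_cost.
have term i : \int[nu i]_y (d (ys i) y `^ p)%:E <=
    A%:E * \int[nu i]_y (d (xs i) y `^ p)%:E + B%:E * (n%:R^-1)%:E.
  rewrite -(nu_mass i) -integral_cst // -ge0_integralZl_EFin //; last first.
    by move=> y _; exact: cost_ge0.
  rewrite -ge0_integralD //; last 2 first.
  - by move=> y _; rewrite mule_ge0 ?cost_ge0 ?lee_fin.
  - exact: measurable_funeM.
  apply: ge0_le_integral => //.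
  - by move=> y _; exact: cost_ge0.
  - by apply: emeasurable_funD => //; exact: measurable_funeM.
  move=> y _; rewrite -EFinM -EFinD lee_fin.
  have r0 : (0 <= r)%R := le_trans (polish_ge0 polish_d _ _) (xyr i).
  apply: le_trans (powR_add_le (ltW p_gt0) (polish_ge0 polish_d (xs i) y) r0 c0).
  rewrite ler_powRl ?(ltW p_gt0) ?polish_ge0 //.
  have := polish_triangle polish_d (ys i) (xs i) y; have := xyr i.
  by rewrite (polish_sym polish_d (ys i) (xs i)); lra.
apply: le_trans (lee_sum _ (fun i _ => term i)) _.
rewrite big_split /= -ge0_sume_distrr => [|i _]; last first.
  by apply: integral_ge0 => y _; exact: cost_ge0.
rewrite -/(splitting_cost d p xs nu) leeD2l // -EFinM sumEFin lee_fin.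
by rewrite sumr_const card_ord -[(_ *+ _)%R]mulr_natr divfK // pnatr_eq0 -lt0n.
Qed.

Lemma exists_powR_dilation (k k' : R) : (0 <= k)%R -> (k < k')%R ->
  exists2 c, (0 < c)%R & ((1 + c) `^ p * k < k')%R.
Proof.
move=> k0 kk'; pose m := ((k + k') / 2)%R.
have [km mk' m0] : [/\ k < m, m < k' & 0 < m]%R by rewrite /m; split; lra.
have [->|k_neq0] := eqVneq k 0%R; first by exists 1%R => //; rewrite mulr0 (lt_trans m0).
have kp : (0 < k)%R by rewrite lt_neqAle eq_sym k_neq0.
have mk1 : (1 < m / k)%R by rewrite ltr_pdivlMr // mul1r.
exists ((m / k) `^ p^-1 - 1)%R; last first.
  by rewrite addrC subrK powRK ?gt_eqF ?divfK // (le_trans ler01) // ltW.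
have : (1 `^ p^-1 < (m / k) `^ p^-1)%R.
  by rewrite gt0_ltr_powR ?invr_gt0 ?nnegrE // (le_trans ler01) // ltW.
by rewrite powR1 subr_gt0.
Qed.

Lemma Wpp_empirical_usc xs (k : R) : Wpp d p (empirical xs) mu < k%:E ->
  exists2 r : R, (0 < r)%R & forall ys, (forall i, d (xs i) (ys i) < r)%R ->
    Wpp d p (empirical ys) mu < k%:E.
Proof.
move=> /ereal_inf_lt[_ [pi /(coupling_splitting polish_d p n_gt0)[nu split_nu nu_le] <-]].
move=> /(le_lt_trans nu_le); set I := splitting_cost d p xs nu => Ik.
have I0 : 0 <= I.
  by apply: sume_ge0 => i _; apply: integral_ge0 => y _; exact: cost_ge0.
have If : I \is a fin_num by rewrite ge0_fin_numE //; exact: lt_trans Ik (ltry _).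
move: Ik I0; rewrite -(fineK If) lte_fin lee_fin => Ik I0.
have [c c0 cI] := exists_powR_dilation I0 Ik.
pose A := ((1 + c^-1) `^ p)%R; pose e := (k - (1 + c) `^ p * fine I)%R.
have A0 : (0 < A)%R by rewrite powR_gt0 // addr_gt0 // invr_gt0.
have e0 : (0 < e / (2 * A))%R by rewrite divr_gt0 ?subr_gt0 // mulr_gt0.
exists ((e / (2 * A)) `^ p^-1)%R; first exact: powR_gt0.
move=> ys xy; apply: le_lt_trans (Wpp_le_splitting_cost polish_d p ys split_nu) _.
apply: le_lt_trans (splitting_cost_perturb split_nu c0 (fun i => ltW (xy i))) _.
rewrite -/I -(fineK If) -EFinM -EFinD lte_fin powRK ?gt_eqF ?(ltW e0) // -/A.
have -> : (A * (e / (2 * A)) = e / 2)%R by field; rewrite gt_eqF.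
by move: cI; rewrite /e -subr_gt0; lra.
Qed.

Context {dO : measure_display} {O : measurableType dO} (X : 'I_n -> O -> E).
Hypothesis mX : forall i, measurable_fun setT (X i).

(* By upper semicontinuity the set is a union of products of balls whose centres
   lie in a dense sequence and whose radii are the inverses of integers. *)
Lemma measurable_Wpp_empirical_lt (x : R) :
  measurable [set w | Wpp d p (empirical (fun i => X i w)) mu < x%:E].
Proof.
have [D dense] := polish_separable polish_d.
pose near_centre (f : 'I_n -> nat) j (ys : 'I_n -> E) :=
  forall i, (d (D (f i)) (ys i) < j.+1%:R^-1)%R.
pose good (fj : {ffun 'I_n -> nat} * nat) := `[< forall ys, near_centre fj.1 fj.2 ys ->
  Wpp d p (empirical ys) mu < x%:E >].
rewrite (_ : [set w | _] = \bigcup_(fj in [set fj | good fj])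
  \bigcap_(i in [set: 'I_n]) (X i @^-1` oball d (D (fj.1 i)) fj.2.+1%:R^-1)).
  rewrite bigcup_mkcond; apply: countable_bigcupT_measurable => // fj.
  case: ifP => // _; apply: fin_bigcap_measurable => // i _.
  by rewrite -[X in measurable X]setTI; apply: mX => //; exact: measurable_oball.
apply/seteqP; split => [w /= /Wpp_empirical_usc[r r0 ball_r]|w [fj /asboolP good_fj /= near_w]].
  have [j jr] := exists_invn_lt (divr_gt0 r0 (ltr0n _ 2)).
  have j0 : (0 < j.+1%:R^-1 :> R)%R by rewrite invr_gt0.
  have [f Xf] := choice (fun i => dense (X i w) j.+1%:R^-1%R j0).
  exists ([ffun i => f i], j) => /=; last first.
    by move=> i _; rewrite /oball /= ffunE (polish_sym polish_d).
  apply/asboolP => ys near_ys; apply: ball_r => i.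
  have := near_ys i; have := Xf i; rewrite /= ffunE.
  have := polish_triangle polish_d (X i w) (D (f i)) (ys i).
  by move: jr; move: (j.+1%:R^-1)%R => e; lra.
by apply: good_fj => i; exact: near_w.
Qed.

Lemma measurable_Wpp_empirical_gt (x : R) :
  measurable [set w | x%:E < Wpp d p (empirical (fun i => X i w)) mu].
Proof.
rewrite (_ : [set w | _] = \bigcup_k
   ~` [set w | Wpp d p (empirical (fun i => X i w)) mu < (x + k.+1%:R^-1)%:E]).
  by apply: bigcupT_measurable => k; apply: measurableC; exact: measurable_Wpp_empirical_lt.
apply/seteqP; split => [w /= xW|w [k _] /= /negP]; last first.
  by rewrite -leNgt; apply: lt_le_trans; rewrite lte_fin ltrDl invr_gt0.
move: xW; case WE : (Wpp _ _ _ _) => [y| |] //=.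
  rewrite lte_fin -subr_gt0 => /exists_invn_lt[k xk]; exists k => //=; rewrite WE.
  by apply/negP; rewrite -leNgt lee_fin -lerBrDl; exact: ltW.
by move=> _; exists 0%N => //=; rewrite WE.
Qed.

End Semicontinuity.

(** * Labels of independent samples *)

Section TupleProbability.
Context {R : realType} {T : finType}.
Variable law : T -> R.
Hypothesis law_ge0 : forall t, 0 <= law t.
Hypothesis law_sum1 : \sum_t law t = 1.
Implicit Types (n : nat) (Q : pred (seq T)).

Definition tuple_prob n Q : R := \sum_(s : n.-tuple T | Q s) \prod_(t <- s) law t.

Lemma tuple_prob0 Q : tuple_prob 0 Q = (Q [::])%:R.
Proof.
rewrite /tuple_prob; case: (boolP (Q [::])) => [QN|/negbTE QN]; last first.
  by rewrite big1 // => s; rewrite tuple0 /= QN.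
rewrite (big_pred1 [tuple]) ?big_nil // => s; rewrite (tuple0 s) /= QN.
by apply/esym/eqP/val_inj.
Qed.

Lemma tuple_probS n Q :
  tuple_prob n.+1 Q = \sum_t law t * tuple_prob n (fun s => Q (t :: s)).
Proof.
rewrite /tuple_prob.
rewrite (reindex (fun ts : T * n.-tuple T => [tuple of ts.1 :: ts.2])) /=; last first.
  exists (fun s : n.+1.-tuple T => (thead s, [tuple of behead s])).
    by move=> [t s] _ /=; rewrite theadE; congr (_, _); apply: val_inj.
  by move=> s _ /=; rewrite [RHS]tuple_eta; apply: val_inj.
under [RHS]eq_bigr do rewrite mulr_sumr.
rewrite pair_big_dep /=; apply: eq_bigr => -[t s] _ /=.
by rewrite big_cons.
Qed.

Lemma tuple_prob_or n (P Q : pred (seq T)) :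
  tuple_prob n (fun s => P s || Q s) <= tuple_prob n P + tuple_prob n Q.
Proof.
rewrite /tuple_prob big_mkcond [X in _ <= X + _]big_mkcond.
rewrite [X in _ <= _ + X]big_mkcond /= -big_split /=; apply: ler_sum => s _.
have w0 : 0 <= \prod_(t <- s) law t by apply: prodr_ge0.
by case: (P s); case: (Q s) => /=; rewrite ?addr0 ?add0r // lerDl.
Qed.

Lemma tuple_prob_le1 n Q : tuple_prob n Q <= 1.
Proof.
elim: n Q => [|n IH] Q; first by rewrite tuple_prob0; case: (Q _).
by rewrite tuple_probS -law_sum1; apply: ler_sum => t _; rewrite ler_piMr.
Qed.

Lemma tuple_prob_has n (a : T) : tuple_prob n (has (pred1 a)) <= n%:R * law a.
Proof.
elim: n => [|n IH]; first by rewrite tuple_prob0 mul0r.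
rewrite tuple_probS (bigD1 a) //= -[n.+1%:R]natr1 mulrDl mul1r addrC lerD //; last first.
  by rewrite ler_piMr // tuple_prob_le1.
apply: (@le_trans _ _ (\sum_(t | t != a) law t * (n%:R * law a))).
  apply: ler_sum => t ta; rewrite ler_wpM2l //; apply: le_trans IH.
  by rewrite (_ : (fun s => _) = has (pred1 a)) //; apply/funext => s /=; rewrite (negbTE ta).
by rewrite -mulr_suml ler_piMl ?mulr_ge0 // -law_sum1 [leRHS](bigD1 a) //= lerDr.
Qed.

Lemma end_prob_tuple (V : normedZmodType R) (step : T -> V) n h v :
  end_prob law step n h v = tuple_prob n (fun s => h < `|v + \sum_(t <- s) step t|).
Proof.
rewrite /end_prob; elim: n v => [|n IH] v /=; first by rewrite tuple_prob0 big_nil addr0.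
rewrite tuple_probS; apply: eq_bigr => t _; rewrite IH; congr (_ * tuple_prob n _).
by apply/funext => s; rewrite big_cons addrA.
Qed.

End TupleProbability.

Section IidLabels.
Context {R : realType} {dO dE : measure_display} {O : measurableType dO} {E : measurableType dE}.
Context {P : probability O R} {mu : probability E R} {n : nat} {X : 'I_n -> O -> E}.
Context {T : finType} {lab : E -> T} (Q : pred (seq T)).
Hypothesis iidX : iid P mu X.
Hypothesis measurable_lab : forall t, measurable (lab @^-1` [set t]).

Let labels w := [tuple lab (X i w) | i < n].

Let labelsE s : labels @^-1` [set s] =
  \bigcap_(i in [set: 'I_n]) (X i @^-1` (lab @^-1` [set tnth s i])).
Proof.
apply/seteqP; split => w /=; first by move=> <- i _ /=; rewrite tnth_mktuple.
by move=> Xs; apply: eq_from_tnth => i; rewrite tnth_mktuple; exact: Xs.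
Qed.

Let measurable_labels s : measurable (labels @^-1` [set s]).
Proof.
have [mX _ _] := iidX; rewrite labelsE; apply: fin_bigcap_measurable => // i _.
by rewrite -[X in measurable X]setTI; exact: mX.
Qed.

Lemma measurable_iid_labels : measurable [set w | Q [seq lab (X i w) | i <- enum 'I_n]].
Proof.
rewrite (_ : [set w | _] = \bigcup_(s in [set s : n.-tuple T | Q s]) (labels @^-1` [set s])).
  by apply: fin_bigcup_measurable => // s _; exact: measurable_labels.
by apply/seteqP; split => w /=; [exists (labels w)|move=> [s /[swap] <-]].
Qed.

Lemma iid_labels : P [set w | Q [seq lab (X i w) | i <- enum 'I_n]] =
  (tuple_prob (fun t => fine (mu (lab @^-1` [set t]))) n Q)%:E.
Proof.
have [mX lawX indX] := iidX.
rewrite (measure_fintype_partition P measurable_labels measurable_iid_labels).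
rewrite /tuple_prob -sumEFin [RHS]big_mkcond /=; apply: eq_bigr => s _.
case: ifPn => Qs; last first.
  rewrite (_ : _ `&` _ = set0) ?measure0 //; apply/seteqP; split => // w [/= Qw Ls].
  by move: Qs; rewrite -Ls /= Qw.
rewrite (_ : _ `&` _ = labels @^-1` [set s]); last first.
  by apply/seteqP; split => [w []//|w Ls]; split => //=; rewrite -Ls in Qs.
rewrite labelsE indX // big_tuple -prodEFin; apply: eq_bigr => i _.
by rewrite lawX // fineK // fin_num_measure.
Qed.

End IidLabels.

(** * Tails and moments *)

Lemma integral_le_geometric d (T : measurableType d) (R : realType)
    (m : {measure set T -> \bar R}) (D : set T) (f : T -> \bar R)
    (A : nat -> set T) (b : nat -> R) (c z : R) :
  measurable D -> measurable_fun D f -> (forall x, D x -> 0 <= f x)%E ->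
  (forall j, measurable (A j)) -> (forall j, 0 <= b j) -> 0 <= c -> 0 < z -> z < 1 ->
  (forall x, D x -> exists2 j, A j x & (f x <= (b j)%:E)%E) ->
  (forall j, (b j)%:E * m (A j) <= (c * z ^+ j)%:E)%E ->
  (\int[m]_(x in D) f x <= (c / (1 - z))%:E)%E.
Proof.
move=> mD mf f0 mA b0 c0 z0 z1 f_le mass_le.
pose g j x := ((b j)%:E * (\1_(A j) x)%:E)%E.
have g0 j x : (0 <= g j x)%E by rewrite /g -EFinM lee_fin mulr_ge0.
have mI j : measurable_fun D (fun x => (\1_(A j) x : R)%:E).
  by apply/measurable_EFinP; exact: measurable_indic.
have mg j : measurable_fun D (g j) by apply: measurable_funeM.
apply: (@le_trans _ _ (\int[m]_(x in D) (\sum_(j <oo) g j x))%E).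
  apply: ge0_le_integral => //.
    by apply: ge0_emeasurable_sum => // j x Dx _.
  move=> x Dx; have [j Ajx fx] := f_le x Dx; apply: le_trans fx _.
  apply: le_trans (nneseries_lim_ge j.+1 (fun k _ _ => g0 k x)).
  rewrite big_nat_recr //= {2}/g indicE mem_set // mule1 leeDr //.
  by apply: sume_ge0.
rewrite integral_nneseries //; apply: lime_le.
  by apply: is_cvg_nneseries => j _ _; apply: integral_ge0.
apply: nearW => N; rewrite big_mkord.
apply: (@le_trans _ _ (\sum_(j < N) (c * z ^+ j)%:E)%E).
  apply: lee_sum => j _; rewrite /g ge0_integralZl_EFin //= integral_indic //.
  apply: le_trans (mass_le j); rewrite lee_wpmul2l ?lee_fin // le_measure ?inE //.
  exact: measurableI.
by rewrite sumEFin lee_fin (@ler_sum_geometric _ (fun j => c * z ^+ j)).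
Qed.

Section DyadicRadius.
Context {R : realType}.
Implicit Types (r p : R) (k : nat).

Definition dyadic r k : R := r / 2 ^+ k.

Lemma dyadic_gt0 r k : 0 < r -> 0 < dyadic r k.
Proof. by move=> r0; rewrite divr_gt0 // exprn_gt0. Qed.

Lemma dyadicS r k : dyadic r k = 2 * dyadic r k.+1.
Proof. by rewrite /dyadic exprS; field; rewrite expf_neq0. Qed.

Lemma dyadic_le r k : 0 <= r -> dyadic r k <= r.
Proof. by move=> r0; rewrite ler_pdivrMr ?exprn_gt0 // ler_peMr // exprn_ege1 // ler1n. Qed.

Lemma powR_dyadic r p k : 0 <= r -> dyadic r k `^ p = r `^ p * (2 `^ (- p)) ^+ k.
Proof.
move=> r0; rewrite powRM ?invr_ge0 ?exprn_ge0 // powRV ?exprn_ge0 //.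
by rewrite powR_exprn // powRN exprVn.
Qed.

End DyadicRadius.

Section Tail.
Context {R : realType} {dE : measure_display} {E : measurableType dE} {d : E -> E -> R}.
Hypothesis polish_d : polish d.
Variables (x0 : E) (mu : probability E R) (p : R).
Hypothesis p_ge1 : 1 <= p.

Let p_gt0 : 0 < p. Proof. exact: lt_le_trans p_ge1. Qed.

Local Notation H := (tailH d x0 mu).

Lemma tailHE t : mu (~` cball d x0 t) = (H t)%:E.
Proof. by rewrite fineK // fin_num_measure //; exact: measurable_cballC. Qed.

Lemma tailH_ge0 t : 0 <= H t.
Proof. exact: fine_ge0. Qed.

Lemma tailH_le1 t : H t <= 1.
Proof. by rewrite -lee_fin -tailHE; apply: probability_le1; exact: measurable_cballC. Qed.

Lemma le_tailH (A : set E) t : measurable A -> (forall y, A y -> t < d x0 y) ->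
  fine (mu A) <= H t.
Proof.
move=> mA At; rewrite -lee_fin -tailHE fineK ?fin_num_measure //.
apply: le_measure; rewrite ?inE //; first exact: measurable_cballC.
by rewrite setC_cball.
Qed.

Lemma tailH_anti t u : t <= u -> H u <= H t.
Proof.
move=> tu; apply: le_tailH; first exact: measurable_cballC.
by move=> y; rewrite setC_cball /=; exact: le_lt_trans.
Qed.

Let f (t : R) : \bar R := (Num.sqrt (H t) * t `^ (p - 1))%:E.

Lemma measurable_I2pp_integrand D : measurable D -> measurable_fun D f.
Proof.
move=> mD; apply/measurable_EFinP; apply: measurable_funM.
  by apply: nonincreasing_measurable => // t u tu; apply: ler_wsqrtr; exact: tailH_anti.
by apply: measurable_funTS; exact: measurable_powR.
Qed.

Lemma I2pp_integrand_ge0 t : (0 <= f t)%E.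
Proof. by rewrite lee_fin mulr_ge0 // ?sqrtr_ge0 // powR_ge0. Qed.

Lemma I2pp_ge0 : (0 <= I2pp d x0 mu p)%E.
Proof. by apply: integral_ge0 => t _; exact: I2pp_integrand_ge0. Qed.

Lemma fine_I2pp_ge0 : 0 <= fine (I2pp d x0 mu p).
Proof. exact: fine_ge0 I2pp_ge0. Qed.

Lemma integral_le_I2pp (D : set R) : measurable D -> (forall t, D t -> 0 <= t) ->
  (\int[lebesgue_measure]_(t in D) f t <= I2pp d x0 mu p)%E.
Proof.
move=> mD D0; apply: ge0_subset_integral => //.
- exact: measurable_I2pp_integrand.
- by move=> t _; exact: I2pp_integrand_ge0.
- by move=> t /D0; rewrite /= in_itv /= andbT.
Qed.

Lemma sqrt_tailH_le_integral a : 0 < a ->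
  ((Num.sqrt (H (2 * a)) * a `^ p)%:E <=
   \int[lebesgue_measure]_(t in `]a, (2 * a)%R]%classic) f t)%E.
Proof.
move=> a0.
have -> : (Num.sqrt (H (2 * a)) * a `^ p)%:E =
    (\int[lebesgue_measure]_(t in `]a, (2 * a)%R]%classic)
      (Num.sqrt (H (2 * a)) * a `^ (p - 1))%:E)%E.
  rewrite integral_cst //= lebesgue_measure_itv /= lte_fin ifT; last lra.
  by rewrite -EFinB -EFinM -(mulr_powRB1 (ltW a0) p_gt0); congr (_%:E); ring.
apply: ge0_le_integral => //.
- by move=> t _; rewrite lee_fin mulr_ge0 // ?sqrtr_ge0 // powR_ge0.
- exact: measurable_I2pp_integrand.
move=> t /=; rewrite in_itv /= => /andP[/ltW at_ t2a]; rewrite lee_fin.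
rewrite ler_pM ?sqrtr_ge0 ?powR_ge0 //; first by rewrite ler_wsqrtr // tailH_anti.
by rewrite ler_powRl ?subr_ge0 ?(ltW a0).
Qed.

Definition dyadic_sum (r : R) (K : nat) : R :=
  \sum_(k < K) dyadic r k `^ p * Num.sqrt (H (dyadic r k.+1)).

Lemma dyadic_sum_le_integral r K : 0 < r -> (((4 `^ p)^-1 * dyadic_sum r K)%:E <=
  \int[lebesgue_measure]_(t in `](dyadic r K.+1), (dyadic r 1)]%classic) f t)%E.
Proof.
move=> r0; elim: K => [|K IH].
  rewrite /dyadic_sum big_ord0 mulr0.
  by apply: integral_ge0 => t _; exact: I2pp_integrand_ge0.
have mono : dyadic r K.+1 <= dyadic r 1.
  by rewrite ler_pM2l // lef_pV2 ?posrE ?exprn_gt0 // ler_eXn2l ?ltr1n.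
have split : `](dyadic r K.+2), (dyadic r 1)]%classic =
    `](dyadic r K.+1), (dyadic r 1)]%classic `|`
    `](dyadic r K.+2), (dyadic r K.+1)]%classic :> set R.
  rewrite setUC -itv_bndbnd_setU // bnd_simp //.
  by rewrite [leRHS]dyadicS; have := dyadic_gt0 K.+2 r0; lra.
rewrite split ge0_integral_setU //; last 3 first.
- by apply: measurable_I2pp_integrand; exact: measurableU.
- by move=> t _; exact: I2pp_integrand_ge0.
- apply/disj_setPS => t /=; rewrite !in_itv /= => -[/andP[u _] /andP[_ v]].
  by move: (lt_le_trans u v); rewrite ltxx.
rewrite /dyadic_sum big_ord_recr /= mulrDr EFinD; apply: leeD => //.
have := sqrt_tailH_le_integral (dyadic_gt0 K.+2 r0); rewrite -dyadicS; apply: le_trans.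
have -> : dyadic r K = 4 * dyadic r K.+2 by rewrite dyadicS (dyadicS r K.+1); ring.
rewrite lee_fin powRM ?(ltW (dyadic_gt0 _ _)) // !mulrA mulVf ?mul1r 1?mulrC //.
Qed.

Lemma dyadic_sum_le_I2pp r K : 0 < r -> (I2pp d x0 mu p < +oo)%E ->
  dyadic_sum r K <= 4 `^ p * fine (I2pp d x0 mu p).
Proof.
move=> r0 If; rewrite -ler_pdivrMl ?powR_gt0 // -lee_fin fineK ?ge0_fin_numE ?I2pp_ge0 //.
apply: le_trans (dyadic_sum_le_integral K r0) _; apply: integral_le_I2pp => // t /=.
rewrite in_itv /= => /andP[/ltW/(le_trans _) + _]; apply.
exact/ltW/dyadic_gt0.
Qed.

Lemma weak_moment_lty : (I2pp d x0 mu p < +oo)%E -> (weak_moment d x0 mu (2 * p) < +oo)%E.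
Proof.
move=> If; have IE : I2pp d x0 mu p = (fine (I2pp d x0 mu p))%:E.
  by rewrite fineK // ge0_fin_numE // I2pp_ge0.
set I := fine _ in IE; apply: le_lt_trans (ltry ((2 `^ p * I) ^+ 2)).
apply: ge_ereal_sup => _ [t /= t0 <-]; rewrite lee_fin.
have [->|t_neq0] := eqVneq t 0.
  by rewrite powR0 ?mul0r ?sqr_ge0 // gt_eqF // mulr_gt0.
have th0 : 0 < t / 2 by rewrite divr_gt0 // lt_neqAle eq_sym t_neq0.
have tI : Num.sqrt (H t) * (t / 2) `^ p <= I.
  rewrite -lee_fin -IE; have := sqrt_tailH_le_integral th0.
  rewrite [2 * _]mulrC divfK // => /le_trans; apply; apply: integral_le_I2pp => // u /=.
  by rewrite in_itv /= => /andP[/ltW/(le_trans _) + _]; apply; exact: ltW.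
have -> : t `^ (2 * p) * H t = (2 `^ p * (Num.sqrt (H t) * (t / 2) `^ p)) ^+ 2.
  rewrite mulrCA -powRM ?(ltW th0) // [2 * (t / 2)]mulrC divfK // exprMn sqr_sqrtr ?tailH_ge0 //.
  by rewrite mulrC -powR_mulrn ?powR_ge0 // -powRrM [p * _]mulrC.
rewrite lerXn2r ?nnegrE ?mulr_ge0 ?sqrtr_ge0 ?powR_ge0 ?fine_I2pp_ge0 //.
by rewrite ler_wpM2l ?powR_ge0.
Qed.

Section WeakMoment.
Variable s : R.
Hypothesis weak_fin : (weak_moment d x0 mu s < +oo)%E.

Local Notation wm := (fine (weak_moment d x0 mu s)).

Lemma weak_moment_ub t : 0 <= t -> t `^ s * H t <= wm.
Proof.
move=> t0; have ub : ((t `^ s * H t)%:E <= weak_moment d x0 mu s)%E.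
  by apply: ereal_sup_ubound; exists t.
rewrite -lee_fin fineK // ge0_fin_numE //; apply: le_trans ub.
by rewrite lee_fin mulr_ge0 // ?powR_ge0 // tailH_ge0.
Qed.

Lemma weak_moment_ge0 : 0 <= wm.
Proof. by apply: le_trans (weak_moment_ub (lexx 0)); rewrite mulr_ge0 ?powR_ge0 ?tailH_ge0. Qed.

Lemma tailH_le_weak t : 0 < t -> H t <= wm * t `^ (- s).
Proof.
by move=> t0; rewrite powRN ler_pdivlMr ?powR_gt0 // mulrC; apply/weak_moment_ub/ltW.
Qed.

Lemma sqrt_tailH_le_weak t : 0 < t -> Num.sqrt (H t) <= Num.sqrt wm * t `^ (- (s / 2)).
Proof.
move=> t0; apply: le_trans (ler_wsqrtr (tailH_le_weak t0)) _.
by rewrite sqrtrM ?weak_moment_ge0 // sqrt_powR mulNr.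
Qed.

Definition outer_moment_cst : R := 2 `^ p / (1 - 2 `^ (p - s)).

Lemma integral_outside_le r (C : set E) : p < s -> 0 < r -> measurable C ->
  (forall y, C y -> r < d x0 y) ->
  (\int[mu]_(y in C) (d x0 y `^ p)%:E <= (outer_moment_cst * wm * r `^ (p - s))%:E)%E.
Proof.
move=> ps r0 mC Cr.
have -> : outer_moment_cst * wm * r `^ (p - s) =
    2 `^ p * wm * r `^ (p - s) / (1 - 2 `^ (p - s)).
  by rewrite /outer_moment_cst; ring.
apply: (@integral_le_geometric _ _ _ mu C _ (fun j => ~` cball d x0 (2 ^+ j * r))
  (fun j => (2 ^+ j.+1 * r) `^ p)) => //.
- by apply: measurable_funTS; exact: measurable_cost.
- by move=> y _; exact: cost_ge0.
- by move=> j; exact: measurable_cballC.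
- by move=> j; exact: powR_ge0.
- by rewrite !mulr_ge0 ?powR_ge0 ?weak_moment_ge0.
- by rewrite powR_lt1 ?ltr1n // subr_lt0.
- move=> y Cy; have : 1 < d x0 y / r by rewrite ltr_pdivlMr // mul1r Cr.
  move=> /dyadic_above[j yj jy]; exists j.
    by rewrite setC_cball /= -ltr_pdivlMr.
  by rewrite lee_fin ler_powRl ?(polish_ge0 polish_d) ?(ltW p_gt0) // -ler_pdivrMr.
move=> j; have jr : 0 < 2 ^+ j * r by rewrite mulr_gt0 // exprn_gt0.
have -> : 2 `^ p * wm * r `^ (p - s) * 2 `^ (p - s) ^+ j =
    (2 ^+ j.+1 * r) `^ p * (wm * (2 ^+ j * r) `^ (- s)).
  have -> : 2 ^+ j.+1 * r = 2 * (2 ^+ j * r) by rewrite exprS mulrA.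
  rewrite (powRM _ _ (ltW jr)) // -powR_exprn //.
  transitivity (2 `^ p * wm * (2 ^+ j * r) `^ (p - s)); last by rewrite gt0_powRD //; ring.
  by rewrite powRM ?exprn_ge0 ?(ltW r0) //; ring.
rewrite EFinM lee_wpmul2l ?lee_fin ?powR_ge0 //.
by have := tailH_le_weak jr; rewrite -lee_fin -tailHE.
Qed.

Lemma pmoment_lty : p < s -> (pmoment d x0 mu p < +oo)%E.
Proof.
move=> ps; have mB := measurable_cball polish_d x0 1.
have mc : measurable_fun setT (fun y => (d x0 y `^ p)%:E) by exact: measurable_cost.
rewrite /pmoment -(setvU (cball d x0 1)) ge0_integral_setU //; last 4 first.
- exact: measurable_cballC.
- by rewrite setvU.
- by move=> y _; exact: cost_ge0.
- by rewrite disj_set2E setICl.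
apply: lte_add_pinfty.
  apply: le_lt_trans (integral_outside_le ps ltr01 _ _) (ltry _).
  - exact: measurable_cballC.
  - by rewrite setC_cball.
apply: (@le_lt_trans _ _ (\int[mu]_(y in cball d x0 1) 1%:E)%E).
  apply: ge0_le_integral => //.
  - by move=> y _; exact: cost_ge0.
  - exact: measurable_funTS.
  - by move=> y y1; rewrite lee_fin powR_le1 ?(polish_ge0 polish_d) ?(ltW p_gt0).
by rewrite integral_cst // mul1e -ge0_fin_numE // fin_num_measure.
Qed.

Lemma integral_I2pp_outside_le : 2 * p < s ->
  (\int[lebesgue_measure]_(t in `]1%R, +oo[%classic) f t <=
   (Num.sqrt wm * 2 `^ (p - 1) / (1 - 2 `^ (p - s / 2)))%:E)%E.
Proof.
move=> ps; apply: (@integral_le_geometric _ _ _ lebesgue_measure _ f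
  (fun j => `]2 ^+ j, 2 ^+ j.+1]%classic)
  (fun j => Num.sqrt wm * (2 ^+ j) `^ (- (s / 2)) * (2 ^+ j.+1) `^ (p - 1))) => //.
- exact: measurable_I2pp_integrand.
- by move=> t _; exact: I2pp_integrand_ge0.
- by rewrite powR_lt1 ?ltr1n // subr_lt0 ltr_pdivlMr // mulrC.
- move=> t /=; rewrite in_itv /= andbT => t1; have [j jt tj] := dyadic_above t1.
  exists j; first by rewrite /= in_itv /= jt.
  rewrite lee_fin ler_pM ?sqrtr_ge0 ?powR_ge0 //.
    apply: le_trans (sqrt_tailH_le_weak _); last by rewrite exprn_gt0.
    by rewrite ler_wsqrtr // tailH_anti // ltW.
  by rewrite ler_powRl ?subr_ge0 // (le_trans ler01) // ltW.
move=> j; have jp : 0 < 2 ^+ j :> R by rewrite exprn_gt0.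
rewrite [X in (_ * X)%E](_ : _ = (2 ^+ j)%:E); last first.
  apply: etrans (lebesgue_measure_itv _) _; rewrite /= lte_fin ltr_eXn2l ?ltr1n // ltnSn.
  by rewrite -EFinB exprS mulr_natl mulr2n addrK.
rewrite -EFinM lee_fin.
rewrite -powR_exprn // [p - s / 2]addrC (gt0_powRD _ _ jp) -(mulr_powRB1 (ltW jp) p_gt0).
rewrite exprS powRM ?(ltW jp) // le_eqVlt; apply/orP; left; apply/eqP; ring.
Qed.

Lemma I2pp_lty : 2 * p < s -> (I2pp d x0 mu p < +oo)%E.
Proof.
move=> ps; have split : `[0, +oo[%classic = `[0, 1]%classic `|` `]1, +oo[%classic :> set R.
  by rewrite -itv_bndbnd_setU // bnd_simp.
rewrite /I2pp split ge0_integral_setU //; last 3 first.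
- by apply: measurable_I2pp_integrand; exact: measurableU.
- by move=> t _; exact: I2pp_integrand_ge0.
- apply/disj_setPS => t /=; rewrite !in_itv /= andbT => -[/andP[_ t1]].
  by rewrite ltNge t1.
apply: lte_add_pinfty; last exact: le_lt_trans (integral_I2pp_outside_le ps) (ltry _).
apply: (@le_lt_trans _ _ (\int[lebesgue_measure]_(t in `[0%R, 1%R]%classic) 1%:E)%E).
  apply: ge0_le_integral => //.
  - by move=> t _; exact: I2pp_integrand_ge0.
  - exact: measurable_I2pp_integrand.
  move=> t /=; rewrite in_itv /= => /andP[t0 t1].
  rewrite lee_fin mulr_ile1 ?sqrtr_ge0 ?powR_ge0 ?powR_le1 ?subr_ge0 //.
  by rewrite -sqrtr1 ler_wsqrtr // tailH_le1.
by rewrite integral_cst //= lebesgue_measure_itv /= lte_fin ltr01 oppr0 adde0 mule1 ltry.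
Qed.

Definition weak_dyadic_cst : R := 2 `^ (s / 2) / (1 - 2 `^ (s / 2 - p)).

Lemma dyadic_sum_le_weak r K : s < 2 * p -> 0 < r ->
  dyadic_sum r K <= weak_dyadic_cst * (Num.sqrt wm * r `^ (p - s / 2)).
Proof.
move=> sp r0.
have -> : weak_dyadic_cst * (Num.sqrt wm * r `^ (p - s / 2)) =
    2 `^ (s / 2) * (Num.sqrt wm * r `^ (p - s / 2)) / (1 - 2 `^ (s / 2 - p)).
  by rewrite /weak_dyadic_cst mulrAC.
apply: (@ler_sum_geometric _ (fun k => dyadic r k `^ p * Num.sqrt (H (dyadic r k.+1)))).
- by rewrite !mulr_ge0 ?sqrtr_ge0 ?powR_ge0.
- exact: powR_gt0.
- by rewrite powR_lt1 ?ltr1n // subr_lt0 ltr_pdivrMr // mulrC.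
move=> k; have ak := dyadic_gt0 k r0; have ak1 := dyadic_gt0 k.+1 r0.
apply: le_trans (ler_wpM2l (powR_ge0 _ _) (sqrt_tailH_le_weak ak1)) _.
have -> : dyadic r k.+1 `^ (- (s / 2)) = 2 `^ (s / 2) * dyadic r k `^ (- (s / 2)).
  rewrite (dyadicS r k) powRM ?(ltW ak1) // mulrA -gt0_powRD // subrr powRr0 mul1r //.
rewrite le_eqVlt; apply/orP; left; apply/eqP.
transitivity (2 `^ (s / 2) * Num.sqrt wm * dyadic r k `^ (p - s / 2)).
  by rewrite gt0_powRD //; ring.
by rewrite powR_dyadic ?(ltW r0) // opprB; ring.
Qed.

End WeakMoment.

End Tail.

Arguments dyadic_sum {R dE E} d x0 mu p r K.

(** * Shells and nested cells *)

Section MeasurableFibers.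
Context {dE : measure_display} {E : measurableType dE}.

Definition measurable_fibers (T : Type) (f : E -> T) : Prop :=
  forall t, measurable (f @^-1` [set t]).

Lemma measurable_fibers_cst (T : Type) (c : T) : measurable_fibers (fun=> c).
Proof.
move=> t; have [ct|ct] := pselect (c = t).
  by rewrite (_ : _ @^-1` _ = setT) //; apply/seteqP; split.
by rewrite (_ : _ @^-1` _ = set0) //; apply/seteqP; split.
Qed.

Lemma measurable_fibers_preimage (T : countType) (f : E -> T) (B : set T) :
  measurable_fibers f -> measurable (f @^-1` B).
Proof.
move=> mf; rewrite (_ : f @^-1` B = \bigcup_(t in B) (f @^-1` [set t])).
  rewrite bigcup_mkcond; apply: countable_bigcupT_measurable => // t.
  by case: ifP.
by apply/seteqP; split => [y By|y [t Bt /= ->]] //; exists (f y).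
Qed.

Lemma measurable_fibers_bind (U : countType) (T : Type) (u : E -> U) (g : U -> E -> T) :
  measurable_fibers u -> (forall k, measurable_fibers (g k)) ->
  measurable_fibers (fun y => g (u y) y).
Proof.
move=> mu mg t; rewrite (_ : _ @^-1` _ = \bigcup_k (u @^-1` [set k] `&` g k @^-1` [set t])).
  by apply: countable_bigcupT_measurable => // k; apply: measurableI; [exact: mu|exact: mg].
by apply/seteqP; split => [y <-|y [k _ [/= -> ]]] //; exists (u y).
Qed.

Lemma measurable_fibers_bool (b : E -> bool) : measurable [set y | b y] -> measurable_fibers b.
Proof.
move=> mb -[] /=; first by rewrite (_ : _ @^-1` _ = [set y | b y]).
rewrite (_ : _ @^-1` _ = ~` [set y | b y]); first exact: measurableC.
by apply/seteqP; split => y /= /negP; rewrite ?negbK; case: (b y).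
Qed.

Lemma measurable_fibers_find (A : Type) (s : seq A) (Q : A -> E -> bool) :
  (forall a, measurable [set y | Q a y]) -> measurable_fibers (fun y => find (Q^~ y) s).
Proof.
move=> mQ; elim: s => [|a s IH] /=; first exact: measurable_fibers_cst.
apply: (measurable_fibers_bind (g := fun q y => if q then 0%N else (find (Q^~ y) s).+1)).
  exact: measurable_fibers_bool.
case; first exact: measurable_fibers_cst.
apply: (measurable_fibers_bind (g := fun m _ => m.+1) IH) => m.
exact: measurable_fibers_cst.
Qed.

End MeasurableFibers.

Section Nets.
Context {R : realType} {E : choiceType} (d : E -> E -> R).

Definition net (Y : set E) (delta : R) (s : seq E) : Prop :=
  (forall z, z \in s -> Y z) /\ (forall y, Y y -> has (fun z => d z y <= delta) s).

Definition net_index (delta : R) (s : seq E) (y : E) : nat := find (fun z => d z y <= delta) s.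

Lemma net_indexP Y delta s z0 y : net Y delta s -> Y y ->
  (net_index delta s y < size s)%N /\ d (nth z0 s (net_index delta s y)) y <= delta.
Proof.
by move=> [_ cover] /cover near_y; rewrite -has_find; split; last exact: (nth_find z0 near_y).
Qed.

Lemma covering_number_net (Y : set E) (delta c : R) :
  (covering_number d Y delta <= c%:E)%E ->
  exists2 s : seq E, net Y delta s & (size s)%:R <= c + 1.
Proof.
move=> cov; have : (covering_number d Y delta < (c + 1)%:E)%E.
  by apply: le_lt_trans cov _; rewrite lte_fin ltrDl.
move=> /ereal_inf_lt[_ [m [y [yY Ycov]] <-]]; rewrite lte_fin => mc.
exists [seq y j | j <- enum 'I_m]; last by rewrite size_map size_enum_ord ltW.
split=> [z /mapP[j _ ->] //|z /Ycov[j yz]].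
by apply/hasP; exists (y j) => //; apply: map_f; rewrite mem_enum.
Qed.

End Nets.

Lemma sum_option (V : nmodType) (A : finType) (G : option A -> V) :
  \sum_F G F = G None + \sum_a G (Some a).
Proof.
rewrite (bigD1 None) //=; congr (_ + _); rewrite (reindex_omap Some id) /=; last by case.
by apply: eq_bigl => a; rewrite eqxx.
Qed.

Section Cells.
Context {R : realType} {dE : measure_display} {E : measurableType dE} {d : E -> E -> R}.
Hypothesis polish_d : polish d.
Variables (x0 : E) (S : set E) (rho : R) (K L N : nat) (ctr : nat -> nat -> seq E).
Hypothesis measurable_S : measurable S.
Hypothesis rho_gt0 : 0 < rho.

Local Notation radius := (dyadic rho).

Definition mesh (k l : nat) : R := dyadic (2 * radius k) l.

Hypothesis ctr_net : forall k l, net d (S `&` cball d x0 (radius k)) (mesh k l) (ctr k l).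
Hypothesis ctr_size : forall k l, (k < K)%N -> (l <= L)%N -> (size (ctr k l) <= N)%N.

Definition inside (y : E) : bool := `[< (S `&` cball d x0 rho) y >].

(* Index [k < K] stands for the shell of radii in ]radius k.+1, radius k], and [K] for the
   remaining ball of radius [radius K]. *)
Definition shell (y : E) : nat := find (fun k => radius k.+1 < d x0 y) (iota 0 K).

Definition leaf_index (y : E) : nat :=
  if (shell y < K)%N then net_index d (mesh (shell y) L) (ctr (shell y) L) y else 0%N.

Definition label : finType := option ('I_K.+1 * 'I_N.+1).

Definition label_of (y : E) : label :=
  if inside y then Some (inord (shell y), inord (leaf_index y)) else None.

Definition parent_index (k l j : nat) : nat :=
  net_index d (mesh k l) (ctr k l) (nth x0 (ctr k l.+1) j).

Definition parent (l : nat) (t : label) : label :=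
  if t is Some (k, j) then Some (k, if l is 0 then ord0 else inord (parent_index k l j))
  else None.

Fixpoint ancestor (m : nat) (t : label) : label :=
  if m is m'.+1 then parent (L - m) (ancestor m' t) else t.

Definition cell (l : nat) (t : label) : label := if l is 0 then parent 0 t else ancestor (L - l) t.

Lemma mesh_gt0 k l : 0 < mesh k l.
Proof. by rewrite dyadic_gt0 // mulr_gt0 // dyadic_gt0. Qed.

Lemma parent_shell l (t : label) : omap fst (parent l t) = omap fst t.
Proof. by case: t => [[k j]|]. Qed.

Lemma ancestor_shell m (t : label) : omap fst (ancestor m t) = omap fst t.
Proof. by elim: m => //= m IH; rewrite parent_shell. Qed.

Lemma cell_shell l (t : label) : omap fst (cell l t) = omap fst t.
Proof. by case: l => [|l]; rewrite ?parent_shell ?ancestor_shell. Qed.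

Lemma cell_eq_None l (t : label) : (cell l t == None) = (t == None).
Proof. by have := cell_shell l t; case: (cell l t) => [[? ?]|]; case: t => [[? ?]|]. Qed.

Lemma cell_None l : cell l None = None.
Proof. by apply/eqP; rewrite cell_eq_None. Qed.

Lemma cellS l t : (l < L)%N -> cell l t = parent l (cell l.+1 t).
Proof.
case: l => [|l] lL; last by rewrite /= -(subnSK lL) /= subnSK // subKn // ltnW.
have := ancestor_shell (L - 1) t; rewrite /cell.
by case: (ancestor _ t) => [[k j]|]; case: t => [[k' j']|] //= [->].
Qed.

Lemma cell0 k j : cell 0 (Some (k, j)) = Some (k, ord0).
Proof. by []. Qed.

Arguments cell : simpl never.

Lemma shell_le y : (shell y <= K)%N.
Proof. by rewrite /shell (leq_trans (find_size _ _)) // size_iota. Qed.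

Lemma shellK y : (inord (shell y) : 'I_K.+1) = shell y :> nat.
Proof. by rewrite inordK // ltnS shell_le. Qed.

Lemma shell_inner y : ~~ (shell y < K)%N -> shell y = K.
Proof. by move=> sK; apply/eqP; rewrite eqn_leq shell_le leqNgt. Qed.

Lemma shell_gt y : (shell y < K)%N -> radius (shell y).+1 < d x0 y.
Proof.
move=> sK; have out : has (fun k => radius k.+1 < d x0 y) (iota 0 K).
  by rewrite has_find size_iota.
by have := nth_find 0%N out; rewrite -/(shell y) nth_iota.
Qed.

Lemma insideP y : inside y -> S y /\ d x0 y <= radius (shell y).
Proof.
move=> /asboolP[Sy yr]; split => //; case sE : (shell y) => [|k].
  by rewrite /dyadic expr0 divr1.
have kK : (k < K)%N by have := shell_le y; rewrite sE.
have : (k < shell y)%N by rewrite sE.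
by move/(before_find 0%N)/negbT; rewrite nth_iota // add0n -leNgt.
Qed.

Lemma label_of_inside y : inside y ->
  label_of y = Some (inord (shell y), inord (leaf_index y)).
Proof. by rewrite /label_of => ->. Qed.

Lemma label_of_None y : (label_of y == None) = ~~ inside y.
Proof. by rewrite /label_of; case: (inside y). Qed.

Lemma label_of_Some y k j : label_of y = Some (k, j) -> inside y /\ shell y = k :> nat.
Proof. by rewrite /label_of; case: ifP => // yin [<- _]; rewrite shellK. Qed.

Lemma label_of_inner y : inside y -> shell y = K -> label_of y = Some (inord K, inord 0).
Proof. by move=> yin yK; rewrite label_of_inside // /leaf_index yK ltnn. Qed.

Lemma leaf_indexP y : inside y -> (shell y < K)%N ->
  (leaf_index y < size (ctr (shell y) L))%N /\
  d (nth x0 (ctr (shell y) L) (leaf_index y)) y <= mesh (shell y) L.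
Proof. by move=> /insideP yin sK; rewrite /leaf_index sK; apply: net_indexP. Qed.

Lemma parent_indexP k l j : (j < size (ctr k l.+1))%N ->
  (parent_index k l j < size (ctr k l))%N /\
  d (nth x0 (ctr k l) (parent_index k l j)) (nth x0 (ctr k l.+1) j) <= mesh k l.
Proof.
move=> js; apply: net_indexP (ctr_net k l) _.
exact: (ctr_net k l.+1).1 (mem_nth x0 js).
Qed.

(* The distances to the successive centres form a geometric sum. *)
Lemma cell_centre l y : (0 < l)%N -> (l <= L)%N -> inside y -> (shell y < K)%N ->
  exists2 j : nat, cell l (label_of y) = Some (inord (shell y), inord j) &
    (j < size (ctr (shell y) l))%N /\
    d (nth x0 (ctr (shell y) l) j) y <= 2 * mesh (shell y) l - mesh (shell y) L.
Proof.
move=> l0 lL yin sK; set k := shell y.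
rewrite -(subKn lL); have : (L - l < L)%N by rewrite ltn_subrL l0 (leq_trans l0).
elim: (L - l)%N => [|m IH] mL.
  have [js jd] := leaf_indexP yin sK; rewrite -/k in js jd.
  exists (leaf_index y); last by rewrite subn0; split => //; lra.
  by rewrite subn0 /cell subnn -label_of_inside //; case: (L) mL.
have [j jE [js jd]] := IH (ltnW mL).
have lS : (L - m = (L - m.+1).+1)%N by rewrite subnSK // ltnW.
have l'0 : (0 < L - m.+1)%N by rewrite subn_gt0.
have l'L : (L - m.+1 < L)%N by rewrite -lS leq_subr.
rewrite lS in jE js jd; move: l'0 l'L jE js jd; case: (L - m.+1)%N => // l' _ l'L jE js jd.
have [js' jd'] := parent_indexP js; exists (parent_index k l'.+1 j).
  rewrite cellS // jE /= shellK -/k; congr (Some (_, inord (parent_index _ _ _))).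
  by rewrite inordK // ltnS (leq_trans (ltnW js)) // ctr_size.
split => //; have := dyadicS (2 * radius k) l'.+1; rewrite -/(mesh k _) -/(mesh k _).
have := polish_triangle polish_d (nth x0 (ctr k l'.+1) (parent_index k l'.+1 j))
  (nth x0 (ctr k l'.+2) j) y.
lra.
Qed.

Lemma cell_same_shell l x y : inside x -> inside y ->
  cell l (label_of x) = cell l (label_of y) -> shell x = shell y.
Proof.
move=> xin yin same; have := cell_shell l (label_of x).
rewrite same cell_shell !label_of_inside //= => -[] /(congr1 val) /=.
by rewrite !shellK.
Qed.

Lemma cell_inside l x y : inside x -> cell l (label_of x) = cell l (label_of y) -> inside y.
Proof.
move=> xin same; apply: contraT; rewrite -label_of_None => /eqP yN.
by move: same => /eqP; rewrite yN cell_None cell_eq_None label_of_inside.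
Qed.

Lemma shell_diam x y : inside x -> inside y -> shell x = shell y ->
  d x y <= 2 * radius (shell x).
Proof.
move=> /insideP[_ xr] /insideP[_ yr] sE; have := polish_triangle polish_d x x0 y.
by rewrite (polish_sym polish_d x x0); rewrite -sE in yr; lra.
Qed.

Lemma cell_diam l x y : (l <= L)%N -> inside x -> inside y -> (shell x < K)%N ->
  cell l (label_of x) = cell l (label_of y) -> d x y <= dyadic (8 * radius (shell x)) l.
Proof.
move=> lL xin yin sx same; have sE := cell_same_shell xin yin same.
have [l0|l0] := posnP l.
  have -> : dyadic (8 * radius (shell x)) l = 8 * radius (shell x).
    by rewrite l0 /dyadic expr0 divr1.
  apply: le_trans (shell_diam xin yin sE) _.
  by rewrite ler_wpM2r ?ler_nat // ltW // dyadic_gt0.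
have sy : (shell y < K)%N by rewrite -sE.
have [i iE [i_s i_d]] := cell_centre l0 lL xin sx.
have [j jE [j_s j_d]] := cell_centre l0 lL yin sy.
rewrite -sE in j_s j_d jE; have small u : (u < size (ctr (shell x) l))%N -> (u < N.+1)%N.
  by move=> us; rewrite ltnS (leq_trans (ltnW us)) // ctr_size.
move: same; rewrite iE jE => -[] /(congr1 val) /=.
rewrite !inordK ?small // => ij; rewrite ij in i_d.
have := polish_triangle polish_d x (nth x0 (ctr (shell x) l) j) y.
rewrite (polish_sym polish_d x (nth _ _ _)).
have -> : dyadic (8 * radius (shell x)) l = 4 * mesh (shell x) l by rewrite /mesh /dyadic; ring.
have := mesh_gt0 (shell x) L; lra.
Qed.

Lemma measurable_inside : measurable [set y | inside y].
Proof.
rewrite (_ : [set _ | _] = S `&` cball d x0 rho).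
  by apply: measurableI => //; exact: (measurable_cball polish_d).
by apply/seteqP; split => y /asboolP.
Qed.

Lemma measurable_fibers_shell : measurable_fibers shell.
Proof.
apply: (measurable_fibers_find _ (Q := fun k y => radius k.+1 < d x0 y)) => k.
by rewrite -setC_cball; exact: (measurable_cballC polish_d).
Qed.

Lemma measurable_fibers_leaf_index : measurable_fibers leaf_index.
Proof.
apply: (measurable_fibers_bind (g := fun k y => if (k < K)%N then
   net_index d (mesh k L) (ctr k L) y else 0%N)); first exact: measurable_fibers_shell.
move=> k; case: (k < K)%N; last exact: measurable_fibers_cst.
apply: (measurable_fibers_find _ (Q := fun z y => d z y <= mesh k L)) => z.
exact: (measurable_cball polish_d).
Qed.

Lemma measurable_label_of : measurable_fibers label_of.
Proof.
apply: (measurable_fibers_bind (g := fun b y => if b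
  then Some (inord (shell y), inord (leaf_index y)) : label else None)).
  exact: measurable_fibers_bool measurable_inside.
case; last exact: measurable_fibers_cst.
apply: (measurable_fibers_bind (g := fun k y => Some (inord k, inord (leaf_index y)) : label)).
  exact: measurable_fibers_shell.
move=> k; apply: (measurable_fibers_bind (g := fun j _ => Some (inord k, inord j) : label)).
  exact: measurable_fibers_leaf_index.
by move=> j; exact: measurable_fibers_cst.
Qed.

Section Masses.
Variables (mu : probability E R) (p : R).
Hypothesis p_ge1 : 1 <= p.

Let p_ge0 : 0 <= p. Proof. exact: le_trans p_ge1. Qed.

Definition cell_mass (t : label) : R := fine (mu (label_of @^-1` [set t])).

Lemma cell_massE t : mu (label_of @^-1` [set t]) = (cell_mass t)%:E.
Proof. by rewrite fineK // fin_num_measure //; exact: measurable_label_of. Qed.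

Lemma cell_mass_ge0 t : 0 <= cell_mass t.
Proof. exact: fine_ge0. Qed.

Lemma measurable_label_pred (Q : pred label) : measurable [set y | Q (label_of y)].
Proof. exact: (measurable_fibers_preimage [set t | Q t] measurable_label_of). Qed.

Lemma sum_cell_mass (Q : pred label) :
  \sum_(t | Q t) cell_mass t = fine (mu [set y | Q (label_of y)]).
Proof.
have mQ := measurable_label_pred Q; apply: EFin_inj.
rewrite fineK ?fin_num_measure // (measure_fintype_partition mu measurable_label_of mQ).
rewrite -sumEFin big_mkcond /=; apply: eq_bigr => t _; case: ifPn => Qt.
  rewrite -cell_massE; congr (mu _).
  by apply/seteqP; split => [y /= yt|y []//]; split => //=; rewrite yt.
rewrite (_ : _ `&` _ = set0) ?measure0 //; apply/seteqP; split => // y [/= Qy yt].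
by move: Qt; rewrite -yt Qy.
Qed.

Lemma cell_mass_sum1 : \sum_t cell_mass t = 1.
Proof.
rewrite sum_cell_mass (_ : [set _ | _] = setT) ?probability_setT //.
by apply/seteqP; split.
Qed.

Lemma measurable_label_fun (w : label -> R) :
  measurable_fun setT (fun y => (w (label_of y))%:E).
Proof.
apply/measurable_EFinP; apply: measurable_fun_lt => r.
exact: (measurable_label_pred (fun t => w t < r)).
Qed.

Lemma integral_label (w : label -> R) : (forall t, 0 <= w t) ->
  (\int[mu]_y (w (label_of y))%:E = (\sum_t cell_mass t * w t)%:E)%E.
Proof.
move=> w0; have mw := measurable_label_fun w.
have labT : [set` enum label] = [set: label] by apply/seteqP; split => t //= _; rewrite mem_enum.
have -> : setT = \big[setU/set0]_(t <- enum label) (label_of @^-1` [set t]) :> set E.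
  by rewrite -bigcup_seq labT; apply/seteqP; split => // y _; exists (label_of y).
rewrite ge0_integral_bigsetU ?enum_uniq //; last 4 first.
- by move=> t; exact: measurable_label_of.
- by apply/trivIsetP => t u _ _ tu; apply/seteqP; split => // y [/= -> e]; move: tu; rewrite e eqxx.
- exact: measurable_funTS.
- by move=> y _; rewrite lee_fin.
rewrite -sumEFin big_enum; apply: eq_bigr => t _.
rewrite mulrC EFinM -cell_massE -integral_cst //; last exact: measurable_label_of.
by apply: eq_integral => y; rewrite inE => /= ->.
Qed.

Lemma cell_mass_None_le : mu S = 1%E -> cell_mass None <= tailH d x0 mu rho.
Proof.
move=> S1; have mSC : measurable (~` S) by exact: measurableC.
have mO : measurable (~` cball d x0 rho) by exact: measurable_cballC.
have SC0 : mu (~` S) = 0%E by rewrite probability_setC // S1 subee.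
rewrite -lee_fin -cell_massE -tailHE //.
rewrite (_ : _ @^-1` _ = ~` S `|` ~` cball d x0 rho); last first.
  rewrite -setCI; apply/seteqP; split => y /=.
    by move=> /eqP; rewrite label_of_None => /asboolPn.
  by move=> out; apply/eqP; rewrite label_of_None; exact/asboolPn.
apply: le_trans (measureU2 mu mSC mO) _.
by rewrite [X in (X + _)%E](_ : _ = 0%E) ?add0e //; exact: SC0.
Qed.

Definition shell_mass (k : 'I_K.+1) : R := fiber_sum (omap fst) cell_mass (Some k).

Lemma shell_mass_le (k : 'I_K.+1) : (k < K)%N -> shell_mass k <= tailH d x0 mu (radius k.+1).
Proof.
move=> kK; rewrite /shell_mass /fiber_sum sum_cell_mass; apply: le_tailH => //.
  exact: (measurable_label_pred (fun t => omap fst t == Some k)).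
move=> y /=; case yE : (label_of y) => [[k' j]|] //= /eqP[k'k].
by have [_ sy] := label_of_Some yE; rewrite -k'k -sy; apply: shell_gt; rewrite sy k'k.
Qed.

Lemma shell_mass_le1 k : shell_mass k <= 1.
Proof.
rewrite -cell_mass_sum1 /shell_mass /fiber_sum [leRHS](bigID (fun t => omap fst t == Some k)) /=.
by rewrite lerDl sumr_ge0 // => t _; exact: cell_mass_ge0.
Qed.

Lemma dist_powR_le x y : d x y `^ p <= (2 * d x0 x) `^ p + (2 * d x0 y) `^ p.
Proof.
have d0 := polish_ge0 polish_d; rewrite !powRM //.
have := powR_add_le p_ge0 (d0 x0 x) (d0 x0 y) ltr01; rewrite invr1.
rewrite -[1 + 1]/(2%:R); apply: le_trans; rewrite ler_powRl //.
by have := polish_triangle polish_d x x0 y; rewrite (polish_sym polish_d x x0).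
Qed.

(** * Transport costs between cells *)

Section Costs.
Hypothesis moment_fin : (pmoment d x0 mu p < +oo)%E.

Lemma integral_dist_fin x (C : set E) : measurable C ->
  (\int[mu]_(y in C) (d x y `^ p)%:E)%E \is a fin_num.
Proof.
move=> mC; rewrite ge0_fin_numE; last by apply: integral_ge0 => y _; exact: cost_ge0.
have mc z : measurable_fun setT (fun y => (d z y `^ p)%:E) by exact: measurable_cost.
apply: (@le_lt_trans _ _
    (\int[mu]_y (((2 * d x0 x) `^ p)%:E + (2 `^ p)%:E * (d x0 y `^ p)%:E)))%E.
  apply: (@le_trans _ _ (\int[mu]_y (d x y `^ p)%:E)%E).
    by apply: ge0_subset_integral => // y _; exact: cost_ge0.
  apply: ge0_le_integral => //.
  - by move=> y _; exact: cost_ge0.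
  - by apply: emeasurable_funD => //; exact: measurable_funeM.
  - move=> y _; rewrite -EFinM -EFinD lee_fin -powRM ?(polish_ge0 polish_d) //.
    exact: dist_powR_le.
rewrite ge0_integralD //; last 3 first.
- by move=> y _; rewrite lee_fin powR_ge0.
- by move=> y _; rewrite mule_ge0 ?cost_ge0 ?lee_fin ?powR_ge0.
- exact: measurable_funeM.
rewrite integral_cst //= probability_setT mule1 ge0_integralZl_EFin ?powR_ge0 //; last first.
  by move=> y _; exact: cost_ge0.
apply: lte_add_pinfty; first exact: ltry.
by apply: lte_mul_pinfty => //; rewrite lee_fin powR_ge0.
Qed.

Definition avg_cost (x : E) (t : label) : R :=
  fine (\int[mu]_(y in label_of @^-1` [set t]) (d x y `^ p)%:E)%E / cell_mass t.

Lemma avg_cost_le x t (w : R) : 0 <= w ->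
  (forall y, label_of y = t -> d x y `^ p <= w) -> avg_cost x t <= w.
Proof.
move=> w0 cost_le; rewrite /avg_cost.
have [->|t_neq0] := eqVneq (cell_mass t) 0; first by rewrite invr0 mulr0.
have mt := measurable_label_of t.
have t0 : 0 < cell_mass t by rewrite lt_neqAle eq_sym t_neq0 cell_mass_ge0.
rewrite ler_pdivrMr // -lee_fin fineK; last exact: integral_dist_fin.
rewrite EFinM -cell_massE -integral_cst //; apply: ge0_le_integral => //.
- by move=> y _; exact: cost_ge0.
- by apply: measurable_funTS; exact: measurable_cost.
Qed.

Definition cell_weight (l : nat) (F : label) : R :=
  if F is Some (k, _) then
    if l is l'.+1 then (if (k < K)%N then dyadic (8 * radius k) l' `^ p else 0)
    else (2 * radius k) `^ p
  else 0.

Definition leaf_weight (F : label) : R :=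
  if F is Some (k, _) then
    (if (k < K)%N then dyadic (8 * radius k) L else 2 * radius K) `^ p
  else 0.

Definition outer_cost : R :=
  2 `^ p * fine (\int[mu]_(y in label_of @^-1` [set None]) (d x0 y `^ p)%:E)%E.

Lemma cell_weight_ge0 l F : 0 <= cell_weight l F.
Proof.
rewrite /cell_weight; case: F => [[k j]|] //; case: l => [|l]; first exact: powR_ge0.
by case: ifP => // _; exact: powR_ge0.
Qed.

Lemma leaf_weight_ge0 F : 0 <= leaf_weight F.
Proof. by rewrite /leaf_weight; case: F => [[k j]|] //; rewrite powR_ge0. Qed.

Lemma outer_cost_ge0 : 0 <= outer_cost.
Proof.
by rewrite mulr_ge0 ?powR_ge0 // fine_ge0 // integral_ge0 // => y _; exact: cost_ge0.
Qed.

(* The root cell of the outer points carries their average cost from [x0]. *)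
Definition transport_weight (l : nat) (F : label) : R :=
  if (l == 0)%N && (F == None) then outer_cost / cell_mass None else cell_weight l F.

Lemma transport_weight_ge0 l F : 0 <= transport_weight l F.
Proof.
rewrite /transport_weight; case: ifP => _; last exact: cell_weight_ge0.
by rewrite divr_ge0 ?outer_cost_ge0 ?cell_mass_ge0.
Qed.

Lemma avg_cost_leaf x t : inside x -> cell L (label_of x) = cell L t ->
  avg_cost x t <= leaf_weight t.
Proof.
move=> xin same; apply: avg_cost_le; first exact: leaf_weight_ge0.
move=> y yt; rewrite -yt in same *; have yin := cell_inside xin same.
have sE := cell_same_shell xin yin same.
rewrite label_of_inside //= shellK ler_powRl ?(polish_ge0 polish_d) // -sE.
case: ifPn => sK; first exact: cell_diam.
by rewrite -(shell_inner sK); exact: shell_diam.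
Qed.

Lemma avg_cost_split l x t : (l < L)%N -> inside x -> cell l (label_of x) = cell l t ->
  cell l.+1 (label_of x) != cell l.+1 t ->
  avg_cost x t <= transport_weight l.+1 (cell l.+1 (label_of x)).
Proof.
move=> lL xin same diff; apply: avg_cost_le; first exact: transport_weight_ge0.
move=> y yt; rewrite -yt in same diff *; have yin := cell_inside xin same.
have sE := cell_same_shell xin yin same.
have : omap fst (cell l.+1 (label_of x)) = Some (inord (shell x)).
  by rewrite cell_shell label_of_inside.
rewrite /transport_weight /=; case: (cell l.+1 _) => [[k j]|] //= [->]; rewrite shellK.
case: ifPn => sK.
  by rewrite ler_powRl ?(polish_ge0 polish_d) //; apply: cell_diam => //; exact: ltnW.
have yK := shell_inner sK; rewrite sE in yK.
by move: diff; rewrite (label_of_inner yin yK) (label_of_inner xin) ?eqxx // sE.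
Qed.

Lemma cell_weight0 y : inside y ->
  cell_weight 0 (cell 0 (label_of y)) = (2 * radius (shell y)) `^ p.
Proof. by move=> yin; rewrite label_of_inside // cell0 /= shellK. Qed.

Lemma le_cell_weight0 y : inside y -> (2 * d x0 y) `^ p <= cell_weight 0 (cell 0 (label_of y)).
Proof.
move=> yin; rewrite cell_weight0 // ler_powRl ?mulr_ge0 ?(polish_ge0 polish_d) //.
by rewrite ler_wpM2l // (insideP yin).2.
Qed.

Lemma avg_cost_outside x : inside x ->
  avg_cost x None <= cell_weight 0 (cell 0 (label_of x)) + outer_cost / cell_mass None.
Proof.
move=> xin; have w0 := cell_weight_ge0 0 (cell 0 (label_of x)).
rewrite /avg_cost; have [->|N_neq0] := eqVneq (cell_mass None) 0.
  by rewrite !invr0 !mulr0 addr0.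
have N0 : 0 < cell_mass None by rewrite lt_neqAle eq_sym N_neq0 cell_mass_ge0.
rewrite ler_pdivrMr // mulrDl divfK // -lee_fin fineK; last first.
  by apply: integral_dist_fin; exact: measurable_label_of.
have mN := measurable_label_of None.
have mc z : measurable_fun (label_of @^-1` [set None]) (fun y => (d z y `^ p)%:E).
  by apply: measurable_funTS; exact: measurable_cost.
rewrite EFinD EFinM -cell_massE -integral_cst // /outer_cost EFinM fineK; last first.
  exact: integral_dist_fin.
rewrite -ge0_integralZl_EFin ?powR_ge0 //; last by move=> y _; exact: cost_ge0.
rewrite -ge0_integralD //; last 2 first.
- by move=> y _; rewrite mule_ge0 ?cost_ge0 ?lee_fin ?powR_ge0.
- exact: measurable_funeM.
apply: ge0_le_integral => //.
- by move=> y _; exact: cost_ge0.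
- by apply: emeasurable_funD => //; exact: measurable_funeM.
move=> y _; rewrite -EFinM -EFinD lee_fin -powRM ?(polish_ge0 polish_d) //.
by apply: le_trans (dist_powR_le x y) _; rewrite lerD2r le_cell_weight0.
Qed.

Lemma avg_cost_root x t : inside x -> avg_cost x t <=
  transport_weight 0 (cell 0 (label_of x)) + transport_weight 0 (cell 0 t).
Proof.
move=> xin; rewrite {1}/transport_weight cell_eq_None label_of_None xin /=.
case: t => [[k j]|]; last first.
  by rewrite cell_None; exact: avg_cost_outside.
have -> : transport_weight 0 (cell 0 (Some (k, j))) = cell_weight 0 (cell 0 (Some (k, j))).
  by rewrite /transport_weight cell_eq_None.
apply: avg_cost_le; first by rewrite addr_ge0 ?cell_weight_ge0.
move=> y yt; have yin : inside y by apply: contraT; rewrite -label_of_None yt.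
rewrite -yt; apply: le_trans (dist_powR_le x y) _.
by rewrite lerD // le_cell_weight0.
Qed.

Definition discrepancy (n : nat) (xs : 'I_n -> E) : R :=
  \sum_(0 <= l < L.+1) \sum_F cell_weight l F *
    `|fiber_sum (fun i => cell l (label_of (xs i))) (fun=> n%:R^-1) F
      - fiber_sum (cell l) cell_mass F|.

Lemma transport_discrepancy_le n (xs : 'I_n -> E) : (forall i, inside (xs i)) ->
  \sum_(0 <= l < L.+1) level_cost (fun=> n%:R^-1) cell_mass
    (fun l i => cell l (label_of (xs i))) cell transport_weight l <=
  discrepancy xs + outer_cost.
Proof.
move=> xin; rewrite /discrepancy !(@big_ltn _ _ _ 0 L.+1) // addrAC.
apply: lerD; last by rewrite le_eqVlt; apply/orP; left; apply/eqP/eq_big_nat => -[|l].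
rewrite /level_cost (bigD1 None) //= addrC [X in _ <= X + _](bigD1 None) //= mul0r add0r.
apply: lerD; first by apply: ler_sum => F FN; rewrite /transport_weight /= (negbTE FN).
rewrite /transport_weight /= {1}/fiber_sum big1 => [|i]; last first.
  by rewrite cell_eq_None label_of_None xin.
rewrite sub0r normrN /fiber_sum (big_pred1 None) => [|t]; last by rewrite /= cell_eq_None.
rewrite ger0_norm ?cell_mass_ge0 //; have [->|N0] := eqVneq (cell_mass None) 0.
  by rewrite mulr0 outer_cost_ge0.
by rewrite divfK.
Qed.

Lemma Wpp_le_discrepancy n (xs : 'I_n -> E) : (0 < n)%N -> (forall i, inside (xs i)) ->
  (Wpp d p (empirical xs) mu <=
   (\sum_t cell_mass t * leaf_weight t + discrepancy xs + outer_cost)%:E)%E.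
Proof.
move=> n0 xin; have n_inv0 (i : 'I_n) : 0 <= n%:R^-1 :> R by rewrite invr_ge0.
have same_mass : \sum_(i < n) n%:R^-1 = \sum_t cell_mass t.
  by rewrite cell_mass_sum1 sumr_const card_ord -[_ *+ n]mulr_natl divff // pnatr_eq0 -lt0n.
have [q q_plan q_cost] := nested_transport (L := L) (T := label)
  (phi := fun l i => cell l (label_of (xs i))) (psi := cell) (parent := parent)
  (c := fun i => avg_cost (xs i)) n_inv0 cell_mass_ge0 same_mass
  (fun l i lL => cellS _ lL) (fun l t lL => cellS _ lL) transport_weight_ge0 leaf_weight_ge0
  (fun i t => avg_cost_leaf (xin i)) (fun l i t lL => avg_cost_split lL (xin i))
  (fun i t _ => avg_cost_root t (xin i)).
apply: le_trans (Wpp_le_cells polish_d p xs measurable_label_of q_plan) _.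
rewrite (eq_bigr (fun i => (\sum_t q i t * avg_cost (xs i) t)%:E)); last first.
  move=> i _; rewrite -sumEFin; apply: eq_bigr => t _; rewrite /avg_cost -/(cell_mass t).
  rewrite -[X in (_ * X)%E]fineK; last exact: integral_dist_fin (measurable_label_of t).
  by rewrite -EFinM; congr (_%:E); ring.
rewrite sumEFin lee_fin; apply: le_trans q_cost _.
by rewrite -addrA lerD2l transport_discrepancy_le.
Qed.

Lemma leaf_cost_le_mesh :
  \sum_t cell_mass t * leaf_weight t <= dyadic (8 * rho) L `^ p + (2 * radius K) `^ p.
Proof.
rewrite -[leRHS]mul1r -[X in X * _]cell_mass_sum1 mulr_suml; apply: ler_sum => t _.
rewrite ler_wpM2l ?cell_mass_ge0 // /leaf_weight; case: t => [[k j]|]; last first.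
  by rewrite addr_ge0 ?powR_ge0.
case: ifP => kK; last by rewrite lerDr powR_ge0.
rewrite ler_wpDr ?powR_ge0 // ler_powRl ?(ltW (dyadic_gt0 _ _)) ?mulr_gt0 ?dyadic_gt0 //.
by rewrite ler_wpM2r ?invr_ge0 ?exprn_ge0 // ler_wpM2l // dyadic_le // ltW.
Qed.

Lemma leaf_cost_le_moment :
  \sum_t cell_mass t * leaf_weight t <=
  16 `^ p * fine (pmoment d x0 mu p) + (2 * radius K) `^ p.
Proof.
have mc : measurable_fun setT (fun y => (d x0 y `^ p)%:E) by exact: measurable_cost.
have pmE : pmoment d x0 mu p = (fine (pmoment d x0 mu p))%:E.
  by rewrite fineK //; exact: integral_dist_fin.
rewrite -lee_fin -integral_label; last exact: leaf_weight_ge0.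
rewrite EFinD EFinM -pmE /pmoment -ge0_integralZl_EFin ?powR_ge0 //; last first.
  by move=> y _; exact: cost_ge0.
rewrite -[X in (_ <= _ + X)%E]mule1 -(probability_setT mu) -integral_cst //.
rewrite -ge0_integralD //; last 3 first.
- by move=> y _; rewrite mule_ge0 ?cost_ge0 ?lee_fin ?powR_ge0.
- exact: measurable_funeM.
- by move=> y _; rewrite lee_fin powR_ge0.
apply: ge0_le_integral => //.
- by move=> y _; rewrite lee_fin leaf_weight_ge0.
- exact: measurable_label_fun.
- by apply: emeasurable_funD => //; exact: measurable_funeM.
move=> y _; rewrite -EFinM -EFinD lee_fin -powRM ?(polish_ge0 polish_d) //.
rewrite /leaf_weight; case yE : (label_of y) => [[k j]|]; last by rewrite addr_ge0 ?powR_ge0.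
have [_ sy] := label_of_Some yE; case: ifP => kK; last by rewrite ler_wpDl ?powR_ge0.
have r0 : 0 <= 8 * radius k by rewrite mulr_ge0 // ltW // dyadic_gt0.
rewrite ler_wpDr ?powR_ge0 // ler_powRl ?divr_ge0 ?exprn_ge0 //.
apply: le_trans (dyadic_le _ r0) _; have := @shell_gt y; rewrite sy => /(_ kK).
by rewrite (dyadicS rho k); lra.
Qed.

Lemma outer_cost_le s : p < s -> (weak_moment d x0 mu s < +oo)%E -> mu S = 1%E ->
  outer_cost <= 2 `^ p * (outer_moment_cst p s * fine (weak_moment d x0 mu s) * rho `^ (p - s)).
Proof.
move=> ps wf S1; rewrite ler_wpM2l ?powR_ge0 //.
have mN := measurable_label_of None; have mSC : measurable (~` S) by exact: measurableC.
have SC0 : mu (~` S) = 0%E by rewrite probability_setC // S1 subee.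
rewrite -lee_fin fineK; last exact: integral_dist_fin.
rewrite (ge0_negligible_integral mSC mN _ _ SC0) //; last 2 first.
- by apply: measurable_funTS; exact: measurable_cost.
- by move=> y _; exact: cost_ge0.
apply: integral_outside_le => //; first exact: measurableD.
move=> y [/= /eqP]; rewrite label_of_None => /asboolPn out /contrapT Sy.
by rewrite ltNge; apply/negP => yr; apply: out.
Qed.

End Costs.

(** * The walk of the cell counts *)

Definition node : finType := ('I_L.+1 * label)%type.

Definition node_mass (F : node) : R := fiber_sum (cell F.1) cell_mass F.2.

Definition node_step (t : label) : l1 R node :=
  [ffun F : node => cell_weight F.1 F.2 * ((cell F.1 t == F.2)%:R - node_mass F)].

Definition node_spread : R := \sum_(F : node) cell_weight F.1 F.2 * Num.sqrt (node_mass F).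

Lemma node_mass_ge0 F : 0 <= node_mass F.
Proof. by apply: fiber_sum_ge0; exact: cell_mass_ge0. Qed.

Lemma node_massE F : node_mass F = \sum_t cell_mass t * (cell F.1 t == F.2)%:R.
Proof.
rewrite /node_mass /fiber_sum big_mkcond /=; apply: eq_bigr => t _.
by rewrite mulr_natr mulrb.
Qed.

Lemma node_mass_le1 F : node_mass F <= 1.
Proof.
rewrite node_massE -[leRHS]cell_mass_sum1; apply: ler_sum => t _.
by rewrite ler_piMr ?cell_mass_ge0 // lern1 leq_b1.
Qed.

Lemma node_spread_ge0 : 0 <= node_spread.
Proof. by apply: sumr_ge0 => F _; rewrite mulr_ge0 ?cell_weight_ge0 ?sqrtr_ge0. Qed.

Lemma node_step_mean0 F : \sum_t cell_mass t * node_step t F = 0.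
Proof.
under eq_bigr do rewrite ffunE mulrCA mulrBr.
by rewrite -mulr_sumr sumrB -node_massE -mulr_suml cell_mass_sum1 mul1r subrr mulr0.
Qed.

Lemma node_step_var_le F :
  step_var cell_mass node_step F <= cell_weight F.1 F.2 ^+ 2 * node_mass F.
Proof.
rewrite /step_var (eq_bigr (fun t => cell_weight F.1 F.2 ^+ 2 *
  (cell_mass t * (cell F.1 t == F.2)%:R * (1 - 2 * node_mass F) + cell_mass t * node_mass F ^+ 2))).
  rewrite -mulr_sumr big_split /= -!mulr_suml -node_massE cell_mass_sum1 mul1r.
  by rewrite ler_wpM2l ?sqr_ge0 //; have := node_mass_ge0 F; nra.
by move=> t _; rewrite ffunE; case: eqP => _ /=; ring.
Qed.

Lemma spread_le_node : spread cell_mass node_step <= node_spread.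
Proof.
apply: ler_sum => F _; apply: le_trans (ler_wsqrtr (node_step_var_le F)) _.
by rewrite sqrtrM ?sqr_ge0 // sqrtr_sqr ger0_norm ?cell_weight_ge0.
Qed.

Lemma sum_node (G : node -> R) : \sum_F G F = \sum_(l < L.+1) \sum_(F : label) G (l, F).
Proof. by rewrite pair_bigA; apply: eq_bigr => -[]. Qed.

Lemma sum_label (G : label -> R) : \sum_F G F = G None + \sum_k \sum_j G (Some (k, j)).
Proof. by rewrite sum_option pair_bigA; congr (_ + _); apply: eq_bigr => -[]. Qed.

Lemma norm_walk_discrepancy n (xs : 'I_n -> E) : (0 < n)%N ->
  `|\sum_(t <- [seq label_of (xs i) | i <- enum 'I_n]) node_step t| = n%:R * discrepancy xs.
Proof.
move=> n0; have n_neq0 : n%:R != 0 :> R by rewrite pnatr_eq0 -lt0n.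
rewrite l1_normE /discrepancy big_mkord mulr_sumr sum_node; apply: eq_bigr => l _.
rewrite mulr_sumr; apply: eq_bigr => F _; rewrite sum_ffunE big_map big_enum /=.
under eq_bigr do rewrite ffunE /=.
rewrite -mulr_sumr normrM ger0_norm ?cell_weight_ge0 // mulrCA; congr (_ * _).
rewrite -[X in X * _]ger0_norm // -normrM; congr `|_|.
rewrite sumrB sumr_const card_ord -[_ *+ n]mulr_natl mulrBr; congr (_ - _).
rewrite /fiber_sum mulr_sumr [LHS]big_mkcond [RHS]big_mkcond /=.
by apply: eq_bigr => i _; rewrite ?inE divff //; case: eqP.
Qed.

Lemma deviation_le_walk {dO : measure_display} {O : measurableType dO}
    (P : probability O R) (n : nat) (X : 'I_n -> O -> E) (x y : R) :
  (pmoment d x0 mu p < +oo)%E -> iid P mu X -> (0 < n)%N ->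
  \sum_t cell_mass t * leaf_weight t + outer_cost + y <= x ->
  (P [set w | x%:E < Wpp d p (empirical (fun i => X i w)) mu] <=
   (n%:R * cell_mass None + end_prob cell_mass node_step n (n%:R * y) 0)%:E)%E.
Proof.
move=> moment_fin iidX n0 xy; have [mX _ _] := iidX.
pose bad (s : seq label) := has (pred1 None) s || (n%:R * y < `|0 + \sum_(t <- s) node_step t|).
have p_gt0 : 0 < p by exact: lt_le_trans p_ge1.
apply: (@le_trans _ _ (P [set w | bad [seq label_of (X i w) | i <- enum 'I_n]])).
  apply: le_measure; rewrite ?inE.
  - exact: (measurable_Wpp_empirical_gt polish_d _ p_gt0 n0).
  - exact: (measurable_iid_labels bad iidX measurable_label_of).
  move=> w /= xW; rewrite /bad; have [//|/hasPn all_in /=] := boolP (has _ _).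
  have xin i : inside (X i w).
    apply: contraT; rewrite -label_of_None => iN.
    have /all_in : label_of (X i w) \in [seq label_of (X i w) | i <- enum 'I_n].
      by apply: map_f; rewrite mem_enum.
    by rewrite /= iN.
  rewrite add0r norm_walk_discrepancy // ltr_pM2l ?ltr0n //.
  have := lt_le_trans xW (Wpp_le_discrepancy moment_fin n0 xin); rewrite lte_fin.
  lra.
rewrite (iid_labels bad iidX measurable_label_of) lee_fin.
apply: le_trans (tuple_prob_or cell_mass_ge0 _ _ _) _; apply: lerD.
  exact: tuple_prob_has cell_mass_ge0 cell_mass_sum1 _ _.
by rewrite end_prob_tuple.
Qed.

(** * Spread and jumps of the walk *)

Lemma sum_node_mass (l : 'I_L.+1) (k : 'I_K.+1) :
  \sum_j node_mass (l, Some (k, j)) = shell_mass k.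
Proof.
rewrite /shell_mass /fiber_sum.
rewrite (fiber_sum_coarsen (f := cell l) (h := omap fst)); last by move=> t; rewrite cell_shell.
rewrite [RHS]big_mkcond sum_label /= add0r [RHS](bigD1 k) //= [X in _ + X]big1 ?addr0.
  by apply: eq_bigr => j _; rewrite eqxx.
move=> k' k'k; rewrite big1 // => j _; case: eqP => // -[e]; by rewrite e eqxx in k'k.
Qed.

Lemma root_mass (k : 'I_K.+1) (j : 'I_N.+1) :
  node_mass (ord0, Some (k, j)) = (j == ord0)%:R * shell_mass k.
Proof.
have out i : i != ord0 -> node_mass (ord0, Some (k, i)) = 0.
  move=> i0; rewrite /node_mass /fiber_sum big1 // => -[[k' j']|] /=; last by rewrite cell_None.
  rewrite cell0 => /eqP[_ e].
  by rewrite -e eqxx in i0.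
have [->|j0] := eqVneq j ord0; last by rewrite out // mul0r.
by rewrite mul1r -(sum_node_mass ord0) (bigD1 ord0) //= big1 ?addr0 // => i /out.
Qed.

Lemma node_mass_out (l : 'I_L.+1) (k : 'I_K.+1) (j : 'I_N.+1) : (0 < l)%N -> (k < K)%N ->
  (size (ctr k l) <= j)%N -> node_mass (l, Some (k, j)) = 0.
Proof.
move=> l0 kK sj; rewrite /node_mass /fiber_sum sum_cell_mass /=.
rewrite (_ : [set y | _] = set0) ?measure0 //; apply/seteqP; split => // y /= /eqP e.
have := cell_shell l (label_of y); rewrite e; case yE : (label_of y) => [[k' j']|] //= [kk'].
have [yin sy] := label_of_Some yE; rewrite -kk' in sy.
have lL : (l <= L)%N by rewrite -ltnS.
have sK : (shell y < K)%N by rewrite sy.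
have [i iE [i_s _]] := cell_centre l0 lL yin sK.
move: e; rewrite iE => -[_ ij]; move: sj; rewrite -ij inordK; last first.
  by rewrite ltnS (leq_trans (ltnW i_s)) // ctr_size.
by rewrite -sy leqNgt i_s.
Qed.

Lemma sum_sqrt_node_mass (l : 'I_L.+1) (k : 'I_K.+1) : (0 < l)%N -> (k < K)%N ->
  \sum_j Num.sqrt (node_mass (l, Some (k, j))) <=
  Num.sqrt (size (ctr k l))%:R * Num.sqrt (shell_mass k).
Proof.
move=> l0 kK; set m := size _.
have mN : (m <= N.+1)%N by apply/leqW/ctr_size => //; rewrite -ltnS.
rewrite (bigID (fun j : 'I_N.+1 => (j < m)%N)) /= [X in _ + X]big1 ?addr0; last first.
  by move=> j; rewrite -leqNgt => /(node_mass_out l0 kK) ->; rewrite sqrtr0.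
apply: le_trans (sum_sqrt_le [pred j : 'I_N.+1 | (j < m)%N] (fun j => node_mass_ge0 _)) _.
apply: ler_pM; rewrite ?sqrtr_ge0 // ler_wsqrtr //.
  rewrite ler_nat -sum1_card (eq_bigl (fun j : 'I_N.+1 => (j < m)%N)) //.
  by rewrite -(big_ord_widen N.+1 (fun=> 1%N) mN) sum1_card card_ord.
rewrite -(sum_node_mass l k) [leRHS](bigID (fun j : 'I_N.+1 => (j < m)%N)) /= lerDl.
by apply: sumr_ge0 => j _; exact: node_mass_ge0.
Qed.

Definition shell_sum : R := \sum_(k < K.+1 | (k < K)%N) radius k `^ p * Num.sqrt (shell_mass k).

Lemma shell_sum_ge0 : 0 <= shell_sum.
Proof. by apply: sumr_ge0 => k _; rewrite mulr_ge0 ?powR_ge0 ?sqrtr_ge0. Qed.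

Lemma shell_sum_le : shell_sum <= dyadic_sum d x0 mu p rho K.
Proof.
rewrite /dyadic_sum [leRHS](big_ord_widen K.+1 (fun k => radius k `^ p *
    Num.sqrt (tailH d x0 mu (radius k.+1)))) //.
by apply: ler_sum => k kK; rewrite ler_wpM2l ?powR_ge0 // ler_wsqrtr // shell_mass_le.
Qed.

Definition level_spread (l : 'I_L.+1) : R :=
  \sum_(F : label) cell_weight l F * Num.sqrt (node_mass (l, F)).

Lemma level_spread0_le : level_spread ord0 <= 2 `^ p * shell_sum + (2 * radius K) `^ p.
Proof.
rewrite /level_spread sum_label /= mul0r add0r.
have rootE (k : 'I_K.+1) :
    \sum_(j < N.+1) (2 * radius k) `^ p * Num.sqrt (node_mass (ord0, Some (k, j))) =
    (2 * radius k) `^ p * Num.sqrt (shell_mass k).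
  rewrite (bigD1 ord0) //= big1 => [|j /negbTE j0]; rewrite root_mass ?j0 ?mul0r ?sqrtr0 ?mulr0 //.
  by rewrite mul1r addr0.
under eq_bigr do rewrite rootE.
rewrite (bigID (fun k : 'I_K.+1 => (k < K)%N)) /=; apply: lerD.
  rewrite mulr_sumr; apply: ler_sum => k _.
  by rewrite powRM ?mulrA // ltW // dyadic_gt0.
rewrite (big_pred1 ord_max) /= => [|k]; last first.
  by rewrite /= -leqNgt -val_eqE /= eqn_leq (leq_ord k).
by rewrite ler_piMr ?powR_ge0 // -sqrtr1 ler_wsqrtr // shell_mass_le1.
Qed.

Section ChainBound.
Variables (alpha B : R).
Hypotheses (alpha_lt : alpha < 2 * p) (B_ge0 : 0 <= B).
Hypothesis ctr_size_le : forall k l, (k < K)%N -> (l <= L)%N ->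
  (size (ctr k l))%:R <= B * (2 ^+ l) `^ alpha.

Let z : R := 2 `^ (alpha / 2 - p).

Lemma chain_ratio_lt1 : z < 1.
Proof. by rewrite powR_lt1 ?ltr1n // subr_lt0 ltr_pdivrMr // mulrC. Qed.

Lemma level_spreadS_le (l : 'I_L) :
  level_spread (lift ord0 l) <= 16 `^ p * Num.sqrt B * shell_sum * z ^+ l.
Proof.
rewrite /level_spread sum_label /= mul0r add0r -mulrA [_ * z ^+ l]mulrC mulrA mulr_sumr.
rewrite (bigID (fun k : 'I_K.+1 => (k < K)%N)) /= [X in _ + X]big1 ?addr0; last first.
  by move=> k /negbTE ->; rewrite big1 // => j _; rewrite mul0r.
apply: ler_sum => k kK; rewrite kK -mulr_sumr.
have rk := ltW (dyadic_gt0 k rho_gt0); have two l' : 0 < 2 ^+ l' :> R by rewrite exprn_gt0.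
apply: (@le_trans _ _ (dyadic (8 * radius k) l `^ p *
    (Num.sqrt (B * (2 ^+ l.+1) `^ alpha) * Num.sqrt (shell_mass k)))).
  rewrite ler_wpM2l ?powR_ge0 //; apply: le_trans (sum_sqrt_node_mass _ kK) _ => //.
  by rewrite ler_wpM2r ?sqrtr_ge0 // ler_wsqrtr // ctr_size_le // ltn_ord.
rewrite sqrtrM // sqrt_powR.
have -> : dyadic (8 * radius k) l = dyadic (16 * radius k) l.+1.
  by rewrite (dyadicS (8 * radius k)) /dyadic; ring.
have -> : dyadic (16 * radius k) l.+1 `^ p = 16 `^ p * radius k `^ p * (2 `^ (- p)) ^+ l.+1.
  by rewrite (powR_dyadic p l.+1 (mulr_ge0 (ler0n R 16) rk)) powRM.
rewrite powR_exprn //.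
rewrite [leLHS](_ : _ = 16 `^ p * Num.sqrt B * (radius k `^ p * Num.sqrt (shell_mass k)) *
    (2 `^ (alpha / 2) * 2 `^ (- p)) ^+ l.+1); last by rewrite exprMn; ring.
rewrite -gt0_powRD // -/z [leRHS]mulrAC ler_wpM2l //.
  by rewrite !mulr_ge0 ?powR_ge0 ?sqrtr_ge0.
by rewrite exprS ler_piMl ?exprn_ge0 ?powR_ge0 // (ltW chain_ratio_lt1).
Qed.

Definition chain_cst (refined : bool) : R :=
  2 `^ p + (if refined then 16 `^ p * Num.sqrt B / `|1 - z| else 0).

Lemma node_spread_le :
  node_spread <= chain_cst (0 < L)%N * shell_sum + (2 * radius K) `^ p.
Proof.
rewrite /node_spread sum_node big_ord_recl -/(level_spread ord0) /chain_cst mulrDl addrAC.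
apply: lerD; first exact: level_spread0_le.
have [L0|L0] := posnP L.
  by rewrite mul0r big1 // => l _; have := ltn_ord l; rewrite {2}L0.
rewrite ger0_norm ?subr_ge0 ?(ltW chain_ratio_lt1) // mulrAC.
have A0 : 0 <= 16 `^ p * Num.sqrt B * shell_sum.
  by rewrite !mulr_ge0 ?powR_ge0 ?sqrtr_ge0 ?shell_sum_ge0.
have z0 : 0 < z by exact: powR_gt0.
apply: le_trans (ler_sum _ (fun l _ => level_spreadS_le l)) _.
by apply: (ler_sum_geometric L A0 z0 chain_ratio_lt1 (f := fun l => _ * z ^+ l)) => l.
Qed.

End ChainBound.

Lemma sum_cell_weight_le (k : 'I_K.+1) j :
  \sum_(l < L.+1) cell_weight l (Some (k, j)) <=
  (if (k < K)%N then 3 * 8 `^ p * radius k `^ p else (2 * radius K) `^ p).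
Proof.
rewrite big_ord_recl /=; under eq_bigr do rewrite add0n; case: ifPn => kK; last first.
  have -> : nat_of_ord k = K by apply/eqP; rewrite eqn_leq -ltnS ltn_ord leqNgt.
  by rewrite big1 ?addr0.
have rk := ltW (dyadic_gt0 k rho_gt0).
have half : 2 `^ (- p) <= 2^-1 :> R.
  by rewrite powRN lef_pV2 ?posrE ?powR_gt0 // le1r_powR // ler1n.
have sum_le : \sum_(l < L) dyadic (8 * radius k) l `^ p <=
    (8 * radius k) `^ p / (1 - 2 `^ (- p)).
  apply: (@ler_sum_geometric _ (fun l => dyadic (8 * radius k) l `^ p)).
  - exact: powR_ge0.
  - exact: powR_gt0.
  - by apply: le_lt_trans half _; lra.
  - by move=> l; rewrite powR_dyadic // mulr_ge0.
have inv_le : (1 - 2 `^ (- p))^-1 <= 2.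
  by rewrite -[leRHS]invrK lef_pV2 ?posrE ?invr_gt0 //; lra.
have root_le : (2 * radius k) `^ p <= 8 `^ p * radius k `^ p.
  by rewrite -powRM //; apply: ler_powRl => //; lra.
rewrite powRM // in sum_le.
have := ler_wpM2l (mulr_ge0 (powR_ge0 8 p) (powR_ge0 (radius k) p)) inv_le.
by move: sum_le root_le; lra.
Qed.

Lemma cell_weight_cell l t : cell_weight l (cell l t) = cell_weight l t.
Proof.
have := cell_shell l t; case: (cell l t) => [[k j]|]; case: t => [[k' j']|] //= [->].
by [].
Qed.

Lemma norm_node_step_le t : `|node_step t| <=
  (if t is Some (k, _) then
     if (k < K)%N then 3 * 8 `^ p * radius k `^ p else (2 * radius K) `^ p
   else 0) + node_spread.
Proof.
rewrite l1_normE; apply: (@le_trans _ _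
    (\sum_(F : node) cell_weight F.1 F.2 * ((cell F.1 t == F.2)%:R + node_mass F))).
  apply: ler_sum => F _; rewrite ffunE normrM ger0_norm ?cell_weight_ge0 //.
  rewrite ler_wpM2l ?cell_weight_ge0 //; apply: le_trans (ler_normB _ _) _.
  by rewrite !ger0_norm ?node_mass_ge0.
under eq_bigr do rewrite mulrDr.
rewrite big_split /=; apply: lerD; last first.
  apply: ler_sum => F _; rewrite ler_wpM2l ?cell_weight_ge0 //.
  have m0 := node_mass_ge0 F; rewrite -{1}(sqr_sqrtr m0) expr2 ler_piMl ?sqrtr_ge0 //.
  by rewrite -sqrtr1 ler_wsqrtr // node_mass_le1.
rewrite sum_node /= (eq_bigr (fun l : 'I_L.+1 => cell_weight l t)).
  by case: t => [[k j]|]; [exact: sum_cell_weight_le|rewrite big1].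
move=> l _; rewrite (bigD1 (cell l t)) //= eqxx mulr1 big1 ?addr0 ?cell_weight_cell // => F.
by rewrite eq_sym => /negbTE ->; rewrite mulr0.
Qed.

(* A jump larger than twice the spread comes from a label in a shell of radius
   comparable to the jump. *)
Lemma jump_prob_le_tail u v : 0 <= v -> 2 * node_spread <= u -> 2 * (2 * radius K) `^ p <= u ->
  6 * 16 `^ p * v `^ p <= u ->
  jump_prob cell_mass node_step u <= tailH d x0 mu v.
Proof.
move=> v0 u_spread u_inner u_v; rewrite /jump_prob sum_cell_mass; apply: le_tailH => //.
  exact: (measurable_label_pred (fun t => u < `|node_step t|)).
move=> y /= uy; have := lt_le_trans uy (norm_node_step_le (label_of y)).
have := node_spread_ge0; case yE : (label_of y) => [[k j]|]; last by lra.
case: ifPn => kK; last by lra.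
move=> _ u_lt; have [_ sy] := label_of_Some yE; have := @shell_gt y; rewrite sy => /(_ kK).
apply: le_lt_trans; rewrite leNgt; apply/negP => rv.
have : radius k `^ p <= 2 `^ p * v `^ p.
  by rewrite -powRM // ler_powRl ?(ltW (dyadic_gt0 _ _)) // dyadicS; lra.
move=> /(ler_wpM2l (mulr_ge0 (ler0n R 3) (powR_ge0 8 p))).
have -> : 3 * 8 `^ p * (2 `^ p * v `^ p) = 3 * 16 `^ p * v `^ p.
  by rewrite mulrA -[3 * _ * _]mulrA -powRM // -natrM.
lra.
Qed.

End Masses.
End Cells.

(** * Deviation bounds *)

Record centred_walk (R : realType) := CentredWalk {
  labels : finType;
  coordinates : finType;
  law : labels -> R;
  step : labels -> l1 R coordinates;
  law_ge0 : forall t, 0 <= law t;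
  law_sum1 : \sum_t law t = 1;
  step_mean0 : forall F, \sum_t law t * step t F = 0 }.

Arguments law {R} c t.
Arguments step {R} c t.
Arguments law_ge0 {R} c t.
Arguments step_mean0 {R} c F.

Section Constants.
Context {R : realType}.
Implicit Types (p q r s alpha beta : R) (refined : bool).

(* If [refined] is [false] the shells are not cut into smaller cells, and the constant does
   not involve the covering numbers. *)
Definition spread_cst p alpha beta refined : R :=
  4 `^ p * chain_cst p alpha (beta + 1) refined.

Lemma chain_cst_ge p alpha B refined : 2 `^ p <= chain_cst p alpha B refined.
Proof. by rewrite lerDl; case: refined. Qed.

Lemma chain_cst_gt0 p alpha B refined : 0 < chain_cst p alpha B refined.
Proof. by apply: lt_le_trans (chain_cst_ge _ _ _ _); rewrite powR_gt0. Qed.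

Lemma spread_cst_gt0 p alpha beta refined : 0 < spread_cst p alpha beta refined.
Proof. by rewrite mulr_gt0 ?powR_gt0 ?chain_cst_gt0. Qed.

Lemma spread_cst_ge1 p alpha beta refined : 0 <= p -> 1 <= spread_cst p alpha beta refined.
Proof.
move=> p0; rewrite mulr_ege1 ?powR_ge1 ?ler1n //.
by apply: le_trans (chain_cst_ge _ _ _ _); rewrite powR_ge1 ?ler1n.
Qed.

Lemma spread_cst_unrefined p alpha beta : spread_cst p alpha beta false = 8 `^ p.
Proof. by rewrite /spread_cst /chain_cst addr0 -powRM // -natrM. Qed.

(* The Hoffmann-Jorgensen inequality is iterated until the exponent [2 ^ hj_order q] of the
   quadratic bound exceeds [q]. *)
Definition hj_order q : nat := Num.bound q.

Definition moderate_cst p q r : R :=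
  hj_cst (hj_order q) *
  ((32 * 16 ^+ hj_order q) `^ q + (12 * 4 ^+ hj_order q * 16 `^ p) `^ r).

Lemma moderate_cst_ge0 p q r : 0 <= moderate_cst p q r.
Proof.
apply: mulr_ge0; last by rewrite addr_ge0 ?powR_ge0.
exact: le_trans ler01 (hj_cst_ge1 _).
Qed.

Definition second_moment_cst p alpha beta : R := 4 * spread_cst p alpha beta true ^+ 2.

Definition truncation_cst p s : R := 2 `^ p * outer_moment_cst p s.

Definition heavy_tail_cst p alpha beta r : R :=
  1 + 4 * `|truncation_cst p (r * p)| +
  4 * (chain_cst p alpha (beta + 1) true * weak_dyadic_cst p (r * p)) ^+ 2.

Definition exponential_cst p alpha beta : R := 2 / spread_cst p alpha beta true ^+ 4.

Definition polynomial_cst p q r : R := moderate_cst p q r + ((8 `^ p) ^+ 2) `^ q.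

Lemma second_moment_cst_gt0 p alpha beta : 0 < second_moment_cst p alpha beta.
Proof. by rewrite mulr_gt0 // exprn_gt0 // spread_cst_gt0. Qed.

Lemma heavy_tail_cst_gt0 p alpha beta r : 0 < heavy_tail_cst p alpha beta r.
Proof.
apply: ltr_wpDr; first by rewrite mulr_ge0 ?sqr_ge0.
by apply: ltr_wpDr => //; rewrite mulr_ge0.
Qed.

Lemma exponential_cst_gt0 p alpha beta : 0 < exponential_cst p alpha beta.
Proof. by rewrite divr_gt0 // exprn_gt0 // spread_cst_gt0. Qed.

Lemma polynomial_cst_gt0 p q r : 0 < polynomial_cst p q r.
Proof. by rewrite ltr_wpDl ?moderate_cst_ge0 // powR_gt0 // exprn_gt0 // powR_gt0. Qed.

End Constants.

Section Deviation.
Context {R : realType} {dE : measure_display} {E : measurableType dE} {d : E -> E -> R}.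
Context {dO : measure_display} {O : measurableType dO}.
Variables (x0 : E) (mu : probability E R) (P : probability O R) (n : nat)
  (X : 'I_n -> O -> E) (S : set E) (p alpha beta : R).
Hypotheses (polish_d : polish d) (n_gt0 : (0 < n)%N) (iidX : iid P mu X).
Hypotheses (measurable_S : measurable S) (muS : mu S = 1%E).
Hypotheses (p_ge1 : 1 <= p) (alpha_gt0 : 0 < alpha) (alpha_lt : alpha < 2 * p).
Hypothesis beta_gt0 : 0 < beta.
Hypothesis cover : forall r delta, 0 < r -> 0 < delta -> delta <= 2 * r ->
  (covering_number d (S `&` cball d x0 r) delta <= (beta * (2 * r / delta) `^ alpha)%:E)%E.

Let p_gt0 : 0 < p. Proof. exact: lt_le_trans p_ge1. Qed.

Let n_pos : 0 < n%:R :> R. Proof. by rewrite ltr0n. Qed.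

Local Notation H := (tailH d x0 mu).
Local Notation I := (fine (I2pp d x0 mu p)).
Local Notation wm s := (fine (weak_moment d x0 mu s)).
Local Notation deviation x :=
  (P [set w | (x%:E < Wpp d p (empirical (fun i => X i w)) mu)%E]).

Lemma deviation_le1 x : (deviation x <= 1)%E.
Proof.
apply: probability_le1; case: iidX => mX _ _.
exact: measurable_Wpp_empirical_gt.
Qed.

Lemma exists_centres (rho : R) : 0 < rho ->
  exists ctr : nat -> nat -> seq E, forall k l,
    net d (S `&` cball d x0 (dyadic rho k)) (mesh rho k l) (ctr k l) /\
    (size (ctr k l))%:R <= (beta + 1) * (2 ^+ l) `^ alpha.
Proof.
move=> rho0; have ex (kl : nat * nat) : exists s : seq E,
    net d (S `&` cball d x0 (dyadic rho kl.1)) (mesh rho kl.1 kl.2) s /\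
    (size s)%:R <= (beta + 1) * (2 ^+ kl.2) `^ alpha.
  case: kl => k l /=; have r0 := dyadic_gt0 k rho0; have m0 := mesh_gt0 rho0 k l.
  have l1 : 1 <= 2 ^+ l :> R by rewrite exprn_ege1 // ler1n.
  have [|s s_net s_size] := covering_number_net (cover r0 m0 _).
    by rewrite dyadic_le // mulr_ge0 // ltW.
  exists s; split => //; apply: le_trans s_size _.
  have -> : 2 * dyadic rho k / mesh rho k l = 2 ^+ l.
    by rewrite /mesh {2}/dyadic; field; rewrite !gt_eqF.
  by rewrite mulrDl mul1r lerD2l powR_ge1 // ltW.
have [ctr ctrP] := choice ex.
by exists (fun k l => ctr (k, l)) => k l; exact: (ctrP (k, l)).
Qed.

Definition tail_controlled (k : R) (w : centred_walk R) : Prop :=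
  spread (law w) (step w) <= k /\
  forall u v, 0 <= v -> 2 * k <= u -> 6 * 16 `^ p * v `^ p <= u ->
    jump_prob (law w) (step w) u <= H v.

Definition leaf_cost_bound (refined : bool) : R :=
  if refined then 0 else 16 `^ p * fine (pmoment d x0 mu p).

Section CellWalk.
Variables (rho : R) (K L : nat) (ctr : nat -> nat -> seq E).
Hypothesis rho_gt0 : 0 < rho.
Hypothesis ctr_net : forall k l, net d (S `&` cball d x0 (dyadic rho k)) (mesh rho k l) (ctr k l).
Hypothesis ctr_size_le : forall k l, (size (ctr k l))%:R <= (beta + 1) * (2 ^+ l) `^ alpha.

Let N : nat := \max_(k < K) \max_(l < L.+1) size (ctr k l).

Let ctr_size k l : (k < K)%N -> (l <= L)%N -> (size (ctr k l) <= N)%N.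
Proof.
move=> kK lL; apply: leq_trans (leq_bigmax (Ordinal kK)).
exact: (leq_bigmax (Ordinal (lL : (l < L.+1)%N))).
Qed.

Definition cell_walk : centred_walk R :=
  CentredWalk (cell_mass_ge0 (d := d) (N := N) x0 S rho L ctr mu)
    (cell_mass_sum1 polish_d x0 rho K L N ctr measurable_S mu)
    (node_step_mean0 polish_d x0 rho ctr measurable_S mu p).

Lemma tail_controlled_cell_walk (B e : R) : 0 <= B -> dyadic_sum d x0 mu p rho K <= B ->
  (2 * dyadic rho K) `^ p <= e ->
  tail_controlled (chain_cst p alpha (beta + 1) (0 < L)%N * B + e) cell_walk.
Proof.
move=> B0 sum_le inner_le; have c0 := ltW (chain_cst_gt0 p alpha (beta + 1) (0 < L)%N).
have b1 : 0 <= beta + 1 by rewrite addr_ge0 // ltW.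
have spread_le : node_spread (d := d) x0 S rho K L N ctr mu p <=
    chain_cst p alpha (beta + 1) (0 < L)%N * B + e.
  apply: le_trans (node_spread_le polish_d measurable_S rho_gt0 ctr_net ctr_size mu alpha_lt b1
    (fun k l _ _ => ctr_size_le k l)) _.
  by rewrite lerD // ler_wpM2l // (le_trans _ sum_le) // shell_sum_le.
split => [|u v v0 u_spread u_v]; first by apply: le_trans spread_le; exact: spread_le_node.
apply: (jump_prob_le_tail polish_d measurable_S rho_gt0 p_ge1 v0 _ _ u_v).
  by apply: le_trans u_spread; rewrite ler_wpM2l.
by apply: le_trans u_spread; rewrite ler_wpM2l // (le_trans inner_le) // lerDr mulr_ge0.
Qed.

Lemma deviation_le_cell_walk (e s x y : R) : (2 * dyadic rho K) `^ p <= e ->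
  ((0 < L)%N -> dyadic (8 * rho) L `^ p <= e) -> 0 <= e ->
  p < s -> (weak_moment d x0 mu s < +oo)%E ->
  leaf_cost_bound (0 < L)%N + 2 * e + truncation_cst p s * wm s * rho `^ (p - s) + y <= x ->
  (deviation x <=
   (n%:R * H rho + end_prob (law cell_walk) (step cell_walk) n (n%:R * y) 0)%:E)%E.
Proof.
move=> inner_le mesh_le e0 ps weak_fin xy.
have moment_fin := pmoment_lty polish_d p_ge1 weak_fin ps.
apply: le_trans (deviation_le_walk polish_d measurable_S rho_gt0 ctr_net ctr_size p_ge1
  moment_fin iidX n_gt0 (y := y) _) _; last first.
  by rewrite lee_fin lerD2r ler_wpM2l // cell_mass_None_le.
have outer := outer_cost_le polish_d K L N ctr measurable_S rho_gt0 p_ge1 moment_fin ps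
  weak_fin muS.
have leaf : \sum_t cell_mass (d := d) (K := K) (N := N) x0 S rho L ctr mu t *
    leaf_weight rho L p t <=
    leaf_cost_bound (0 < L)%N + 2 * e.
  rewrite /leaf_cost_bound; have [L0|/mesh_le mesh_e] := posnP L.
    have := leaf_cost_le_moment polish_d K L N ctr measurable_S rho_gt0 p_ge1 moment_fin; lra.
  have := leaf_cost_le_mesh polish_d x0 K L N ctr measurable_S rho_gt0 mu p_ge1; lra.
by move: xy outer leaf; rewrite /truncation_cst -!mulrA; lra.
Qed.

End CellWalk.

Lemma exists_cell_walk (refined : bool) (rho B e : R) : 0 < rho -> 0 < e ->
  (forall K, dyadic_sum d x0 mu p rho K <= B) ->
  exists2 w, tail_controlled (chain_cst p alpha (beta + 1) refined * B + e) w &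
    forall s x y, p < s -> (weak_moment d x0 mu s < +oo)%E ->
      leaf_cost_bound refined + 2 * e + truncation_cst p s * wm s * rho `^ (p - s) + y <= x ->
      (deviation x <= (n%:R * H rho + end_prob (law w) (step w) n (n%:R * y) 0)%:E)%E.
Proof.
move=> rho0 e0 sum_le; have [ctr ctrP] := exists_centres rho0.
have [K Ke] := exists_dyadic_powR_le (mulr_ge0 (ler0n R 2) (ltW rho0)) e0 p_gt0.
have [L0 Le] := exists_dyadic_powR_le (mulr_ge0 (ler0n R 8) (ltW rho0)) e0 p_gt0.
have inner_le : (2 * dyadic rho K) `^ p <= e by rewrite /dyadic mulrA.
have mesh_le : dyadic (8 * rho) L0.+1 `^ p <= e.
  have r0 := dyadic_gt0 L0.+1 (mulr_gt0 (ltr0n R 8) rho0).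
  apply: le_trans Le; rewrite -/(dyadic _ _) ler_powRl ?(ltW p_gt0) ?(ltW r0) //.
  by rewrite [leRHS]dyadicS; lra.
have B0 : 0 <= B by apply: le_trans (sum_le 0%N); rewrite /dyadic_sum big_ord0.
have ctr_net k l := (ctrP k l).1; have ctr_size_le k l := (ctrP k l).2.
pose L := if refined then L0.+1 else 0%N.
have LE : (0 < L)%N = refined by rewrite /L; case: (refined).
exists (cell_walk rho K L ctr); first by rewrite -LE; exact: tail_controlled_cell_walk.
move=> s x y ps weak_fin; rewrite -LE => xy.
apply: deviation_le_cell_walk xy => //; last exact: ltW.
by rewrite /L; case: (refined).
Qed.

Lemma exists_global_walk (refined : bool) (s e : R) : p < s ->
  (weak_moment d x0 mu s < +oo)%E -> (I2pp d x0 mu p < +oo)%E -> 0 < e ->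
  exists2 w, tail_controlled (spread_cst p alpha beta refined * I + e) w &
    forall x y, leaf_cost_bound refined + 3 * e + y <= x ->
      (deviation x <= (e + end_prob (law w) (step w) n (n%:R * y) 0)%:E)%E.
Proof.
move=> ps weak_fin I_fin e0; have wm0 := weak_moment_ge0 weak_fin.
have c0 : 0 <= (n%:R + `|truncation_cst p s|) * wm s by rewrite mulr_ge0 ?addr_ge0.
have [|rho rho1] := exists_powRN_le c0 e0 (p := s - p); first by rewrite subr_gt0.
rewrite opprB !mulrDl => rho_e; have rho0 : 0 < rho by exact: lt_le_trans rho1.
have rho_ge0 : 0 <= rho `^ (p - s) by exact: powR_ge0.
have [w w_ctrl w_dev] := exists_cell_walk refined rho0 e0
  (fun K => dyadic_sum_le_I2pp polish_d p_ge1 K rho0 I_fin).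
exists w; first by rewrite /spread_cst mulrAC mulrC.
move=> x y xy; have out_ge0 : 0 <= `|truncation_cst p s| * wm s * rho `^ (p - s).
  by rewrite !mulr_ge0.
have mass_ge0 : 0 <= n%:R * wm s * rho `^ (p - s) by rewrite !mulr_ge0.
have out_le : truncation_cst p s * wm s * rho `^ (p - s) <= e.
  apply: (@le_trans _ _ (`|truncation_cst p s| * wm s * rho `^ (p - s))); last by lra.
  by rewrite ler_wpM2r // ler_wpM2r // ler_norm.
apply: le_trans (w_dev s x y ps weak_fin _) _; first by lra.
rewrite lee_fin lerD2r; apply: (@le_trans _ _ (n%:R * wm s * rho `^ (p - s))); last by lra.
rewrite -mulrA ler_wpM2l //; apply: le_trans (tailH_le_weak weak_fin rho0) _.
by rewrite ler_wpM2l // ler_powR // lerDr ltW.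
Qed.

Lemma end_prob_le_controlled k w x : tail_controlled k w -> 0 < x ->
  end_prob (law w) (step w) n (n%:R * (x / 2)) 0 <= 4 / (n%:R * x ^+ 2) * k ^+ 2.
Proof.
move=> [spread_le _] x_gt0; have nx0 : 0 < n%:R * (x / 2) by rewrite mulr_gt0 ?divr_gt0.
apply: le_trans (end_prob_le_spread (law_ge0 w) (law_sum1 w) (step_mean0 w) n nx0) _.
rewrite [leLHS](_ : _ = 4 / (n%:R * x ^+ 2) * spread (law w) (step w) ^+ 2); last first.
  by field; rewrite !gt_eqF.
apply: ler_wpM2l; first by rewrite divr_ge0 // mulr_ge0 // sqr_ge0.
by rewrite lerXn2r ?nnegrE ?(le_trans (spread_ge0 _ _) spread_le) // spread_ge0.
Qed.

Lemma deviation_second_moment x : (I2pp d x0 mu p < +oo)%E -> 0 < x ->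
  (deviation x <= (second_moment_cst p alpha beta * I ^+ 2 / (x ^+ 2 * n%:R))%:E)%E.
Proof.
move=> I_fin x_gt0; have weak_fin := weak_moment_lty polish_d p_ge1 I_fin.
have p2 : p < 2 * p by rewrite ltr_pMl // ltr1n.
rewrite (_ : _ / _ = 0 + 4 / (n%:R * x ^+ 2) * (spread_cst p alpha beta true * I) ^+ 2); last first.
  by rewrite /second_moment_cst; field; rewrite !gt_eqF.
apply: (lee_sqr_affine (b := 1) (d := x / 6)) => [|e e0 ex]; first by rewrite divr_gt0.
have [w w_ctrl w_dev] := exists_global_walk true p2 weak_fin I_fin e0.
apply: le_trans (w_dev x (x / 2) _) _; first by rewrite /leaf_cost_bound; lra.
by rewrite lee_fin add0r mul1r lerD2l end_prob_le_controlled.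
Qed.

Section HeavyTail.
Variables (r x : R).
Hypotheses (r_gt1 : 1 < r) (r_lt2 : r < 2) (x_gt0 : 0 < x).
Hypothesis weak_fin : (weak_moment d x0 mu (r * p) < +oo)%E.

Let rho : R := (n%:R * x) `^ p^-1.

Let D : R := (x `^ r * n%:R `^ (r - 1))^-1.

Let nx_gt0 : 0 < n%:R * x. Proof. exact: mulr_gt0. Qed.

Let rho_powR a : rho `^ (a * p) = (n%:R * x) `^ a.
Proof. by rewrite /rho -powRrM; congr (_ `^ _); field; rewrite gt_eqF. Qed.

Let rho_mass : n%:R * rho `^ (- (r * p)) = D.
Proof.
rewrite -mulNr rho_powR /D powRN powRM ?(ltW x_gt0) // gt0_powRD // powRN powRr1 //.
by field; rewrite !gt_eqF ?powR_gt0.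
Qed.

Let rho_outer : rho `^ (p - r * p) = x * D.
Proof.
rewrite -rho_mass -{1}[p]mul1r -mulrBl -mulNr !rho_powR gt0_powRD // powRr1 ?(ltW nx_gt0) //.
by ring.
Qed.

Let rho_spread : (rho `^ (p - r * p / 2)) ^+ 2 = n%:R * x ^+ 2 * D.
Proof.
rewrite -powR_mulrn ?powR_ge0 // -powRrM (_ : _ * 2 = (2 - r) * p); last by field.
rewrite rho_powR gt0_powRD // powR_mulrn ?(ltW nx_gt0) // -rho_mass -mulNr rho_powR.
by ring.
Qed.

(* The radius [rho], with [rho ^ p = n x], balances the mass outside the ball against the
   second moment of the walk inside. *)
Lemma deviation_heavy_tail :
  (deviation x <=
   (heavy_tail_cst p alpha beta r * wm (r * p) / (x `^ r * n%:R `^ (r - 1)))%:E)%E.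
Proof.
have wm0 := weak_moment_ge0 weak_fin; set W := wm _ in wm0 *; rewrite -/D -mulrA.
have rho0 : 0 < rho by rewrite powR_gt0.
have ps : p < r * p by rewrite ltr_pMl.
have sp : r * p < 2 * p by rewrite ltr_pM2r.
have D0 : 0 <= W * D by rewrite mulr_ge0 // invr_ge0 mulr_ge0 ?powR_ge0.
set T := truncation_cst p (r * p).
have [trivial|small] := lerP 1 (4 * `|T| * (W * D)).
  apply: le_trans (deviation_le1 x) _; rewrite lee_fin; apply: le_trans trivial _.
  by rewrite ler_wpM2r //; apply: ler_wpDr; [rewrite mulr_ge0 ?sqr_ge0|rewrite lerDr].
pose a := chain_cst p alpha (beta + 1) true *
  (weak_dyadic_cst p (r * p) * (Num.sqrt W * rho `^ (p - r * p / 2))).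
apply: (@le_trans _ _ (W * D + 4 / (n%:R * x ^+ 2) * a ^+ 2)%:E).
  apply: (lee_sqr_affine (b := 0) (d := x / 8)) => [|e e0 ex]; first by rewrite divr_gt0.
  have [w w_ctrl w_dev] := exists_cell_walk true rho0 e0
    (fun K => dyadic_sum_le_weak weak_fin K sp rho0).
  apply: le_trans (w_dev (r * p) x (x / 2) ps weak_fin _) _.
    have : T * (W * D) * x <= x / 4.
      apply: (@le_trans _ _ (`|T| * (W * D) * x)).
        by rewrite !ler_wpM2r ?ler_norm ?(ltW x_gt0).
      by rewrite mulrC ler_pM2l //; lra.
    by rewrite /leaf_cost_bound rho_outer -/T -/W; lra.
  rewrite mul0r addr0 lee_fin lerD //; last exact: end_prob_le_controlled.
  by rewrite -rho_mass mulrCA ler_wpM2l // tailH_le_weak.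
have a_sqr : a ^+ 2 = (chain_cst p alpha (beta + 1) true * weak_dyadic_cst p (r * p)) ^+ 2 *
    (W * (n%:R * x ^+ 2 * D)).
  by rewrite /a mulrA exprMn [in LHS](exprMn 2 (Num.sqrt W)) sqr_sqrtr // rho_spread.
rewrite lee_fin a_sqr [leLHS](_ : _ = (1 + 4 * (chain_cst p alpha (beta + 1) true *
  weak_dyadic_cst p (r * p)) ^+ 2) * (W * D)); last by field; rewrite !gt_eqF.
by rewrite ler_wpM2r // lerD2r lerDl mulr_ge0.
Qed.

End HeavyTail.

Lemma normalized_powR (a q x : R) : 0 <= a -> 0 < x ->
  a `^ q / (x `^ q * n%:R `^ (q / 2)) = (a / (x * Num.sqrt n%:R)) `^ q.
Proof.
move=> a0 x_gt0; have xn0 : 0 <= x * Num.sqrt n%:R by rewrite mulr_ge0 ?sqrtr_ge0 // ltW.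
rewrite powRM ?invr_ge0 // powRV // powRM ?sqrtr_ge0 ?(ltW x_gt0) //.
by rewrite -powR12_sqrt // -powRrM [2^-1 * q]mulrC.
Qed.

Section ModerateWalk.
Variables (w : centred_walk R) (k u q r x : R).
Hypotheses (w_ctrl : tail_controlled k w) (x_gt0 : 0 < x) (u_ge0 : 0 <= u) (q_gt0 : 0 < q).
Hypothesis k_le : k ^+ 2 <= u * (n%:R * x ^+ 2).
Hypothesis weak_fin : (weak_moment d x0 mu (r * p) < +oo)%E.

Let j : nat := hj_order q.

Definition hj_level : R := n%:R * x / (2 * 4 ^+ j).

Let nx2_gt0 : 0 < n%:R * x ^+ 2. Proof. by rewrite mulr_gt0 // exprn_gt0. Qed.

Let spread_le : spread (law w) (step w) <= k := w_ctrl.1.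

Let k_ge0 : 0 <= k. Proof. exact: le_trans (spread_ge0 _ _) spread_le. Qed.

Lemma hj_level_gt0 : 0 < hj_level.
Proof. by rewrite divr_gt0 // mulr_gt0. Qed.

Lemma hj_level_sqr : hj_level ^+ 2 = n%:R * (n%:R * x ^+ 2) / (4 * 16 ^+ j).
Proof.
have -> : 16 ^+ j = 4 ^+ j ^+ 2 :> R by rewrite exprAC; congr (_ ^+ j); ring.
by rewrite /hj_level; field; rewrite gt_eqF.
Qed.

Lemma controlled_le_level : 32 * 16 ^+ j * u <= 1 -> 2 * k <= hj_level.
Proof.
move=> u_small; rewrite -(@ler_pXn2r _ 2) ?nnegrE ?(ltW hj_level_gt0) ?mulr_ge0 //.
rewrite hj_level_sqr ler_pdivlMr ?mulr_gt0 ?exprn_gt0 // exprMn.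
have n1 : 1 <= n%:R :> R by rewrite ler1n.
have : 16 * 16 ^+ j * k ^+ 2 <= 16 * 16 ^+ j * (u * (n%:R * x ^+ 2)).
  by rewrite ler_wpM2l // mulr_ge0 // exprn_ge0.
have := ler_wpM2r (ltW nx2_gt0) u_small; have := ler_wpM2r (ltW nx2_gt0) n1.
move: nx2_gt0; lra.
Qed.

Lemma max_prob_le_level :
  max_prob (law w) (step w) n hj_level 0 <= 32 * 16 ^+ j * u.
Proof.
apply: le_trans (max_prob_le_spread (law_ge0 w) (law_sum1 w) (step_mean0 w) n hj_level_gt0) _.
have sixteen_gt0 : 0 < 16 ^+ j :> R by exact: exprn_gt0.
rewrite hj_level_sqr [leLHS](_ : _ = 32 * 16 ^+ j *
    (spread (law w) (step w) ^+ 2 / (n%:R * x ^+ 2))); last by field; rewrite !gt_eqF.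
rewrite ler_wpM2l ?mulr_ge0 ?(ltW sixteen_gt0) // ler_pdivrMr //; apply: le_trans k_le.
by rewrite lerXn2r ?nnegrE ?spread_ge0.
Qed.

Lemma max_prob_level_powR : 32 * 16 ^+ j * u <= 1 ->
  max_prob (law w) (step w) n hj_level 0 ^+ (2 ^ j) <= (32 * 16 ^+ j) `^ q * u `^ q.
Proof.
set v := 32 * 16 ^+ j * u; have c0 : 0 <= 32 * 16 ^+ j :> R by rewrite mulr_ge0 // exprn_ge0.
have v0 : 0 <= v by rewrite mulr_ge0.
move=> v1; rewrite -powRM // -/v; apply: (@le_trans _ _ (v `^ (2 ^ j)%:R)).
  rewrite powR_mulrn // lerXn2r ?nnegrE ?max_prob_le_level //.
  exact: max_prob_ge0 (law_ge0 w) _ _ _.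
have [->|v_neq0] := eqVneq v 0; first by rewrite !powR0 ?gt_eqF // ltr0n expn_gt0.
rewrite /powR (negbTE v_neq0) ler_expR ler_wnM2r ?ln_le0 //.
by rewrite natrX ltW //; exact: upper_nthrootP.
Qed.

Lemma jump_prob_le_level : 2 * k <= hj_level ->
  n%:R * jump_prob (law w) (step w) hj_level <=
  (12 * 4 ^+ j * 16 `^ p) `^ r * (wm (r * p) / (x `^ r * n%:R `^ (r - 1))).
Proof.
move=> k_level; have c0 : 0 < 16 `^ p :> R by rewrite powR_gt0.
set c := 12 * 4 ^+ j * 16 `^ p; have cpos : 0 < c by rewrite !mulr_gt0.
pose v := (n%:R * x / c) `^ p^-1.
have nxc0 : 0 < n%:R * x / c by rewrite divr_gt0 // mulr_gt0.
have v0 : 0 < v by rewrite powR_gt0.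
have vp : v `^ p = n%:R * x / c by rewrite /v powRK ?gt_eqF // ltW.
have jump_le : jump_prob (law w) (step w) hj_level <= H v.
  apply: w_ctrl.2 => //; first exact: ltW.
  rewrite vp le_eqVlt; apply/orP; left; apply/eqP.
  by rewrite /c /hj_level; field; rewrite !gt_eqF.
apply: le_trans (ler_wpM2l (ltW n_pos) (le_trans jump_le (tailH_le_weak weak_fin v0))) _.
have -> : v `^ (- (r * p)) = c `^ r * ((n%:R * x) `^ r)^-1.
  rewrite [r * p]mulrC -mulrN powRrM vp powRN.
  rewrite powRM ?invr_ge0 ?mulr_ge0 ?(ltW x_gt0) ?(ltW cpos) // powRV ?(ltW cpos) //.
  by rewrite invfM invrK mulrC.
rewrite powRM ?(ltW x_gt0) // gt0_powRD // powRN powRr1 //.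
by rewrite le_eqVlt; apply/orP; left; apply/eqP; field; rewrite !gt_eqF ?powR_gt0.
Qed.

Lemma end_prob_le_moderate :
  end_prob (law w) (step w) n (n%:R * (x / 2)) 0 <=
  moderate_cst p q r * (u `^ q + wm (r * p) / (x `^ r * n%:R `^ (r - 1))).
Proof.
have wm0 := weak_moment_ge0 weak_fin; have C1 := hj_cst_ge1 (R := R) j.
set W := wm _ / _; have W0 : 0 <= W by rewrite divr_ge0 // mulr_ge0 ?powR_ge0.
have uq0 : 0 <= u `^ q by exact: powR_ge0.
apply: (@le_trans _ _ (hj_cst j * ((32 * 16 ^+ j) `^ q * u `^ q +
    (12 * 4 ^+ j * 16 `^ p) `^ r * W))); last first.
  rewrite /moderate_cst -[leRHS]mulrA ler_wpM2l ?(le_trans ler01 C1) //.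
  have sum_le (a b : R) : 0 <= a -> 0 <= b -> a * u `^ q + b * W <= (a + b) * (u `^ q + W).
    by move=> a0 b0; rewrite mulrDl lerD // ler_wpM2l // ?lerDl ?lerDr.
  by rewrite sum_le ?powR_ge0.
apply: le_trans (end_prob_le_max _ (law_ge0 w) (law_sum1 w) _ _ _) _.
have [u_small|u_large] := lerP (32 * 16 ^+ j * u) 1; last first.
  apply: le_trans (max_prob_le1 _ (law_ge0 w) (law_sum1 w) _ _ _) _.
  apply: mulr_ege1 => //; apply: ler_wpDr; first by rewrite mulr_ge0 ?powR_ge0.
  by rewrite -powRM ?mulr_ge0 ?exprn_ge0 // powR_ge1 // ltW.
have -> : n%:R * (x / 2) = 4 ^+ j * hj_level by rewrite /hj_level; field; rewrite gt_eqF.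
apply: le_trans (max_prob_iter _ (law_ge0 w) (law_sum1 w) _ _ (ltW hj_level_gt0)) _.
rewrite ler_wpM2l ?(le_trans ler01 C1) // lerD ?max_prob_level_powR //.
by rewrite jump_prob_le_level ?controlled_le_level.
Qed.

End ModerateWalk.

Section Moderate.
Variables (refined : bool) (q r x : R).
Hypotheses (r_gt1 : 1 < r) (q_gt0 : 0 < q) (x_gt0 : 0 < x).
Hypothesis weak_fin : (weak_moment d x0 mu (r * p) < +oo)%E.
Hypothesis I_fin : (I2pp d x0 mu p < +oo)%E.
Hypothesis leaf_le : leaf_cost_bound refined <= x / 4.

Local Notation K := (spread_cst p alpha beta refined).
Local Notation W := (wm (r * p) / (x `^ r * n%:R `^ (r - 1))).

Let sqrt_n_gt0 : 0 < Num.sqrt n%:R :> R. Proof. by rewrite sqrtr_gt0. Qed.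

Lemma deviation_moderate_above u : 0 <= u -> I < u * (x * Num.sqrt n%:R) -> K ^+ 2 * u <= 1 ->
  (deviation x <= (moderate_cst p q r * (u `^ q + W))%:E)%E.
Proof.
move=> u0 I_lt Ku; have ps : p < r * p by rewrite ltr_pMl.
have I0 : 0 <= I by exact: fine_I2pp_ge0.
have K1 : 1 <= K by apply: spread_cst_ge1; exact: ltW.
apply/lee_addgt0Pr => e e0.
have [e1 [e1_gt0 e1_e e1_x e1_I]] : exists e1 : R,
    [/\ 0 < e1, e1 <= e, e1 <= x / 12 & e1 <= u * (x * Num.sqrt n%:R) - I].
  exists (Num.min e (Num.min (x / 12) (u * (x * Num.sqrt n%:R) - I))).
  by rewrite !ge_min !lexx !orbT !lt_min e0 subr_gt0 I_lt divr_gt0.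
have [w w_ctrl w_dev] := exists_global_walk refined ps weak_fin I_fin e1_gt0.
apply: le_trans (w_dev x (x / 2) _) _; first by move: leaf_le; lra.
rewrite -EFinD lee_fin addrC lerD //; apply: end_prob_le_moderate w_ctrl _ _ _ _ _ => //.
have k_le : K * I + e1 <= K * (u * (x * Num.sqrt n%:R)).
  apply: (@le_trans _ _ (K * I + K * e1)); first by rewrite lerD2l ler_peMl // ltW.
  by rewrite -mulrDr ler_wpM2l ?(le_trans ler01 K1) //; lra.
apply: (@le_trans _ _ ((K * (u * (x * Num.sqrt n%:R))) ^+ 2)).
  have K0 := le_trans ler01 K1; have Ku0 : 0 <= K * (u * (x * Num.sqrt n%:R)).
    by rewrite mulr_ge0 // mulr_ge0 // mulr_ge0 // ltW.
  by rewrite lerXn2r ?nnegrE // addr_ge0 ?(ltW e1_gt0) // mulr_ge0.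
rewrite (_ : _ ^+ 2 = K ^+ 2 * u * (u * (Num.sqrt n%:R ^+ 2 * x ^+ 2))); last by ring.
by rewrite sqr_sqrtr // ler_piMl // mulr_ge0 // mulr_ge0 // sqr_ge0.
Qed.

Lemma deviation_moderate : K ^+ 2 * (I / (x * Num.sqrt n%:R)) < 1 ->
  (deviation x <= (moderate_cst p q r * (I `^ q / (x `^ q * n%:R `^ (q / 2)) + W))%:E)%E.
Proof.
have I0 : 0 <= I by exact: fine_I2pp_ge0.
have K2_gt0 : 0 < K ^+ 2 by rewrite exprn_gt0 // spread_cst_gt0.
have xn0 : 0 < x * Num.sqrt n%:R by rewrite mulr_gt0.
rewrite normalized_powR //; set t := I / _ => Kt.
have t0 : 0 <= t by rewrite divr_ge0 // ltW.
have t_lt : t < (K ^+ 2)^-1 by rewrite -[ltRHS]mul1r ltr_pdivlMr // mulrC.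
rewrite -[moderate_cst _ _ _ * _](addr0) -[X in _ + X](mul0r (0 ^+ 2)).
apply: (lee_sqr_affine (b := moderate_cst p q r) ltr01) => e e0 _.
have [u [tu uK u_le]] := exists_powR_between t0 t_lt e0 q_gt0.
apply: le_trans (deviation_moderate_above (le_trans t0 (ltW tu)) _ _) _.
- by rewrite -ltr_pdivrMr.
- by rewrite mulrC -ler_pdivlMr // mul1r.
rewrite lee_fin mul0r addr0 -mulrDr ler_wpM2l ?moderate_cst_ge0 //; lra.
Qed.

End Moderate.

Section LightTail.
Variables (q r x : R).
Hypotheses (r_gt2 : 2 < r) (q_gt : r < q) (x_gt0 : 0 < x).
Hypothesis weak_fin : (weak_moment d x0 mu (r * p) < +oo)%E.

Local Notation decay := (I `^ q / (x `^ q * n%:R `^ (q / 2)) +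
  wm (r * p) / (x `^ r * n%:R `^ (r - 1))).

Let r_gt1 : 1 < r. Proof. by apply: lt_trans r_gt2; rewrite ltr1n. Qed.

Let q_gt0 : 0 < q. Proof. by apply: lt_trans q_gt; apply: lt_trans r_gt1. Qed.

Let I_fin : (I2pp d x0 mu p < +oo)%E.
Proof. by apply: I2pp_lty weak_fin _ => //; rewrite ltr_pM2r. Qed.

Let I_ge0 : 0 <= I. Proof. exact: fine_I2pp_ge0. Qed.

Let xn_gt0 : 0 < x * Num.sqrt n%:R. Proof. by rewrite mulr_gt0 // sqrtr_gt0. Qed.

Let walk_decay_ge0 : 0 <= I `^ q / (x `^ q * n%:R `^ (q / 2)).
Proof. by rewrite divr_ge0 ?powR_ge0 // mulr_ge0 ?powR_ge0. Qed.

Let jump_decay_ge0 : 0 <= wm (r * p) / (x `^ r * n%:R `^ (r - 1)).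
Proof. by rewrite divr_ge0 ?(weak_moment_ge0 weak_fin) // mulr_ge0 ?powR_ge0. Qed.

Lemma deviation_polynomial refined : leaf_cost_bound refined <= x / 4 ->
  spread_cst p alpha beta refined ^+ 2 * (I / (x * Num.sqrt n%:R)) < 1 ->
  (deviation x <= (polynomial_cst p q r * decay)%:E)%E.
Proof.
move=> leaf_le ratio_lt.
apply: le_trans (deviation_moderate r_gt1 q_gt0 x_gt0 weak_fin I_fin leaf_le ratio_lt) _.
by rewrite lee_fin ler_wpM2r ?addr_ge0 // lerDl powR_ge0.
Qed.

Lemma deviation_unrefined : leaf_cost_bound false <= x / 4 ->
  (deviation x <= (polynomial_cst p q r * decay)%:E)%E.
Proof.
move=> leaf_le.
have [ratio_ge|ratio_lt] := lerP 1 ((8 `^ p) ^+ 2 * (I / (x * Num.sqrt n%:R))); last first.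
  by apply: deviation_polynomial leaf_le _; rewrite spread_cst_unrefined.
apply: le_trans (deviation_le1 x) _; rewrite lee_fin.
apply: (@le_trans _ _ (((8 `^ p) ^+ 2) `^ q * (I `^ q / (x `^ q * n%:R `^ (q / 2))))).
  rewrite normalized_powR // -powRM ?sqr_ge0 ?divr_ge0 ?(ltW xn_gt0) //.
  by rewrite powR_ge1 // ltW.
by apply: ler_pM; rewrite ?powR_ge0 // ?lerDr ?moderate_cst_ge0 ?lerDl.
Qed.

Lemma deviation_refined :
  (deviation x <= (expR 2 * expR (- (n%:R * exponential_cst p alpha beta * (x / I) ^+ 2)) +
    polynomial_cst p q r * decay)%:E)%E.
Proof.
have poly_ge0 : 0 <= polynomial_cst p q r * decay.
  by apply: mulr_ge0; [rewrite ltW // polynomial_cst_gt0|rewrite addr_ge0].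
have K2_gt0 : 0 < spread_cst p alpha beta true ^+ 2 by rewrite exprn_gt0 // spread_cst_gt0.
set K2 := _ ^+ 2 in K2_gt0.
have [ratio_ge|ratio_lt] := lerP 1 (K2 * (I / (x * Num.sqrt n%:R))); last first.
  apply: le_trans (deviation_polynomial (refined := true) _ ratio_lt) _.
    by rewrite divr_ge0 // ltW.
  by rewrite lee_fin lerDr mulr_ge0 ?expR_ge0.
have I_gt0 : 0 < I.
  rewrite lt_neqAle I_ge0 andbT eq_sym; apply: contraL ratio_ge => /eqP ->.
  by rewrite mul0r mulr0 ler10.
apply: le_trans (deviation_le1 x) _; rewrite lee_fin -expRD ler_wpDr //.
rewrite -[leLHS]expR0 ler_expR subr_ge0.
rewrite (_ : n%:R * _ * _ = 2 * (x * Num.sqrt n%:R / (K2 * I)) ^+ 2); last first.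
  rewrite -[in LHS](sqr_sqrtr (ltW n_pos)) /exponential_cst -[4%N]/(2 * 2)%N exprM -/K2.
  by field; rewrite !gt_eqF.
have KI_gt0 : 0 < K2 * I by exact: mulr_gt0.
rewrite -[leRHS]mulr1 ler_wpM2l // exprn_ile1 ?divr_ge0 ?(ltW KI_gt0) ?(ltW xn_gt0) //.
by move: ratio_ge; rewrite mulrA ler_pdivlMr // mul1r ler_pdivrMr ?mul1r.
Qed.

Lemma deviation_exponential :
  (deviation x <= (expR 2 * expR (- (n%:R * exponential_cst p alpha beta * (x / I) ^+ 2)) *
      (if (x%:E <= (4 * 16 `^ p)%:E * pmoment d x0 mu p)%E then 1 else 0) +
    polynomial_cst p q r * decay)%:E)%E.
Proof.
case: ifPn => [_|x_large]; first by rewrite mulr1; exact: deviation_refined.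
rewrite mulr0 add0r; apply: deviation_unrefined.
have ps : p < r * p by rewrite ltr_pMl.
have pmE : pmoment d x0 mu p = (fine (pmoment d x0 mu p))%:E.
  rewrite fineK // ge0_fin_numE; first exact: pmoment_lty weak_fin ps.
  by apply: integral_ge0 => y _; exact: cost_ge0.
by move: x_large; rewrite -ltNge pmE -EFinM lte_fin /leaf_cost_bound; lra.
Qed.

End LightTail.

End Deviation.

Theorem theorem2 (R : realType) :
  (* ---------------- part (1) ---------------- *)
  (exists (C1 : R -> R -> R -> R) (Cp : R -> R) (C3 : R -> R -> R -> R),
    [/\ (forall a b c, 0 < C1 a b c), (forall a, 0 < Cp a), (forall a b c, 0 < C3 a b c) &
    forall (dE : measure_display) (E : measurableType dE) (d : E -> E -> R) (x0 : E)
      (mu : probability E R) (dO : measure_display) (O : measurableType dO)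
      (P : probability O R) (n : nat) (X : 'I_n -> O -> E) (S : set E) (p alpha beta : R),
      polish d -> (0 < n)%N -> iid P mu X -> measurable S -> mu S = 1%E ->
      1 <= p -> 0 < alpha -> alpha < 2 * p -> 0 < beta ->
      (forall r delta, 0 < r -> 0 < delta -> delta <= 2 * r ->
         (covering_number d (S `&` cball d x0 r) delta <= (beta * (2 * r / delta) `^ alpha)%:E)%E) ->
      forall r, 2 < r -> (weak_moment d x0 mu (r * p) < +oo)%E ->
      forall q, r < q -> forall x, 0 < x ->
      (P [set w | (x%:E < Wpp d p (empirical (fun i => X i w)) mu)%E] <=
        (expR 2 * expR (- (n%:R * C1 p alpha beta * (x / fine (I2pp d x0 mu p)) ^+ 2))
            * (if (x%:E <= (Cp p)%:E * pmoment d x0 mu p)%E then 1 else 0)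
         + C3 p q r * ((fine (I2pp d x0 mu p)) `^ q / (x `^ q * n%:R `^ (q / 2))
                       + fine (weak_moment d x0 mu (r * p)) / (x `^ r * n%:R `^ (r - 1))))%:E)%E])
  /\
  (* ---------------- part (2) ---------------- *)
  (exists C : R -> R -> R -> R,
    (forall a b c, 0 < C a b c) /\
    forall (dE : measure_display) (E : measurableType dE) (d : E -> E -> R) (x0 : E)
      (mu : probability E R) (dO : measure_display) (O : measurableType dO)
      (P : probability O R) (n : nat) (X : 'I_n -> O -> E) (S : set E) (p alpha beta : R),
      polish d -> (0 < n)%N -> iid P mu X -> measurable S -> mu S = 1%E ->
      1 <= p -> 0 < alpha -> alpha < 2 * p -> 0 < beta ->
      (forall r delta, 0 < r -> 0 < delta -> delta <= 2 * r ->
         (covering_number d (S `&` cball d x0 r) delta <= (beta * (2 * r / delta) `^ alpha)%:E)%E) ->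
      (I2pp d x0 mu p < +oo)%E ->
      forall x, 0 < x ->
      (P [set w | (x%:E < Wpp d p mu (empirical (fun i => X i w)))%E] <=
        (C p alpha beta * (fine (I2pp d x0 mu p)) ^+ 2 / (x ^+ 2 * n%:R))%:E)%E)
  /\
  (* ---------------- part (3) ---------------- *)
  (exists C : R -> R -> R -> R -> R,
    (forall a b c e, 0 < C a b c e) /\
    forall (dE : measure_display) (E : measurableType dE) (d : E -> E -> R) (x0 : E)
      (mu : probability E R) (dO : measure_display) (O : measurableType dO)
      (P : probability O R) (n : nat) (X : 'I_n -> O -> E) (S : set E) (p alpha beta : R),
      polish d -> (0 < n)%N -> iid P mu X -> measurable S -> mu S = 1%E ->
      1 <= p -> 0 < alpha -> alpha < 2 * p -> 0 < beta ->
      (forall r delta, 0 < r -> 0 < delta -> delta <= 2 * r ->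
         (covering_number d (S `&` cball d x0 r) delta <= (beta * (2 * r / delta) `^ alpha)%:E)%E) ->
      forall r, 1 < r -> r < 2 -> (weak_moment d x0 mu (r * p) < +oo)%E ->
      forall x, 0 < x ->
      (P [set w | (x%:E < Wpp d p mu (empirical (fun i => X i w)))%E] <=
        (C p alpha beta r * fine (weak_moment d x0 mu (r * p)) / (x `^ r * n%:R `^ (r - 1)))%:E)%E).
Proof.
split; [|split].
- exists exponential_cst, (fun p => 4 * 16 `^ p), polynomial_cst; split.
  + exact: exponential_cst_gt0.
  + by move=> p; rewrite mulr_gt0 // powR_gt0.
  + exact: polynomial_cst_gt0.
  move=> dE E d x0 mu dO O P n X S p alpha beta polish_d n_gt0 iidX mS muS p_ge1 alpha_gt0.
  move=> alpha_lt beta_gt0 cover r r_gt2 weak_fin q q_gt x x_gt0.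
  exact: (deviation_exponential polish_d n_gt0 iidX mS muS _ _ alpha_lt _ cover).
- exists second_moment_cst; split; first exact: second_moment_cst_gt0.
  move=> dE E d x0 mu dO O P n X S p alpha beta polish_d n_gt0 iidX mS muS p_ge1 alpha_gt0.
  move=> alpha_lt beta_gt0 cover I_fin x x_gt0; under eq_set do rewrite (Wpp_sym polish_d).
  exact: (deviation_second_moment polish_d n_gt0 iidX mS muS _ _ alpha_lt _ cover).
- exists heavy_tail_cst; split; first exact: heavy_tail_cst_gt0.
  move=> dE E d x0 mu dO O P n X S p alpha beta polish_d n_gt0 iidX mS muS p_ge1 alpha_gt0.
  move=> alpha_lt beta_gt0 cover r r_gt1 r_lt2 weak_fin x x_gt0.
  under eq_set do rewrite (Wpp_sym polish_d).
  exact: (deviation_heavy_tail polish_d n_gt0 iidX mS muS _ _ alpha_lt _ cover).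
Qed.
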